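(* Suppose $\mathbf{w}$ has type I. Point the random $\mathcal{R}$-enriched plane tree $(\mathcal{T}_n,\beta_n)$ at a uniformly random vertex $v_0$ (independent given the tree) and for $k\ge0$ let $\mathsf{H}_k=f_k((\mathcal{T}_n,\beta_n),v_0)$. (1) For each fixed $k\ge1$, $\mathsf{H}_k$ converges in distribution to $f_k(\mathcal{T}^*,\beta^* )$, as random elements of the countable set of finite pointed enriched plane trees (together with $\diamond$) equipped with the discrete topology, as $n\to\infty$ with $n\equiv1\bmod\mathsf{span}(\mathbf{w})$. (2) If $\mathbf{w}$ has type I$\alpha$, then for every sequence $k_n=o(\sqrt n)$ of non-negative integers, $d_{\mathrm{TV}}(\mathsf{H}_{k_n},f_{k_n}(\mathcal{T}^*,\beta^* ))\to0$ as $n\to\infty$ with $n\equiv1\bmod\mathsf{span}(\mathbf{w})$.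
   Context: Let $\mathcal{R}^\kappa$ be a weighted species (finite sets $\mathcal{R}[U]$, functorial transport, relabelling-invariant weights $\kappa\ge0$), $|\mathcal{R}[k]|_\kappa=\sum_{R\in\mathcal{R}[\{1,\dots,k\}]}\kappa(R)$, $\mathbf{w}=(\omega_k)$ with $\omega_k=|\mathcal{R}[k]|_\kappa/k!$, assumed $\omega_0>0$ and $\omega_k>0$ for some $k\ge2$; $\mathsf{span}(\mathbf{w})=\gcd\{k:\omega_k>0\}$. $\mathcal{T}_n$ is the plane tree with $n$ vertices drawn with probability proportional to $\prod_v\omega_{d^+(v)}$; $(\mathcal{T}_n,\beta_n)$ is obtained by choosing, conditionally independently for each vertex $v$, $\beta_n(v)\in\mathcal{R}[\{1,\dots,d^+(v)\}]$ with probability proportional to $\kappa$ (label $i$ = $i$-th child). Let $\phi(z)=\sum_k\omega_kz^k$ with radius $\rho_\phi$; if $\rho_\phi>0$, $\psi(t)=t\phi'(t)/\phi(t)$ and $\nu=\lim_{t\uparrow\rho_\phi}\psi(t)$, else $\nu=0$; if $\nu\ge1$, $\tau$ is the unique solution in $(0,\rho_\phi]$ of $\psi(\tau)=1$, else $\tau=\rho_\phi$; $\pi_k=\tau^k\omega_k/\phi(\tau)$ has mean $\min(\nu,1)$ and variance $\sigma^2=\tau\psi'(\tau)$. Type I: $\nu\ge1$; type I$\alpha$: $\nu\ge1$ and $\sigma^2<\infty$. Let $\mathcal{T}$ be a Galton--Watson tree with offspring law $(\pi_k)$, and $\hat\xi$ with $\mathbb{P}(\hat\xi=k)=k\pi_k$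 (a.s. finite in type I). The tree $(\mathcal{T}^*,\beta^* )$ (type I): it has a backwards-growing spine $u_0,u_1,u_2,\dots$; $u_0$ is the root of an independent copy of $\mathcal{T}$; for $i\ge1$, $u_i$ has an independent copy of $\hat\xi$ ordered children, one uniformly chosen child is identified with $u_{i-1}$, and all other children are roots of independent copies of $\mathcal{T}$. Each vertex $v$ independently gets $\beta^*(v)\in\mathcal{R}[\{1,\dots,d^+(v)\}]$ with probability proportional to $\kappa$, matched in order with the children of $v$. For a pointed enriched plane tree $(A,x)$ and $k\ge0$, $f_k(A,x)$ is the enriched fringe subtree of $A$ rooted at the $k$-th ancestor of $x$ (the maximal enriched subtree consisting of that ancestor and all its descendants, with their structures), considered as pointed at $x$; if $x$ has height less than $k$, $f_k(A,x)=\diamond$ (a placeholder). For $(\mathcal{T}^*,\beta^* )$, $f_k$ is taken with respect to $x=u_0$, so $f_k(\mathcal{T}^*,\beta^* )$ is the fringe subtree at $u_k$ pointed at $u_0$. $d_{\mathrm{TV}}$ is total variation distance. *)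

(* Defs.v *)
From Stdlib Require Import Reals List Arith ClassicalEpsilon.
Open Scope R_scope.

Definition sum_list {X : Type} (f : X -> R) (l : list X) : R :=
  fold_right (fun x acc => f x + acc) 0 l.

Definition enumerates {X : Type} (P : X -> Prop) (l : list X) : Prop :=
  NoDup l /\ forall x, In x l <-> P x.

Definition fsum {X : Type} (P : X -> Prop) (f : X -> R) : R :=
  match excluded_middle_informative (exists l, enumerates P l) with
  | left H => sum_list f (proj1_sig (constructive_indefinite_description _ H))
  | right _ => 0
  end.

Definition ind (P : Prop) : R :=
  if excluded_middle_informative P then 1 else 0.

(* unordered (net) summation over an arbitrary (here countable) type:
   sum_x f x = s *)
Definition usum {X : Type} (f : X -> R) (s : R) : Prop :=
  forall eps, 0 < eps -> exists l0 : list X,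
    forall l, NoDup l -> incl l0 l -> Rabs (sum_list f l - s) < eps.

(* d_TV(P,Q) <= eps, with d_TV = 1/2 sum_x |P x - Q x| (sum of nonnegative
   terms = sup of finite partial sums) *)
Definition tv_le {X : Type} (P Q : X -> R) (eps : R) : Prop :=
  forall l : list X, NoDup l -> / 2 * sum_list (fun x => Rabs (P x - Q x)) l <= eps.

Inductive ptree : Type := PNode : list ptree -> ptree.

Fixpoint psize (t : ptree) : nat :=
  match t with
  | PNode ch => S ((fix go (l : list ptree) : nat :=
                     match l with nil => O | c :: l' => (psize c + go l')%nat end) ch)
  end.

Fixpoint pweight (w : nat -> R) (t : ptree) : R :=
  match t with
  | PNode ch => w (length ch) *
      (fix go (l : list ptree) : R :=
         match l with nil => 1 | c :: l' => pweight w c * go l' end) ch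
  end.

(* ---------- R-enriched plane trees ----------
   A vertex with d children carries a structure in Sp d = R[{1..d}];
   label i corresponds to the i-th child. *)
Inductive etree (Sp : nat -> Type) : Type :=
  ENode : forall d : nat, Sp d -> list (etree Sp) -> etree Sp.
Arguments ENode {Sp} d _ _.

Section Trees.
Context {Sp : nat -> Type}.

Fixpoint ewf (t : etree Sp) : Prop :=
  match t with
  | ENode d _ ch => length ch = d /\
      (fix go (l : list (etree Sp)) : Prop :=
         match l with nil => True | c :: l' => ewf c /\ go l' end) ch
  end.

Fixpoint esize (t : etree Sp) : nat :=
  match t with
  | ENode _ _ ch => S ((fix go (l : list (etree Sp)) : nat :=
                     match l with nil => O | c :: l' => (esize c + go l')%nat end) ch)
  end.

Fixpoint eshape (t : etree Sp) : ptree :=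
  match t with
  | ENode _ _ ch => PNode (map eshape ch)
  end.

Fixpoint ewprod (g : forall d, Sp d -> R) (t : etree Sp) : R :=
  match t with
  | ENode d s ch => g d s *
      (fix go (l : list (etree Sp)) : R :=
         match l with nil => 1 | c :: l' => ewprod g c * go l' end) ch
  end.

(* vertices are addressed by Ulam-Harris words (list of child indices,
   0-based, from the root) *)
Fixpoint subtree_at (t : etree Sp) (a : list nat) : option (etree Sp) :=
  match a with
  | nil => Some t
  | i :: a' =>
      match t with
      | ENode _ _ ch =>
          match nth_error ch i with
          | Some c => subtree_at c a'
          | None => None
          end
      end
  end.

Definition is_vertex (t : etree Sp) (a : list nat) : Prop := subtree_at t a <> None.

(* pointed enriched plane trees together with the placeholder diamond = None *)
Definition pointed : Type := option (etree Sp * list nat).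

Definition fk (k : nat) (p : etree Sp * list nat) : pointed :=
  let (A, a) := p in
  if Nat.ltb (length a) k then None
  else
    let m := (length a - k)%nat in
    match subtree_at A (firstn m a) with
    | Some B => Some (B, skipn m a)
    | None => None
    end.

(* Probability weight of the fringe subtree at u_k of T-star pointed at u_0,
   computed along the construction: the vertices of the path from the root
   (= u_k) to the pointed vertex (excluded) are spine vertices u_k..u_1 and
   receive the factor [sp d s] (= P(xi_hat = d) * 1/d * struct. prob.), the
   distinguished child continues the spine, all other children, as well as the
   pointed vertex u_0, are roots of independent GW trees whose vertices
   receive the factor [gw d s] (= pi_d * struct. prob.). *)
Fixpoint qprod (gw sp : forall d, Sp d -> R) (t : etree Sp) (a : list nat) : R :=
  match t with
  | ENode d s ch =>
      match a with
      | nil => ewprod gw t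
      | i :: a' => sp d s *
          (fix go (l : list (etree Sp)) (j : nat) : R :=
             match l with
             | nil => 1
             | c :: l' => (if Nat.eqb j i then qprod gw sp c a' else ewprod gw c)
                          * go l' (S j)
             end) ch O
      end
  end.

End Trees.

Section Model.
Context {Sp : nat -> Type}.
Variable enum : forall k, list (Sp k).
Variable kappa : forall k, Sp k -> R.

Definition Rk (k : nat) : R := sum_list (kappa k) (enum k).

Definition omega (k : nat) : R := Rk k / INR (fact k).

(* probability of the structure beta(v) given d^+(v), proportional to kappa *)
Definition sprob (d : nat) (s : Sp d) : R := kappa d s / Rk d.

Definition Zn (n : nat) : R := fsum (fun t => psize t = n) (pweight omega).

Definition lawT (n : nat) (A : etree Sp) : R :=
  pweight omega (eshape A) / Zn n * ewprod sprob A.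

Definition Pvalid (n : nat) (p : etree Sp * list nat) : Prop :=
  ewf (fst p) /\ esize (fst p) = n /\ is_vertex (fst p) (snd p).

(* P(H_k = x), with v_0 uniform among the n vertices *)
Definition lawH (n k : nat) (x : @pointed Sp) : R :=
  fsum (Pvalid n) (fun p => lawT n (fst p) * / INR n * ind (fk k p = x)).

Definition EH (n k : nat) (g : @pointed Sp -> R) : R :=
  fsum (Pvalid n) (fun p => lawT n (fst p) * / INR n * g (fk k p)).

Definition pi (tau Phi : R) (d : nat) : R := tau ^ d * omega d / Phi.

Definition lawStar (tau Phi : R) (k : nat) (x : @pointed Sp) : R :=
  match x with
  | None => 0
  | Some (A, a) =>
      ind (ewf A /\ is_vertex A a /\ length a = k) *
      qprod (fun d s => pi tau Phi d * sprob d s)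
            (fun d s => (INR d * pi tau Phi d) * / INR d * sprob d s) A a
  end.

End Model.

Definition phi_conv (w : nat -> R) (t : R) : Prop :=
  exists l, infinite_sum (fun k => w k * t ^ k) l.

Definition below_rho (w : nat -> R) (t : R) : Prop :=
  exists s, t < s /\ phi_conv w s.

(* nu = lim_{t -> rho_phi^-} psi(t) (nu = 0 if rho_phi = 0);
   type I : nu >= 1, i.e. rho_phi > 0 and for every c < 1, psi(t) > c for all
   t in (0, rho_phi) close enough to rho_phi (resp. large enough if
   rho_phi = infinity). Here psi(t) = t phi'(t) / phi(t). *)
Definition typeI (w : nat -> R) : Prop :=
  below_rho w 0 /\
  forall c, c < 1 -> exists t0, 0 < t0 /\ below_rho w t0 /\
    forall t Phi Phi', t0 <= t -> below_rho w t ->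
      infinite_sum (fun k => w k * t ^ k) Phi ->
      infinite_sum (fun k => INR k * w k * t ^ (k - 1)) Phi' ->
      c < t * Phi' / Phi.

Definition is_span (w : nat -> R) (d : nat) : Prop :=
  (forall k, 0 < w k -> Nat.divide d k) /\
  (forall d', (forall k, 0 < w k -> Nat.divide d' k) -> Nat.divide d' d).

Definition o_sqrt (kn : nat -> nat) : Prop :=
  forall eps, 0 < eps -> exists N, forall n, (N <= n)%nat -> INR (kn n) <= eps * sqrt (INR n).

(* Main.v *)
(** The fringe subtree of the conditioned tree at the [k]-th ancestor of a random vertex equals a given
    pointed tree [(B, a)], [|a| = k], with probability
    [P(T = B) P(S_{n-m} = 0) / P(S_n = -1)], where [m = |B|] and [S] is the random walk with steps
    [xi - 1] (cycle lemma), while the limit object equals it with probability [P(T = B)]. Both laws have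
    mass at most 1, so it suffices to bound the ratio from below on a finite set of pointed trees that
    carries almost all the mass of the limit law.

    For fixed [B] and no moment assumption, the ratio is the conditional probability, given [S_n = -1],
    that the walk starts with the degree sequence of [B]. The probability of [S_n = -1] decays
    subexponentially, the empirical frequency of each step is concentrated up to exponentially small
    probabilities, and exchangeability turns this into a ratio tending to 1. With finite variance the
    local limit theorem gives the ratio uniformly in [m <= n / 2].

    The mass of the limit law on small trees is computed from the generating function [g = s f(g)] of the
    tree size: the pointed trees at level [k] have generating function [g (s f'(g))^k], and
    [1 - g = O(sqrt (1 - s))], so that level [k = o(sqrt n)] involves only [o(n)] vertices. *)

From Coquelicot Require Import Coquelicot.
From Stdlib Require Import Reals List Arith ClassicalEpsilon Lia Lra ZArith Permutation Eqdep_dec.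
Require Import Defs.
Import ListNotations.
Open Scope R_scope.

(** * Finite sums over lists *)

(** Everything is expressed by finite sums: point probabilities of the walk are coefficients [cz] of
    powers of the step series, and the infinite tree is never built, since [lawStar] is an explicit
    weight. That this weight has mass at most 1 is itself a consequence of the lower bound: on a
    finite list, a multiple close to 1 of it is dominated by the law of some conditioned tree. Mass
    close to 1 is a separate matter of generating functions. The weights [omega] and [pi] define the
    same conditioned tree, because tilting multiplies all trees with [n] vertices by one constant.
    The obstacle in the case without moments is that [tau] may be the radius of convergence, so no
    local limit theorem is at hand; truncating the step law makes room for a tilt. The scale
    [sqrt n] comes from a balance: with a discount [s = 1 - K / n] per vertex, the generating
    function stays above the diagonal only up to [1 - v] with [v] of order [sqrt (1 - s)], and each
    level of the spine then loses mass of order [v]. *)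

Lemma sum_list_ext {X} (f g : X -> R) l :
  (forall x, In x l -> f x = g x) -> sum_list f l = sum_list g l.
Proof.
  induction l as [|x l IH]; simpl; intros H; [reflexivity|].
  rewrite H by auto. rewrite IH by auto. reflexivity.
Qed.

Lemma sum_list_le {X} (f g : X -> R) l :
  (forall x, In x l -> f x <= g x) -> sum_list f l <= sum_list g l.
Proof.
  induction l as [|x l IH]; simpl; intros H; [lra|].
  apply Rplus_le_compat; auto.
Qed.

Lemma sum_list_0 {X} (l : list X) : sum_list (fun _ => 0) l = 0.
Proof. induction l; simpl; lra. Qed.

Lemma sum_list_ge0 {X} (f : X -> R) l :
  (forall x, In x l -> 0 <= f x) -> 0 <= sum_list f l.
Proof. intros H. rewrite <- (sum_list_0 l). apply sum_list_le; auto. Qed.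

Lemma sum_list_app {X} (f : X -> R) l1 l2 :
  sum_list f (l1 ++ l2) = sum_list f l1 + sum_list f l2.
Proof. induction l1; simpl; lra. Qed.

Lemma sum_list_map {X Y} (f : Y -> R) (h : X -> Y) l :
  sum_list f (map h l) = sum_list (fun x => f (h x)) l.
Proof. induction l; simpl; congruence. Qed.

Lemma sum_list_flat_map {X Y} (f : Y -> R) (h : X -> list Y) l :
  sum_list f (flat_map h l) = sum_list (fun x => sum_list f (h x)) l.
Proof. induction l; simpl; auto. rewrite sum_list_app. congruence. Qed.

Lemma sum_list_plus {X} (f g : X -> R) l :
  sum_list (fun x => f x + g x) l = sum_list f l + sum_list g l.
Proof. induction l; simpl; lra. Qed.

Lemma sum_list_minus {X} (f g : X -> R) l :
  sum_list (fun x => f x - g x) l = sum_list f l - sum_list g l.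
Proof. induction l; simpl; lra. Qed.

Lemma sum_list_scal {X} (f : X -> R) c l :
  sum_list (fun x => c * f x) l = c * sum_list f l.
Proof. induction l; simpl; lra. Qed.

Lemma sum_list_scal_r {X} (f : X -> R) c l :
  sum_list (fun x => f x * c) l = sum_list f l * c.
Proof. induction l; simpl; lra. Qed.

Lemma sum_list_swap {X Y} (f : X -> Y -> R) l l' :
  sum_list (fun x => sum_list (f x) l') l = sum_list (fun y => sum_list (fun x => f x y) l) l'.
Proof.
  induction l; simpl; [symmetry; apply sum_list_0|].
  rewrite IHl. symmetry. apply sum_list_plus.
Qed.

Lemma sum_list_abs {X} (f : X -> R) l :
  Rabs (sum_list f l) <= sum_list (fun x => Rabs (f x)) l.
Proof.
  induction l; simpl; [rewrite Rabs_R0; lra|].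
  eapply Rle_trans; [apply Rabs_triang|]. lra.
Qed.

Lemma sum_list_const {X} c (l : list X) : sum_list (fun _ => c) l = INR (length l) * c.
Proof. induction l; simpl length; [simpl; lra|]. rewrite S_INR. simpl. lra. Qed.

Lemma sum_list_perm {X} (f : X -> R) l l' :
  Permutation l l' -> sum_list f l = sum_list f l'.
Proof. induction 1; simpl; lra. Qed.

Lemma sum_list_same {X} (f : X -> R) l l' :
  NoDup l -> NoDup l' -> (forall x, In x l <-> In x l') -> sum_list f l = sum_list f l'.
Proof. intros. apply sum_list_perm, NoDup_Permutation; auto. Qed.

(** Structures and trees come without a decidable equality, so membership tests on lists are
    classical. *)
Lemma eq_dec_cl {X} (x y : X) : {x = y} + {x <> y}.
Proof. apply excluded_middle_informative. Qed.

Definition dropl {X} (l0 l : list X) : list X :=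
  filter (fun x => if in_dec eq_dec_cl x l0 then false else true) l.

Lemma dropl_In {X} (l0 l : list X) x : In x (dropl l0 l) <-> In x l /\ ~ In x l0.
Proof.
  unfold dropl. rewrite filter_In. destruct in_dec; intuition congruence.
Qed.

Lemma dropl_NoDup {X} (l0 l : list X) : NoDup l -> NoDup (dropl l0 l).
Proof. apply NoDup_filter. Qed.

Lemma sum_list_split {X} (f : X -> R) l0 l :
  NoDup l0 -> NoDup l -> incl l0 l ->
  sum_list f l = sum_list f l0 + sum_list f (dropl l0 l).
Proof.
  intros H0 H Hi. rewrite <- sum_list_app. apply sum_list_same; auto.
  - apply NoDup_app; auto using dropl_NoDup.
    intros x Hx Hy. apply dropl_In in Hy. tauto.
  - intros x. rewrite in_app_iff, dropl_In. specialize (Hi x).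
    destruct (in_dec eq_dec_cl x l0); tauto.
Qed.

Lemma sum_list_incl {X} (f : X -> R) l0 l :
  NoDup l0 -> NoDup l -> incl l0 l -> (forall x, In x l -> 0 <= f x) ->
  sum_list f l0 <= sum_list f l.
Proof.
  intros H0 H Hi Hf. rewrite (sum_list_split f l0 l); auto.
  enough (0 <= sum_list f (dropl l0 l)) by lra.
  apply sum_list_ge0. intros x Hx. apply Hf, (proj1 (proj1 (dropl_In _ _ _) Hx)).
Qed.

Lemma fsum_enum {X} (P : X -> Prop) (f : X -> R) l :
  enumerates P l -> fsum P f = sum_list f l.
Proof.
  intros [Hn Hl]. unfold fsum. destruct excluded_middle_informative as [H|H].
  - destruct constructive_indefinite_description as [l' [Hn' Hl']]; simpl.
    apply sum_list_same; auto. intros x. rewrite Hl, Hl'. tauto.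
  - exfalso. apply H. exists l. split; auto.
Qed.

Lemma ind_true (P : Prop) : P -> ind P = 1.
Proof. unfold ind. destruct excluded_middle_informative; tauto. Qed.

Lemma ind_false (P : Prop) : ~ P -> ind P = 0.
Proof. unfold ind. destruct excluded_middle_informative; tauto. Qed.

Lemma ind_range (P : Prop) : 0 <= ind P <= 1.
Proof. unfold ind. destruct excluded_middle_informative; lra. Qed.

Lemma sum_ind_eq {X} (y : X) l : NoDup l -> sum_list (fun x => ind (y = x)) l = ind (In y l).
Proof.
  induction 1 as [|x l Hx Hn IH]; simpl.
  - rewrite ind_false; tauto.
  - rewrite IH. unfold ind.
    repeat destruct excluded_middle_informative; try lra; exfalso; subst; intuition congruence.
Qed.

Lemma sum_f_R0_list (f : nat -> R) n : sum_f_R0 f n = sum_list f (seq 0 (S n)).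
Proof.
  induction n; [simpl; lra|].
  rewrite seq_S, sum_list_app, <- IHn. simpl. lra.
Qed.

Lemma NoDup_flat_map {X Y} (h : X -> list Y) l :
  NoDup l -> (forall x, In x l -> NoDup (h x)) ->
  (forall x x' y, In x l -> In x' l -> In y (h x) -> In y (h x') -> x = x') ->
  NoDup (flat_map h l).
Proof.
  induction 1 as [|x l Hx Hn IH]; simpl; intros H1 H2; [constructor|].
  apply NoDup_app; auto.
  - apply IH; auto. intros; eapply H2; eauto.
  - intros y Hy Hy'. apply in_flat_map in Hy' as [x' [Hx' Hy']].
    assert (x = x') by (eapply H2; eauto). congruence.
Qed.

Lemma NoDup_map_inj {X Y} (h : X -> Y) l :
  NoDup l -> (forall x x', In x l -> In x' l -> h x = h x' -> x = x') -> NoDup (map h l).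
Proof.
  induction 1 as [|x l Hx Hn IH]; simpl; intros H1; [constructor|].
  constructor; auto.
  intros Hc. apply in_map_iff in Hc as [x' [He Hx']].
  assert (x = x') by (apply H1; auto). congruence.
Qed.

(** * Powers of a generating function and conditioned step counts *)

(* [cz u n z] is the coefficient of [X^z] in [(sum_k u_k X^k)^n]; integer indices make it 0 for [z < 0]. *)
Fixpoint cz (u : nat -> R) (n : nat) (z : Z) : R :=
  match n with
  | O => if Z.eq_dec z 0 then 1 else 0
  | S n' => sum_f_R0 (fun k => u k * cz u n' (z - Z.of_nat k)) (Z.to_nat z)
  end.

Lemma sum_eq_0 f n : (forall k, (k <= n)%nat -> f k = 0) -> sum_f_R0 f n = 0.
Proof.
  intros H. rewrite (sum_eq f (fun _ => 0)) by auto. rewrite sum_cte. ring.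
Qed.

Lemma sum_scal c f n : sum_f_R0 (fun k => c * f k) n = c * sum_f_R0 f n.
Proof. rewrite scal_sum. apply sum_eq. intros; ring. Qed.

Lemma sum_swap (f : nat -> nat -> R) n m :
  sum_f_R0 (fun k => sum_f_R0 (f k) m) n = sum_f_R0 (fun l => sum_f_R0 (fun k => f k l) n) m.
Proof.
  induction n; simpl; auto. rewrite IHn, <- plus_sum. reflexivity.
Qed.

Lemma sum_extend f n m :
  (n <= m)%nat -> (forall k, (n < k <= m)%nat -> f k = 0) -> sum_f_R0 f m = sum_f_R0 f n.
Proof.
  induction 1 as [|m Hm IH]; auto; intros H. simpl.
  rewrite IH by (intros; apply H; lia). rewrite (H (S m)) by lia. ring.
Qed.

Lemma sum_ge0 f n : (forall k, (k <= n)%nat -> 0 <= f k) -> 0 <= sum_f_R0 f n.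
Proof.
  intros H. induction n; simpl; auto.
  apply Rplus_le_le_0_compat; auto.
Qed.

Lemma sum_le_upto f n m : (forall k, 0 <= f k) -> (n <= m)%nat -> sum_f_R0 f n <= sum_f_R0 f m.
Proof. intros H. induction 1; simpl; [lra|]. specialize (H (S m)). lra. Qed.

Lemma term_le_sum f n k : (forall k, 0 <= f k) -> (k <= n)%nat -> f k <= sum_f_R0 f n.
Proof.
  intros H Hk. apply Rle_trans with (sum_f_R0 f k); [|apply sum_le_upto; auto].
  destruct k; simpl; [lra|]. pose proof (sum_ge0 f k (fun j _ => H j)). lra.
Qed.

Lemma sum_single f n a : (a <= n)%nat -> (forall k, (k <= n)%nat -> k <> a -> f k = 0) ->
  sum_f_R0 f n = f a.
Proof.
  revert a. induction n; simpl; intros a Ha H.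
  - replace a with 0%nat by lia. auto.
  - destruct (Nat.eq_dec a (S n)) as [->|Hne].
    + rewrite sum_eq_0; [ring|]. intros; apply H; lia.
    + rewrite (IHn a) by (intros; try apply H; lia).
      rewrite (H (S n)) by lia. ring.
Qed.

Lemma partial_le_infinite_sum f l n : (forall k, 0 <= f k) -> infinite_sum f l -> sum_f_R0 f n <= l.
Proof.
  intros Hf Hl. destruct (Rle_or_lt (sum_f_R0 f n) l) as [|Hlt]; auto.
  destruct (Hl (sum_f_R0 f n - l)) as [N HN]; [lra|].
  specialize (HN (max N n) ltac:(lia)).
  pose proof (sum_le_upto f n (max N n) Hf ltac:(lia)).
  unfold Rdist in HN. rewrite Rabs_pos_eq in HN by lra. lra.
Qed.

Lemma infinite_sum_tail f l eps : (forall k, 0 <= f k) -> infinite_sum f l -> 0 < eps ->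
  exists N, forall n, (N <= n)%nat -> l - eps < sum_f_R0 f n <= l.
Proof.
  intros Hf Hl He. destruct (Hl eps He) as [N HN]. exists N. intros n Hn.
  specialize (HN n Hn). split; [|apply partial_le_infinite_sum; auto].
  unfold Rdist in HN. apply Rabs_def2 in HN. lra.
Qed.

Lemma infinite_sum_scal c f l : infinite_sum f l -> infinite_sum (fun k => c * f k) (c * l).
Proof.
  intros H eps He. destruct (H (eps / (Rabs c + 1))) as [N HN].
  - apply Rdiv_lt_0_compat; [lra|]. pose proof (Rabs_pos c). lra.
  - exists N. intros n Hn. specialize (HN n Hn). rewrite sum_scal. unfold Rdist in *.
    replace (c * sum_f_R0 f n - c * l) with (c * (sum_f_R0 f n - l)) by ring.
    rewrite Rabs_mult. pose proof (Rabs_pos c).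
    apply Rle_lt_trans with ((Rabs c + 1) * Rabs (sum_f_R0 f n - l)).
    + pose proof (Rabs_pos (sum_f_R0 f n - l)). nra.
    + apply Rlt_le_trans with ((Rabs c + 1) * (eps / (Rabs c + 1))).
      * apply Rmult_lt_compat_l; lra.
      * right. field. lra.
Qed.

Lemma infinite_sum_ext f g l : (forall k, f k = g k) -> infinite_sum f l -> infinite_sum g l.
Proof.
  intros H Hl eps He. destruct (Hl eps He) as [N HN]. exists N. intros n Hn.
  rewrite (sum_eq g f) by auto. auto.
Qed.

Section CZ.
Variable u : nat -> R.

Lemma cz_neg n z : (z < 0)%Z -> cz u n z = 0.
Proof.
  revert z. induction n; simpl; intros z Hz.
  - destruct Z.eq_dec; [lia|auto].
  - replace (Z.to_nat z) with 0%nat by lia. simpl. rewrite IHn by lia. ring.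
Qed.

(** The cutoff [D] may be any upper bound of [z], so that sums for different targets run over one
    common range and can be exchanged. *)
Lemma cz_S D n z : (z <= Z.of_nat D)%Z ->
  cz u (S n) z = sum_f_R0 (fun k => u k * cz u n (z - Z.of_nat k)) D.
Proof.
  intros HD. simpl. symmetry. apply sum_extend; [lia|].
  intros k Hk. rewrite cz_neg by lia. ring.
Qed.

(** By symmetry each of the [S n] factors carries the same share of the exponent [z]; equivalently
    [X (f^(n+1))' = (n+1) X f' f^n]. This exchangeability is the analytic core of the cycle lemma
    below. *)
Lemma cz_exch D n z : (z <= Z.of_nat D)%Z ->
  IZR z * cz u (S n) z = INR (S n) * sum_f_R0 (fun k => INR k * u k * cz u n (z - Z.of_nat k)) D.
Proof.
  revert z. induction n; intros z HD.
  - rewrite (cz_S D) by auto. rewrite <- sum_scal. simpl INR. rewrite Rmult_1_l.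
    apply sum_eq. intros k Hk. simpl. destruct Z.eq_dec; [|ring].
    replace (IZR z) with (INR k) by (rewrite INR_IZR_INZ; f_equal; lia). ring.
  - rewrite (cz_S D) by auto. rewrite <- sum_scal.
    rewrite (sum_eq _ (fun k => INR k * u k * cz u (S n) (z - Z.of_nat k) +
      u k * (INR (S n) * sum_f_R0 (fun l => INR l * u l * cz u n (z - Z.of_nat k - Z.of_nat l)) D))).
    + rewrite plus_sum.
      rewrite (sum_eq (fun k => u k * _)
        (fun k => sum_f_R0 (fun l => INR (S n) * (INR l * u l * (u k * cz u n (z - Z.of_nat l - Z.of_nat k)))) D)).
      2:{ intros k Hk. rewrite <- sum_scal, <- sum_scal. apply sum_eq. intros l Hl.
          replace (z - Z.of_nat k - Z.of_nat l)%Z with (z - Z.of_nat l - Z.of_nat k)%Z by lia. ring. }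
      rewrite sum_swap.
      rewrite (sum_eq (fun l => sum_f_R0 _ D) (fun l => INR (S n) * (INR l * u l * cz u (S n) (z - Z.of_nat l)))).
      2:{ intros l Hl. rewrite (cz_S D n (z - Z.of_nat l)) by lia. rewrite <- !sum_scal. reflexivity. }
      rewrite sum_scal, (S_INR (S n)). ring.
    + intros k Hk. rewrite <- IHn by lia. rewrite minus_IZR, <- INR_IZR_INZ. ring.
Qed.

Hypothesis u_ge0 : forall k, 0 <= u k.

Lemma cz_ge0 n z : 0 <= cz u n z.
Proof.
  revert z. induction n; intros z; simpl.
  - destruct Z.eq_dec; lra.
  - apply sum_ge0. intros. apply Rmult_le_pos; auto.
Qed.

Lemma cz_mono v n z : (forall k, u k <= v k) -> cz u n z <= cz v n z.
Proof.
  intros H. revert z. induction n; intros z; simpl; [lra|].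
  apply sum_Rle. intros k Hk. apply Rmult_le_compat; auto using cz_ge0.
Qed.

Lemma cz_le_total M n z : (forall N, sum_f_R0 u N <= M) -> cz u n z <= M ^ n.
Proof.
  intros HM. assert (0 <= M) by (eapply Rle_trans; [apply (u_ge0 0)|apply (HM 0%nat)]).
  revert z. induction n; intros z; simpl.
  - destruct Z.eq_dec; lra.
  - apply Rle_trans with (sum_f_R0 (fun k => u k * M ^ n) (Z.to_nat z)).
    + apply sum_Rle. intros k Hk. apply Rmult_le_compat_l; auto.
    + rewrite <- scal_sum. rewrite Rmult_comm. apply Rmult_le_compat_r; auto. apply pow_le; auto.
Qed.
End CZ.

Lemma cz_ext u v n z : (forall k, (Z.of_nat k <= z)%Z -> u k = v k) -> cz u n z = cz v n z.
Proof.
  revert z. induction n; intros z H; [reflexivity|].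
  destruct (Z_lt_le_dec z 0); [rewrite !cz_neg; auto|].
  simpl. apply sum_eq. intros k Hk. rewrite H by lia.
  rewrite IHn; auto. intros; apply H; lia.
Qed.

Lemma cz_tilt u a b n z : b <> 0 -> (0 <= z)%Z ->
  cz (fun k => a ^ k * u k / b) n z = a ^ (Z.to_nat z) / b ^ n * cz u n z.
Proof.
  intros Hb. revert z. induction n; intros z Hz.
  - simpl. destruct Z.eq_dec; [subst; simpl; field|ring].
  - simpl cz. rewrite <- sum_scal. apply sum_eq. intros k Hk.
    rewrite IHn by lia.
    replace (Z.to_nat (z - Z.of_nat k)) with (Z.to_nat z - k)%nat by lia.
    replace (a ^ Z.to_nat z) with (a ^ k * a ^ (Z.to_nat z - k)) by (rewrite <- pow_add; f_equal; lia).
    simpl. field. split; auto. apply pow_nonzero; auto.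
Qed.

(** * Cost of removing one step from a conditioned walk *)

Section OneStep.
Variables (p : nat -> R) (x : nat) (th : R).
Hypothesis p_ge0 : forall k, 0 <= p k.
Hypothesis Hth : 0 < th < 1.

Definition tiltone (k : nat) : R := if Nat.eq_dec k x then th * p k else p k.

Let L := ln th.

Lemma tiltone_ge0 k : 0 <= tiltone k.
Proof. unfold tiltone. specialize (p_ge0 k). destruct Nat.eq_dec; nra. Qed.

(* Jensen's inequality for [th ^ N], where [N] counts the steps equal to [x] and the walk is
   conditioned on its end point; the conditional mean of [N] is [n p_x cz (n-1) (z-x) / cz n z]. *)
Lemma cz_tiltone_tangent n z mu :
  Rpower th mu * (cz p n z * (1 - mu * L) + L * INR n * p x * cz p (n - 1) (z - Z.of_nat x))
  <= cz tiltone n z.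
Proof.
  revert z mu. induction n; intros z mu.
  - simpl. destruct Z.eq_dec; simpl.
    (* Here [N = 0], and the claim is [exp y * (1 - y) <= 1] with [y = mu * L]. *)
    + rewrite Rmult_0_r, !Rmult_0_l, Rplus_0_r, Rmult_1_l. unfold Rpower. fold L.
      pose proof (exp_ineq1_le (- (mu * L))). pose proof (exp_pos (mu * L)).
      apply Rle_trans with (exp (mu * L) * exp (- (mu * L))).
      * apply Rmult_le_compat_l; lra.
      * rewrite <- exp_plus. replace (mu * L + - (mu * L)) with 0 by ring. rewrite exp_0. lra.
    + rewrite Rmult_0_l. right. ring.
  - set (D := (Z.to_nat z + x)%nat).
    assert (HD : (z <= Z.of_nat D)%Z) by (unfold D; lia).
    rewrite (cz_S tiltone D), (cz_S p D) by auto.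
    replace (S n - 1)%nat with n by lia.
    assert (HI : INR n * cz p n (z - Z.of_nat x) =
      INR n * sum_f_R0 (fun k => p k * cz p (n - 1) (z - Z.of_nat x - Z.of_nat k)) D).
    { destruct n; [simpl; ring|]. replace (S n - 1)%nat with n by lia. f_equal.
      apply cz_S. lia. }
    assert (Hx : sum_f_R0 (fun k => (if Nat.eq_dec k x then 1 else 0) * (p x * cz p n (z - Z.of_nat x))) D
       = p x * cz p n (z - Z.of_nat x)).
    { rewrite (sum_single _ D x); [destruct Nat.eq_dec; [ring|congruence]|unfold D; lia|].
      intros k _ Hk. destruct Nat.eq_dec; [congruence|ring]. }
    replace (L * INR (S n) * p x * cz p n (z - Z.of_nat x)) with
      (L * (p x * cz p n (z - Z.of_nat x)) + L * p x * (INR n * cz p n (z - Z.of_nat x)))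
      by (rewrite S_INR; ring).
    rewrite HI, <- Hx.
    rewrite Rmult_plus_distr_l, (Rmult_comm (sum_f_R0 _ D) (1 - mu * L)).
    replace (L * p x * (INR n * sum_f_R0 (fun k => p k * cz p (n - 1) (z - Z.of_nat x - Z.of_nat k)) D))
      with (L * p x * INR n * sum_f_R0 (fun k => p k * cz p (n - 1) (z - Z.of_nat x - Z.of_nat k)) D) by ring.
    rewrite <- Rmult_plus_distr_l.
    rewrite <- !sum_scal, <- !plus_sum, <- sum_scal.
    apply sum_Rle. intros k Hk. unfold tiltone at 1. destruct Nat.eq_dec as [->|Hne].
    (* A first step equal to [x] contributes a factor [th] and one unit of [N], so the tangent point
       for the remaining steps moves from [mu] to [mu - 1]. *)
    + pose proof (IHn (z - Z.of_nat x)%Z (mu - 1)) as IH.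
      replace (Rpower th mu) with (th * Rpower th (mu - 1)).
      2:{ rewrite <- (Rpower_1 th) at 1 by lra. rewrite <- Rpower_plus. f_equal. ring. }
      apply Rmult_le_compat_l with (r := th * p x) in IH; [|specialize (p_ge0 x); nra].
      eapply Rle_trans; [|apply IH]. right. ring.
    + pose proof (IHn (z - Z.of_nat k)%Z mu) as IH.
      apply Rmult_le_compat_l with (r := p k) in IH; [|auto].
      eapply Rle_trans; [|apply IH]. right.
      replace (z - Z.of_nat x - Z.of_nat k)%Z with (z - Z.of_nat k - Z.of_nat x)%Z by lia. ring.
Qed.

Lemma tiltone_total N : (forall N, sum_f_R0 p N <= 1) -> p x <= 1 ->
  sum_f_R0 tiltone N <= 1 - p x * (1 - th).
Proof.
  intros H1 Hx.
  apply Rle_trans with (sum_f_R0 tiltone (max N x)); [apply sum_le_upto; [apply tiltone_ge0|lia]|].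
  assert (sum_f_R0 p (max N x) - sum_f_R0 tiltone (max N x) = p x * (1 - th)).
  { rewrite <- minus_sum, (sum_single _ _ x); [|lia|].
    - unfold tiltone. destruct Nat.eq_dec; [ring|congruence].
    - intros k _ Hk. unfold tiltone. destruct Nat.eq_dec; [congruence|ring]. }
  specialize (H1 (max N x)). lra.
Qed.

(** Lowering the weight of [x] by the factor [th] reduces the total mass to [1 - q] with
    [q = p x * (1 - th)], so the weighted sum of [th ^ N] is at most [exp (- q n)], whereas the end
    point costs only [exp (- eps n)]. Hence the conditional mean of [N] is at least
    [(q - eps) n / (- ln th)], and [- th * ln th <= 1 - th] turns this into the stated bound. *)
Lemma cz_one_step_lower n z eps :
  (forall N, sum_f_R0 p N <= 1) -> 0 < p x -> (1 <= n)%nat ->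
  exp (- eps * INR n) <= cz p n z ->
  th * (1 - eps / (p x * (1 - th))) * cz p n z <= cz p (n - 1) (z - Z.of_nat x).
Proof.
  intros H1 Hx Hn HW.
  assert (Hx1 : p x <= 1).
  { eapply Rle_trans; [apply (term_le_sum p x x); auto|apply H1]. }
  assert (HW0 : 0 < cz p n z) by (eapply Rlt_le_trans; [apply exp_pos|apply HW]).
  assert (Hn0 : 0 < INR n) by (apply lt_0_INR; lia).
  set (V := cz p (n - 1) (z - Z.of_nat x)).
  (* At the conditional mean of [N] the linear term of the tangent bound vanishes. *)
  set (mu := INR n * p x * V / cz p n z).
  pose proof (cz_tiltone_tangent n z mu) as HT. fold V in HT.
  replace (cz p n z * (1 - mu * L) + L * INR n * p x * V) with (cz p n z) in HT
    by (unfold mu; field; lra).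
  assert (HU : cz tiltone n z <= (1 - p x * (1 - th)) ^ n).
  { apply cz_le_total; [apply tiltone_ge0|]. intros; apply tiltone_total; auto. }
  set (q := p x * (1 - th)) in *.
  assert (Hq : 0 < q < 1) by (unfold q; nra).
  assert (HE : (1 - q) ^ n <= exp (- q * INR n)).
  { clear - Hq. induction n; [simpl; rewrite Rmult_0_r, exp_0; lra|].
    rewrite S_INR, Rmult_plus_distr_l, Rmult_1_r, exp_plus. simpl.
    rewrite Rmult_comm. apply Rmult_le_compat; try lra; [apply pow_le; lra|].
    pose proof (exp_ineq1_le (- q)). lra. }
  assert (Hexp : exp (mu * L) * exp (- eps * INR n) <= exp (- q * INR n)).
  { eapply Rle_trans; [|apply HE]. eapply Rle_trans; [|apply HU]. eapply Rle_trans; [|apply HT].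
    unfold Rpower. fold L. apply Rmult_le_compat_l; auto. left; apply exp_pos. }
  rewrite <- exp_plus in Hexp.
  assert (Hlin : mu * L + - eps * INR n <= - q * INR n).
  { destruct (Rle_or_lt (mu * L + - eps * INR n) (- q * INR n)); auto.
    apply exp_increasing in H. lra. }
  assert (HL : - L * th <= 1 - th).
  { unfold L. rewrite <- ln_Rinv by lra.
    pose proof (exp_ineq1_le (ln (/ th))) as HI. rewrite exp_ln in HI by (apply Rinv_0_lt_compat; lra).
    apply Rmult_le_compat_r with (r := th) in HI; [|lra]. rewrite Rinv_l in HI by lra. lra. }
  assert (Hmu0 : 0 <= mu).
  { unfold mu. apply Rmult_le_pos; [|left; apply Rinv_0_lt_compat; auto].
    repeat apply Rmult_le_pos; try lra. apply cz_ge0; auto. }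
  assert (Hmu : th * (q - eps) * INR n <= mu * (1 - th)).
  { apply Rle_trans with (th * (mu * - L)); [|nra].
    apply Rle_trans with (th * ((q - eps) * INR n)); [lra|].
    apply Rmult_le_compat_l; lra. }
  assert (Hfin : th * (q - eps) * cz p n z <= q * V).
  { apply Rmult_le_reg_l with (INR n); auto.
    apply Rle_trans with (cz p n z * (th * (q - eps) * INR n)); [lra|].
    apply Rle_trans with (cz p n z * (mu * (1 - th))); [apply Rmult_le_compat_l; lra|].
    right. unfold mu, q. field. lra. }
  apply Rmult_le_reg_l with q; [lra|].
  eapply Rle_trans; [|apply Hfin]. right. unfold q. field. unfold q in Hq. split; [lra|].
  intros H0. lra.
Qed.
End OneStep.

(** * Trigonometric bounds and complex sums *)

(** The functions [x - sin x], [cos x - 1 + x ^ 2 / 2] and [sin x - x + x ^ 3 / 6] vanish at 0 and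
    each is the derivative of the next; the first has derivative [1 - cos x]. *)
Lemma sin_lower y : 0 <= y -> y - y ^ 3 / 6 <= sin y.
Proof.
  intros Hy.
  assert (Hmono : forall (f f' : R -> R), f 0 = 0 -> (forall x, is_derive f x (f' x)) ->
     (forall x, 0 <= x -> 0 <= f' x) -> forall x, 0 <= x -> 0 <= f x).
  { intros f f' H0 Hd Hp x Hx.
    destruct (MVT_gen f 0 x f') as [c [Hc He]].
    - intros; apply Hd.
    - intros z _. apply continuity_pt_filterlim. apply @ex_derive_continuous. eexists; apply Hd.
    - rewrite Rmin_left, Rmax_right in Hc by lra.
      specialize (Hp c (proj1 Hc)). rewrite H0 in He. nra. }
  assert (H1 : forall x, 0 <= x -> 0 <= x - sin x).
  { apply (Hmono _ (fun x => 1 - cos x)).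
    - rewrite sin_0; ring.
    - intros x. auto_derive; auto. ring.
    - intros x _. pose proof (COS_bound x). lra. }
  assert (H2 : forall x, 0 <= x -> 0 <= cos x - 1 + x ^ 2 / 2).
  { apply (Hmono _ (fun x => x - sin x)).
    - rewrite cos_0; field.
    - intros x. auto_derive; auto. simpl. field.
    - auto. }
  assert (H3 : forall x, 0 <= x -> 0 <= sin x - (x - x ^ 3 / 6)).
  { apply (Hmono _ (fun x => cos x - 1 + x ^ 2 / 2)).
    - rewrite sin_0; field.
    - intros x. auto_derive; auto. simpl. field.
    - auto. }
  specialize (H3 y Hy). lra.
Qed.

Lemma sin_le_id y : 0 <= y -> sin y <= y.
Proof.
  intros Hy. destruct (Req_dec y 0) as [->|]; [rewrite sin_0; lra|].
  left. apply sin_lt_x. lra.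
Qed.

Lemma abs_sin_sub_id y : Rabs (sin y - y) <= Rabs y ^ 3 / 6.
Proof.
  destruct (Rle_or_lt 0 y) as [Hy|Hy].
  - rewrite (Rabs_pos_eq y) by auto. rewrite Rabs_left1.
    + pose proof (sin_lower y Hy). lra.
    + pose proof (sin_le_id y Hy). lra.
  - rewrite (Rabs_left y) by auto. rewrite <- (Ropp_involutive y) at 1 2. rewrite sin_neg.
    pose proof (sin_lower (- y) ltac:(lra)). pose proof (sin_le_id (- y) ltac:(lra)).
    rewrite Rabs_pos_eq; lra.
Qed.

Lemma abs_sin_le y : Rabs (sin y) <= Rabs y.
Proof.
  assert (forall z, 0 <= z -> Rabs (sin z) <= z) as H.
  { intros z Hz. apply Rabs_le. split; [|apply sin_le_id; auto].
    destruct (Rle_or_lt z 1).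
    - pose proof (sin_lower z Hz). assert (z ^ 3 <= z) by (simpl; nra). lra.
    - pose proof (SIN_bound z). lra. }
  destruct (Rle_or_lt 0 y) as [Hy|Hy].
  - rewrite (Rabs_pos_eq y) by auto. auto.
  - rewrite (Rabs_left y) by auto. rewrite <- Rabs_Ropp, <- sin_neg. apply H. lra.
Qed.

(** Taylor remainders are bounded in two ways: by a cube, which is sharp near 0, and by a square,
    which is all that a finite variance can integrate. *)
Lemma abs_sin_sub_id_sq y : Rabs (sin y - y) <= 2 * y ^ 2.
Proof.
  rewrite <- (pow2_abs y). pose proof (Rabs_pos y).
  destruct (Rle_or_lt (Rabs y) 1).
  - eapply Rle_trans; [apply abs_sin_sub_id|]. simpl. nra.
  - eapply Rle_trans; [apply Rabs_triang|]. rewrite Rabs_Ropp.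
    pose proof (abs_sin_le y). simpl. nra.
Qed.

Lemma one_sub_cos y : 1 - cos y = 2 * sin (y / 2) ^ 2.
Proof.
  replace y with (2 * (y / 2)) at 1 by field. rewrite cos_2a_sin. simpl. ring.
Qed.

Lemma cos_taylor_sq y : Rabs (cos y - 1 + y ^ 2 / 2) <= y ^ 2.
Proof.
  pose proof (one_sub_cos y).
  assert (sin (y / 2) ^ 2 <= (y / 2) ^ 2).
  { rewrite <- (pow2_abs (sin _)), <- (pow2_abs (y / 2)). apply pow_incr. split; [apply Rabs_pos|apply abs_sin_le]. }
  assert (0 <= sin (y / 2) ^ 2) by apply pow2_ge_0.
  apply Rabs_le. simpl in *. split; nra.
Qed.

Lemma cos_taylor_cube y : Rabs (cos y - 1 + y ^ 2 / 2) <= Rabs y ^ 3.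
Proof.
  pose proof (one_sub_cos y) as H.
  set (s := sin (y / 2)) in *. set (x := y / 2) in *.
  replace (cos y - 1 + y ^ 2 / 2) with (2 * ((x - s) * (x + s))).
  2:{ replace (cos y) with (1 - 2 * s ^ 2) by lra. replace y with (2 * x) by (unfold x; field). simpl. field. }
  rewrite !Rabs_mult. rewrite (Rabs_pos_eq 2) by lra.
  pose proof (abs_sin_sub_id x) as H1. fold s in H1. rewrite Rabs_minus_sym in H1.
  assert (H2 : Rabs (x + s) <= 2 * Rabs x).
  { eapply Rle_trans; [apply Rabs_triang|]. pose proof (abs_sin_le x). fold s in H0. lra. }
  assert (H3 : Rabs (x - s) <= 2 * (Rabs x) ^ 2).
  { rewrite pow2_abs. rewrite Rabs_minus_sym. apply abs_sin_sub_id_sq. }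
  replace (Rabs y) with (2 * Rabs x).
  2:{ rewrite <- (Rabs_pos_eq 2) at 1 by lra. rewrite <- Rabs_mult. f_equal. unfold x. field. }
  pose proof (Rabs_pos x). pose proof (Rabs_pos (x - s)). pose proof (Rabs_pos (x + s)).
  apply Rle_trans with (2 * (2 * Rabs x ^ 2 * (2 * Rabs x))).
  - apply Rmult_le_compat_l; [lra|]. apply Rmult_le_compat; auto.
  - simpl. right. ring.
Qed.

Lemma abs_sin_mult_Z c y : Rabs (sin (IZR c * y)) <= Rabs (IZR c) * Rabs (sin y).
Proof.
  assert (Hn : forall n, Rabs (sin (INR n * y)) <= INR n * Rabs (sin y)).
  { induction n; [rewrite !Rmult_0_l, sin_0, Rabs_R0; lra|].
    rewrite S_INR, Rmult_plus_distr_r, Rmult_1_l, sin_plus.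
    eapply Rle_trans; [apply Rabs_triang|]. rewrite !Rabs_mult.
    assert (forall z, Rabs (cos z) <= 1) by (intros; apply Rabs_le; pose proof (COS_bound z); lra).
    pose proof (H y). pose proof (H (INR n * y)).
    pose proof (Rabs_pos (sin y)). pose proof (Rabs_pos (sin (INR n * y))).
    pose proof (Rabs_pos (cos y)). pose proof (Rabs_pos (cos (INR n * y))). nra. }
  destruct (Z_le_gt_dec 0 c).
  - replace c with (Z.of_nat (Z.to_nat c)) by lia. rewrite <- INR_IZR_INZ.
    rewrite (Rabs_pos_eq (INR _)) by apply pos_INR. apply Hn.
  - replace c with (- Z.of_nat (Z.to_nat (- c)))%Z by lia. rewrite opp_IZR, <- INR_IZR_INZ.
    rewrite Rabs_Ropp, (Rabs_pos_eq (INR _)) by apply pos_INR.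
    rewrite Ropp_mult_distr_l_reverse, sin_neg, Rabs_Ropp. apply Hn.
Qed.

Lemma abs_sin_plus a b : Rabs (sin (a + b)) <= Rabs (sin a) + Rabs (sin b).
Proof.
  rewrite sin_plus. eapply Rle_trans; [apply Rabs_triang|]. rewrite !Rabs_mult.
  assert (forall z, Rabs (cos z) <= 1) by (intros; apply Rabs_le; pose proof (COS_bound z); lra).
  pose proof (H a). pose proof (H b).
  pose proof (Rabs_pos (sin a)). pose proof (Rabs_pos (sin b)). nra.
Qed.

(** A pair [(k, c)] stands for the term [c k] of an integer combination. When the total is the span
    and every [k] lies in the support, the list is a Bezout certificate. *)
Definition bezout_sum (bz : list (nat * Z)) : Z :=
  fold_right (fun q acc => (snd q * Z.of_nat (fst q) + acc)%Z) 0%Z bz.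

(** If [sin (k y)] is small at every [k] of a certificate for [d], so is [sin (d y)]. This is how
    the arithmetic of the support enters the decay of the characteristic function. *)
Lemma abs_sin_bezout bz y :
  Rabs (sin (IZR (bezout_sum bz) * y)) <=
  sum_list (fun q => Rabs (IZR (snd q)) * Rabs (sin (INR (fst q) * y))) bz.
Proof.
  induction bz as [|q bz IH]; simpl.
  - rewrite Rmult_0_l, sin_0, Rabs_R0. lra.
  - rewrite plus_IZR, Rmult_plus_distr_r. eapply Rle_trans; [apply abs_sin_plus|].
    apply Rplus_le_compat; [|apply IH].
    rewrite mult_IZR, <- INR_IZR_INZ, Rmult_assoc. apply abs_sin_mult_Z.
Qed.

Definition cis (y : R) : Complex.C := (cos y, sin y).

Lemma cis_plus a b : cis (a + b) = Cmult (cis a) (cis b).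
Proof. unfold cis, Cmult; simpl. rewrite cos_plus, sin_plus. apply injective_projections; simpl; ring. Qed.

Lemma Cmod_cis y : Cmod (cis y) = 1.
Proof.
  unfold Cmod, cis; simpl. transitivity (sqrt 1); [f_equal|apply sqrt_1].
  pose proof (sin2_cos2 y) as H. unfold Rsqr in H. lra.
Qed.

Lemma Cmod_sub_le z w : Cmod z <= Rabs (Re z - Re w) + Rabs (Im z - Im w) + Cmod w.
Proof.
  replace z with (Cplus (Cminus z w) w) at 1 by ring.
  eapply Rle_trans; [apply Cmod_triangle|]. apply Rplus_le_compat_r.
  replace (Cminus z w) with (Cplus (RtoC (Re z - Re w)) (Cmult Ci (RtoC (Im z - Im w)))).
  2:{ destruct z, w. apply injective_projections; simpl; ring. }
  eapply Rle_trans; [apply Cmod_triangle|].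
  rewrite Cmod_mult, Cmod_Ci, !Cmod_R. lra.
Qed.

Lemma Cmod_le_abs z : Cmod z <= Rabs (Re z) + Rabs (Im z).
Proof.
  pose proof (Cmod_sub_le z (RtoC 0)) as H. rewrite Cmod_0 in H. simpl in H.
  rewrite !Rminus_0_r in H. lra.
Qed.

Fixpoint csum (f : nat -> Complex.C) (n : nat) : Complex.C :=
  match n with O => f O | S m => Cplus (csum f m) (f (S m)) end.

Lemma Re_csum f n : Re (csum f n) = sum_f_R0 (fun k => Re (f k)) n.
Proof. induction n; simpl; auto. rewrite <- IHn. reflexivity. Qed.

Lemma Im_csum f n : Im (csum f n) = sum_f_R0 (fun k => Im (f k)) n.
Proof. induction n; simpl; auto. rewrite <- IHn. reflexivity. Qed.

Lemma Cmod_csum f n : Cmod (csum f n) <= sum_f_R0 (fun k => Cmod (f k)) n.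
Proof.
  induction n; simpl; [lra|]. eapply Rle_trans; [apply Cmod_triangle|]. lra.
Qed.

Lemma csum_mult c f n : Cmult c (csum f n) = csum (fun k => Cmult c (f k)) n.
Proof. induction n; simpl; auto. rewrite <- IHn. ring. Qed.

Lemma csum_ext f g n : (forall k, (k <= n)%nat -> f k = g k) -> csum f n = csum g n.
Proof. intros H. induction n; simpl; auto. rewrite IHn, H by auto. reflexivity. Qed.

Lemma Cmod_pow_sub a b n : Cmod a <= 1 -> Cmod b <= 1 ->
  Cmod (Cminus (Cpow a n) (Cpow b n)) <= INR n * Cmod (Cminus a b).
Proof.
  intros Ha Hb. induction n.
  - simpl. replace (Cminus 1 1) with (RtoC 0) by ring. rewrite Cmod_0. lra.
  - rewrite !Cpow_S, S_INR.
    replace (Cminus (Cmult a (Cpow a n)) (Cmult b (Cpow b n))) with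
      (Cplus (Cmult a (Cminus (Cpow a n) (Cpow b n))) (Cmult (Cminus a b) (Cpow b n))) by ring.
    eapply Rle_trans; [apply Cmod_triangle|]. rewrite !Cmod_mult.
    assert (Cmod (Cpow b n) <= 1).
    { rewrite Cmod_pow. rewrite <- (pow1 n). apply pow_incr. split; [apply Cmod_ge_0|auto]. }
    pose proof (Cmod_ge_0 (Cpow b n)). pose proof (Cmod_ge_0 (Cminus a b)).
    pose proof (Cmod_ge_0 (Cminus (Cpow a n) (Cpow b n))). pose proof (Cmod_ge_0 a). nra.
Qed.

Lemma is_RInt_sum (f : nat -> R -> R) (I : nat -> R) a b n :
  (forall k, (k <= n)%nat -> is_RInt (f k) a b (I k)) ->
  is_RInt (fun t => sum_f_R0 (fun k => f k t) n) a b (sum_f_R0 I n).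
Proof.
  intros H. induction n; simpl; auto.
  apply @is_RInt_plus; auto.
Qed.

Lemma is_RInt_cos_Z (q : Z) :
  is_RInt (fun t => cos (IZR q * t)) (- PI) PI (2 * PI * (if Z.eq_dec q 0 then 1 else 0)).
Proof.
  destruct Z.eq_dec as [->|Hq].
  - apply is_RInt_ext with (fun _ => 1).
    + intros. rewrite Rmult_0_l, cos_0. reflexivity.
    + replace (2 * PI * 1) with (scal (PI - - PI) 1) by (unfold scal; simpl; unfold mult; simpl; ring).
      apply @is_RInt_const.
  - assert (Hq' : IZR q <> 0) by (apply not_0_IZR; auto).
    assert (Hs : sin (IZR q * PI) = 0).
    { pose proof (abs_sin_mult_Z q PI) as H. rewrite sin_PI, Rabs_R0, Rmult_0_r in H.
      pose proof (Rabs_pos (sin (IZR q * PI))).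
      apply Rabs_eq_0. lra. }
    replace (2 * PI * 0) with (minus (sin (IZR q * PI) / IZR q) (sin (IZR q * - PI) / IZR q)).
    2:{ replace (IZR q * - PI) with (- (IZR q * PI)) by ring. rewrite sin_neg, Hs.
        unfold minus, plus, opp; simpl. field. auto. }
    apply (is_RInt_derive (fun t => sin (IZR q * t) / IZR q)).
    + intros t _. auto_derive; auto. field. auto.
    + intros t _. apply @ex_derive_continuous. auto_derive; auto.
Qed.

(** * Fourier inversion *)

Section LLT.
Variables (p : nat -> R) (d : nat).

(** Characteristic function of [(xi - 1) / d], truncated at [D] to be a finite sum. Thanks to the
    division by the span, for large [D] its modulus on [[-PI, PI]] can be close to 1 only near 0. *)
Definition chi (D : nat) (t : R) : Complex.C :=
  csum (fun k => Cmult (RtoC (p k)) (cis ((INR k - 1) / INR d * t))) D.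

Definition trunc (D k : nat) : R := if le_dec k D then p k else 0.

Hypothesis p_ge0 : forall k, 0 <= p k.
Hypothesis d_pos : (1 <= d)%nat.
Hypothesis p_div : forall k, 0 < p k -> Nat.divide d k.

Lemma Re_RtoC_mult a z : Re (Cmult (RtoC a) z) = a * Re z.
Proof. destruct z; simpl. ring. Qed.

(** Expanding the power gives the frequencies [(k_1 + ... + k_n - n - j) / d], integers because the
    span divides every [k_i] in the support as well as [n + j]. Peeling off one factor moves [j] to
    [j - k + 1]. *)
Lemma fourier_inversion D n j : Z.divide (Z.of_nat d) (Z.of_nat n + j) ->
  is_RInt (fun t => Re (Cmult (Cpow (chi D t) n) (cis (- IZR j / INR d * t)))) (- PI) PI
    (2 * PI * cz (trunc D) n (Z.of_nat n + j)).
Proof.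
  assert (Hd : INR d <> 0) by (apply not_0_INR; lia).
  revert j. induction n; intros j [q Hq].
  - apply is_RInt_ext with (fun t => cos (IZR (- q) * t)).
    + intros t _. simpl Cpow. rewrite Cmult_1_l. simpl. f_equal. f_equal.
      replace j with (q * Z.of_nat d)%Z by lia. rewrite mult_IZR, opp_IZR, <- INR_IZR_INZ. field. auto.
    + replace (cz (trunc D) 0 (Z.of_nat 0 + j)) with (if Z.eq_dec (- q) 0 then 1 else 0).
      * apply is_RInt_cos_Z.
      * simpl. destruct (Z.eq_dec (- q) 0), (Z.eq_dec j 0); auto; exfalso; nia.
  - apply is_RInt_ext with (fun t => sum_f_R0 (fun k => p k *
       Re (Cmult (Cpow (chi D t) n) (cis (- IZR (j - Z.of_nat k + 1) / INR d * t)))) D).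
    + intros t _. rewrite Cpow_S.
      replace (Cmult (Cmult (chi D t) (Cpow (chi D t) n)) (cis (- IZR j / INR d * t))) with
        (Cmult (Cmult (Cpow (chi D t) n) (cis (- IZR j / INR d * t))) (chi D t)) by ring.
      unfold chi at 3. rewrite csum_mult, Re_csum. apply sum_eq. intros k _.
      rewrite <- Re_RtoC_mult. f_equal.
      replace (- IZR (j - Z.of_nat k + 1) / INR d * t) with (- IZR j / INR d * t + (INR k - 1) / INR d * t).
      2:{ rewrite plus_IZR, minus_IZR, <- INR_IZR_INZ. field. auto. }
      rewrite cis_plus. ring.
    + rewrite (cz_S _ (max D (Z.to_nat (Z.of_nat (S n) + j)))) by lia.
      rewrite (sum_extend _ D); [|lia|intros k Hk; unfold trunc at 1; destruct le_dec; [lia|ring]].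
      rewrite <- sum_scal. apply is_RInt_sum. intros k Hk.
      (* Outside the support the shifted target may fail to be divisible by [d], so these terms are
         discarded before the induction hypothesis is applied. *)
      destruct (Req_dec (p k) 0) as [H0|H0].
      * apply is_RInt_ext with (fun _ => 0); [intros t _; rewrite H0; symmetry; apply Rmult_0_l|].
        replace (2 * PI * _) with (scal (PI - - PI) 0).
        -- apply @is_RInt_const.
        -- unfold trunc at 1. destruct le_dec; [|lia]. rewrite H0.
           unfold scal; simpl; unfold mult; simpl. ring.
      * destruct (p_div k) as [m Hm]; [specialize (p_ge0 k); lra|].
        replace (2 * PI * _) with
          (scal (p k) (2 * PI * cz (trunc D) n (Z.of_nat n + (j - Z.of_nat k + 1)))).
        -- apply @is_RInt_scal. apply IHn. exists (q - Z.of_nat m)%Z.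
           rewrite Z.mul_sub_distr_r. rewrite <- Hq, <- Nat2Z.inj_mul. subst k. lia.
        -- assert (Ht : trunc D k = p k) by (unfold trunc; destruct le_dec; [auto|lia]). rewrite Ht.
           replace (Z.of_nat n + (j - Z.of_nat k + 1))%Z with (Z.of_nat (S n) + j - Z.of_nat k)%Z by lia.
           unfold scal; simpl; unfold mult; simpl. ring.
Qed.

Lemma cz_trunc D n z : (z <= Z.of_nat D)%Z -> cz (trunc D) n z = cz p n z.
Proof.
  intros H. apply cz_ext. intros k Hk. unfold trunc. destruct le_dec; [auto|lia].
Qed.

Variable bz : list (nat * Z).
Hypothesis bz_pos : forall q, In q bz -> 0 < p (fst q).
Hypothesis bz_sum : bezout_sum bz = Z.of_nat d.
Hypothesis p0_pos : 0 < p 0%nat.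
Hypothesis p_sub : forall N, sum_f_R0 p N <= 1.

Lemma chi_le_1 D t : Cmod (chi D t) <= 1.
Proof.
  eapply Rle_trans; [apply Cmod_csum|]. eapply Rle_trans; [|apply (p_sub D)].
  apply sum_Rle. intros k _. rewrite Cmod_mult, Cmod_cis, Cmod_R, Rabs_pos_eq by auto. lra.
Qed.

(** Up to a phase, [chi] is [p 0 + R], with [R] the sum over the positive steps and [m] their mass.
    Then [|p 0 + R|^2 = (p 0)^2 + 2 p 0 Re R + |R|^2 <= (p 0 + m)^2 - 2 p 0 (m - Re R)], and
    [m - Re R] is the sum in the statement. The atom at 0 is the reference against which all other
    phases are measured. *)
Lemma chi_sq_le D t :
  Cmod (chi D t) ^ 2 <= 1 - 2 * p 0%nat * sum_f_R0 (fun k => p k * (1 - cos (INR k * (t / INR d)))) D.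
Proof.
  assert (Hd : INR d <> 0) by (apply not_0_INR; lia).
  set (y := t / INR d).
  assert (Hchi : chi D t = Cmult (cis (- y)) (csum (fun k => Cmult (RtoC (p k)) (cis (INR k * y))) D)).
  { rewrite csum_mult. apply csum_ext. intros k _.
    replace ((INR k - 1) / INR d * t) with (- y + INR k * y) by (unfold y; field; auto).
    rewrite cis_plus. ring. }
  rewrite Hchi, Cmod_mult, Cmod_cis, Rmult_1_l. clear Hchi.
  set (p' := fun k => if Nat.eq_dec k 0 then 0 else p k).
  assert (Hp' : forall k, 0 <= p' k) by (intros k; unfold p'; destruct Nat.eq_dec; auto; lra).
  assert (Hc : csum (fun k => Cmult (RtoC (p k)) (cis (INR k * y))) D =
    Cplus (RtoC (p 0%nat)) (csum (fun k => Cmult (RtoC (p' k)) (cis (INR k * y))) D)).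
  { induction D; simpl.
    - unfold p'; simpl. rewrite Rmult_0_l. unfold cis. rewrite cos_0, sin_0.
      apply injective_projections; simpl; ring.
    - rewrite IHD. unfold p' at 3. destruct Nat.eq_dec; [lia|]. ring. }
  assert (Hs : sum_f_R0 p D = p 0%nat + sum_f_R0 p' D).
  { clear. induction D; simpl; [unfold p'; simpl; ring|].
    rewrite IHD. unfold p' at 3. destruct Nat.eq_dec; [lia|]. ring. }
  assert (HE : sum_f_R0 (fun k => p k * (1 - cos (INR k * y))) D =
      sum_f_R0 p' D - sum_f_R0 (fun k => p' k * cos (INR k * y)) D).
  { rewrite <- minus_sum. apply sum_eq. intros k _. unfold p'. destruct Nat.eq_dec as [->|]; [|ring].
    simpl. rewrite Rmult_0_l, cos_0. ring. }
  rewrite Hc, HE. set (Rr := csum _ D).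
  assert (HRe : Re Rr = sum_f_R0 (fun k => p' k * cos (INR k * y)) D).
  { unfold Rr. rewrite Re_csum. apply sum_eq. intros; rewrite Re_RtoC_mult. reflexivity. }
  assert (HR : Cmod Rr <= sum_f_R0 p' D).
  { eapply Rle_trans; [apply Cmod_csum|]. apply sum_Rle. intros k _.
    rewrite Cmod_mult, Cmod_cis, Cmod_R, Rabs_pos_eq by auto. lra. }
  rewrite <- HRe. pose proof (p_sub D) as H1. rewrite Hs in H1.
  assert (HR2 : Cmod Rr ^ 2 <= sum_f_R0 p' D ^ 2) by (apply pow_incr; split; [apply Cmod_ge_0|auto]).
  rewrite Cmod2_alt in *.
  replace (Re (Cplus (RtoC (p 0%nat)) Rr)) with (p 0%nat + Re Rr) by (destruct Rr; reflexivity).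
  replace (Im (Cplus (RtoC (p 0%nat)) Rr)) with (Im Rr) by (destruct Rr; simpl; ring).
  pose proof (sum_ge0 p' D (fun k _ => Hp' k)).
  simpl in *. nra.
Qed.

(** If [|chi|] is near 1, the sum in [chi_sq_le] is small, hence [sin (k t / (2 d))] is small at
    each [k] of the certificate, hence so is [sin (t / 2)], hence [t]. Only the support points of
    the certificate have to lie below [D], so one [c] serves every large [D]. *)
Lemma chi_decay : exists c D0, 0 < c /\ forall D t, (D0 <= D)%nat -> Rabs t <= PI ->
  Cmod (chi D t) ^ 2 <= 1 - c * t ^ 2.
Proof.
  assert (Hd : 0 < INR d) by (apply lt_0_INR; lia).
  set (M := 1 + sum_list (fun q => Rabs (IZR (snd q)) / sqrt (2 * p (fst q))) bz).
  assert (HM : 1 <= M).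
  { unfold M. enough (0 <= sum_list (fun q => Rabs (IZR (snd q)) / sqrt (2 * p (fst q))) bz) by lra.
    apply sum_list_ge0. intros q Hq. apply Rmult_le_pos; [apply Rabs_pos|].
    left. apply Rinv_0_lt_compat, sqrt_lt_R0. specialize (bz_pos q Hq). lra. }
  exists (2 * p 0%nat / (36 * M ^ 2)), (list_max (map fst bz)). split.
  { apply Rdiv_lt_0_compat; [lra|]. simpl; nra. }
  intros D t HD Ht.
  eapply Rle_trans; [apply chi_sq_le|].
  set (E := sum_f_R0 _ D).
  assert (HE0 : 0 <= E).
  { apply sum_ge0. intros k _. apply Rmult_le_pos; auto. pose proof (COS_bound (INR k * (t / INR d))). lra. }
  set (x := t / INR d / 2).
  assert (Hsin : Rabs (sin (t / 2)) <= sqrt E * M).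
  { replace (t / 2) with (IZR (bezout_sum bz) * x).
    2:{ rewrite bz_sum, <- INR_IZR_INZ. unfold x. field. lra. }
    eapply Rle_trans; [apply abs_sin_bezout|].
    apply Rle_trans with (sum_list (fun q => sqrt E * (Rabs (IZR (snd q)) / sqrt (2 * p (fst q)))) bz).
    2:{ rewrite sum_list_scal. apply Rmult_le_compat_l; [apply sqrt_pos|]. unfold M. lra. }
    apply sum_list_le. intros q Hq. pose proof (bz_pos q Hq) as Hp.
    assert (Hs : 0 < sqrt (2 * p (fst q))) by (apply sqrt_lt_R0; lra).
    replace (sqrt E * _) with (Rabs (IZR (snd q)) * (sqrt E / sqrt (2 * p (fst q)))) by (field; lra).
    apply Rmult_le_compat_l; [apply Rabs_pos|].
    rewrite <- sqrt_div by lra. rewrite <- sqrt_Rsqr_abs. apply sqrt_le_1_alt.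
    apply Rmult_le_reg_r with (2 * p (fst q)); [lra|].
    replace (E / (2 * p (fst q)) * (2 * p (fst q))) with E by (field; lra).
    assert (Hl : (fst q <= D)%nat).
    { eapply Nat.le_trans; [|apply HD].
      pose proof (proj1 (list_max_le (map fst bz) _) (le_n _)) as HF.
      rewrite Forall_forall in HF. apply HF. apply in_map; auto. }
    eapply Rle_trans; [|apply (term_le_sum (fun k => p k * (1 - cos (INR k * (t / INR d)))) D (fst q)); auto].
    - rewrite one_sub_cos. replace (INR (fst q) * (t / INR d) / 2) with (INR (fst q) * x) by (unfold x; field; lra).
      unfold Rsqr. right. simpl. ring.
    - intros k. apply Rmult_le_pos; auto. pose proof (COS_bound (INR k * (t / INR d))). lra. }
  (* From [z <= PI <= 4] one gets [z ^ 3 / 48 <= z / 3], which leaves [z / 6] of the leading term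
     [z / 2]. *)
  assert (Hlow : Rabs t / 6 <= Rabs (sin (t / 2))).
  { assert (Hz : forall z, 0 <= z <= PI -> z / 6 <= sin (z / 2)).
    { intros z Hz. pose proof (sin_lower (z / 2) ltac:(lra)). pose proof PI_4.
      assert (z ^ 2 <= 16) by (simpl; nra). simpl in *. nra. }
    pose proof (Rabs_pos t). eapply Rle_trans; [apply Hz; lra|].
    unfold Rabs at 1. destruct (Rcase_abs t).
    - replace (- t / 2) with (- (t / 2)) by field. rewrite sin_neg, <- Rabs_Ropp. apply Rle_abs.
    - apply Rle_abs. }
  assert (Hsq : t ^ 2 / 36 <= E * M ^ 2).
  { replace (t ^ 2 / 36) with ((Rabs t / 6) ^ 2).
    2:{ rewrite <- (pow2_abs t). field. }
    replace (E * M ^ 2) with ((sqrt E * M) ^ 2).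
    2:{ rewrite Rpow_mult_distr, pow2_sqrt; auto. }
    apply pow_incr. pose proof (Rabs_pos t). lra. }
  assert (t ^ 2 / (36 * M ^ 2) <= E).
  { apply Rmult_le_reg_r with (M ^ 2); [simpl; nra|].
    eapply Rle_trans; [|apply Hsq]. right. field. lra. }
  apply Rplus_le_compat_l, Ropp_le_contravar.
  replace (2 * p 0%nat / (36 * M ^ 2) * t ^ 2) with (2 * p 0%nat * (t ^ 2 / (36 * M ^ 2))) by (field; lra).
  apply Rmult_le_compat_l; lra.
Qed.

Lemma exp_le_inv x : 0 < x -> exp (- x) <= / x.
Proof.
  intros Hx. rewrite exp_Ropp. apply Rinv_le_contravar; auto.
  pose proof (exp_ineq1_le x). lra.
Qed.

(** Weaker than the bound [exp (- c n t^2 / 2)] from which it is derived, but it has an elementary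
    primitive, and its integral beyond [A / sqrt n] already has the right order [1 / (A sqrt n)]. *)
Lemma chi_pow_le c D t n : 0 < c -> (1 <= n)%nat -> t <> 0 -> Cmod (chi D t) ^ 2 <= 1 - c * t ^ 2 ->
  Cmod (Cpow (chi D t) n) <= 2 / (c * INR n) * / t ^ 2.
Proof.
  intros Hc Hn Ht H. rewrite Cmod_pow.
  assert (Hn0 : 0 < INR n) by (apply lt_0_INR; lia).
  assert (Ht2 : 0 < t ^ 2) by (simpl; nra).
  assert (H1 : Cmod (chi D t) <= exp (- (c * t ^ 2 / 2))).
  { apply Rsqr_incr_0_var; [|left; apply exp_pos]. unfold Rsqr. rewrite <- exp_plus.
    pose proof (exp_ineq1_le (- (c * t ^ 2))).
    replace (- (c * t ^ 2 / 2) + - (c * t ^ 2 / 2)) with (- (c * t ^ 2)) by field.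
    simpl in *. lra. }
  apply Rle_trans with (exp (- (c * t ^ 2 / 2)) ^ n).
  { apply pow_incr. split; [apply Cmod_ge_0|auto]. }
  assert (He : forall m, exp (- (c * t ^ 2 / 2)) ^ m = exp (- (INR m * (c * t ^ 2 / 2)))).
  { intros m. induction m.
    - simpl. rewrite Rmult_0_l, Ropp_0, exp_0. reflexivity.
    - rewrite S_INR. rewrite <- tech_pow_Rmult, IHm, <- exp_plus. f_equal. ring. }
  rewrite He. eapply Rle_trans; [apply exp_le_inv|].
  - apply Rmult_lt_0_compat; [auto|nra].
  - right. field. split; [auto|split; lra].
Qed.
End LLT.

(** * The local limit theorem *)

Lemma exp_neg_taylor x : 0 <= x -> Rabs (exp (- x) - (1 - x)) <= x ^ 2.
Proof.
  intros Hx. pose proof (exp_ineq1_le (- x)). pose proof (exp_ineq1_le x). pose proof (exp_pos (- x)).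
  assert (exp (- x) * exp x = 1) by (rewrite <- exp_plus, Rplus_opp_l; apply exp_0).
  rewrite Rabs_pos_eq by lra.
  assert (exp (- x) * (1 + x) <= 1) by nra.
  enough (exp (- x) <= 1 - x + x ^ 2) by lra.
  apply Rmult_le_reg_r with (1 + x); [lra|]. simpl. nra.
Qed.

Lemma Cmod_cis_sub_1 x : Cmod (Cminus (cis x) (RtoC 1)) <= 2 * Rabs x.
Proof.
  eapply Rle_trans; [apply Cmod_le_abs|]. simpl.
  replace (cos x + - (1)) with (- (1 - cos x)) by ring. replace (sin x + - 0) with (sin x) by ring.
  rewrite Rabs_Ropp, one_sub_cos. pose proof (abs_sin_le x).
  assert (Rabs (2 * sin (x / 2) ^ 2) <= Rabs x); [|lra].
  rewrite Rabs_mult, (Rabs_pos_eq 2), <- RPow_abs by lra.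
  assert (Rabs (sin (x / 2)) <= 1) by (apply Rabs_le, SIN_bound).
  pose proof (abs_sin_le (x / 2)) as H1. rewrite Rabs_div, (Rabs_pos_eq 2) in H1 by lra.
  pose proof (Rabs_pos (sin (x / 2))). simpl. nra.
Qed.

Section LLT.
Variables (p : nat -> R) (d : nat) (V : R).
Hypothesis p_ge0 : forall k, 0 <= p k.
Hypothesis d_pos : (1 <= d)%nat.
Hypothesis p_div : forall k, 0 < p k -> Nat.divide d k.
Variable bz : list (nat * Z).
Hypothesis bz_pos : forall q, In q bz -> 0 < p (fst q).
Hypothesis bz_sum : bezout_sum bz = Z.of_nat d.
Hypothesis p0_pos : 0 < p 0%nat.
Hypothesis p_sum : infinite_sum p 1.
Hypothesis p_mean : infinite_sum (fun k => INR k * p k) 1.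
Hypothesis p_var : infinite_sum (fun k => (INR k - 1) ^ 2 * p k) V.

Let v := V / INR d ^ 2.
Let y (k : nat) := (INR k - 1) / INR d.

Lemma variance_ge0 : 0 <= V.
Proof.
  eapply Rle_trans; [|apply (partial_le_infinite_sum _ _ 0 (fun k => Rmult_le_pos _ _ (pow2_ge_0 _) (p_ge0 k)) p_var)].
  simpl. specialize (p_ge0 0%nat). nra.
Qed.

Lemma INR_span_gt0 : 0 < INR d.
Proof. apply lt_0_INR. lia. Qed.

Lemma scaled_variance_ge0 : 0 <= v.
Proof. pose proof variance_ge0. pose proof INR_span_gt0. apply Rmult_le_pos; auto. left. apply Rinv_0_lt_compat. simpl; nra. Qed.

Lemma sum_scaled_square D : sum_f_R0 (fun k => p k * y k ^ 2) D = / INR d ^ 2 * sum_f_R0 (fun k => (INR k - 1) ^ 2 * p k) D.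
Proof. rewrite <- sum_scal. apply sum_eq. intros k _. unfold y. pose proof INR_span_gt0. field. lra. Qed.

(** Only the variance is finite, so the cubic bound is used up to [K], where the absolute third
    moment [B] is a finite sum, and the quadratic bound beyond, where the tail of the variance is
    small. [K] is fixed before [D], which makes the estimate uniform in the truncation. *)
Lemma taylor_remainder_small eps : 0 < eps -> exists delta K, 0 < delta /\ forall r : R -> R,
  (forall z, Rabs (r z) <= 2 * z ^ 2) -> (forall z, Rabs (r z) <= Rabs z ^ 3) ->
  forall D t, (K <= D)%nat -> Rabs t <= delta ->
  Rabs (sum_f_R0 (fun k => p k * r (y k * t)) D) <= eps * t ^ 2.
Proof.
  intros He. pose proof INR_span_gt0 as Hd.
  destruct (infinite_sum_tail _ _ (eps / 4 * INR d ^ 2)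
     (fun k => Rmult_le_pos _ _ (pow2_ge_0 _) (p_ge0 k)) p_var) as [K HK].
  { simpl. assert (0 < INR d * INR d) by nra. nra. }
  set (B := sum_f_R0 (fun k => p k * Rabs (y k) ^ 3) K).
  assert (HB : 0 <= B) by (apply sum_ge0; intros; apply Rmult_le_pos; auto; apply pow_le, Rabs_pos).
  exists (eps / (2 * (B + 1))), K. split.
  { apply Rdiv_lt_0_compat; lra. }
  intros r Hr2 Hr3 D t HD Ht.
  assert (Ht2 : 0 <= t ^ 2) by apply pow2_ge_0.
  eapply Rle_trans; [apply Rsum_abs|].
  apply Rle_trans with (Rabs t ^ 3 * B + 2 * t ^ 2 *
    (sum_f_R0 (fun k => p k * y k ^ 2) D - sum_f_R0 (fun k => p k * y k ^ 2) K)).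
  - clear HK Ht. induction HD as [|D HD IH].
    + rewrite Rminus_diag, Rmult_0_r, Rplus_0_r. unfold B. rewrite <- sum_scal.
      apply sum_Rle. intros k _. rewrite Rabs_mult, (Rabs_pos_eq (p k)) by auto.
      replace (Rabs t ^ 3 * (p k * Rabs (y k) ^ 3)) with (p k * Rabs (y k * t) ^ 3)
        by (rewrite Rabs_mult; ring).
      apply Rmult_le_compat_l; auto.
    + simpl sum_f_R0 at 1. simpl sum_f_R0 at 1.
      assert (Rabs (p (S D) * r (y (S D) * t)) <= 2 * t ^ 2 * (p (S D) * y (S D) ^ 2)).
      { rewrite Rabs_mult, (Rabs_pos_eq (p _)) by auto.
        replace (2 * t ^ 2 * (p (S D) * y (S D) ^ 2)) with (p (S D) * (2 * (y (S D) * t) ^ 2)) by ring.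
        apply Rmult_le_compat_l; auto. }
      simpl in *. lra.
  - rewrite !sum_scaled_square.
    assert (Hdd : 0 < INR d ^ 2) by (apply pow_lt; auto).
    assert (H1 : / INR d ^ 2 * sum_f_R0 (fun k => (INR k - 1) ^ 2 * p k) D -
       / INR d ^ 2 * sum_f_R0 (fun k => (INR k - 1) ^ 2 * p k) K <= eps / 4).
    { apply Rmult_le_reg_l with (INR d ^ 2); auto.
      pose proof (HK D HD). pose proof (HK K (le_n _)).
      rewrite Rmult_minus_distr_l, <- !Rmult_assoc, Rinv_r by lra. lra. }
    assert (H2 : Rabs t ^ 3 * B <= eps / 2 * t ^ 2).
    { rewrite <- (pow2_abs t). pose proof (Rabs_pos t).
      replace (Rabs t ^ 3 * B) with (Rabs t * B * Rabs t ^ 2) by ring.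
      apply Rmult_le_compat_r; [apply pow2_ge_0|].
      apply Rle_trans with (eps / (2 * (B + 1)) * B); [apply Rmult_le_compat_r; auto|].
      apply Rmult_le_reg_r with (2 * (B + 1)); [lra|].
      replace (eps / (2 * (B + 1)) * B * (2 * (B + 1))) with (eps * B) by (field; lra). nra. }
    nra.
Qed.

(** [delta] is chosen before [rho]: the latter pays for truncating mass, mean and variance at [D]
    and will be of order [1 / n], while the range of [t] must not depend on [n]. *)
Lemma chi_expand eps : 0 < eps -> exists delta, 0 < delta <= 1 /\ forall rho, 0 < rho ->
  exists D0, forall D t, (D0 <= D)%nat -> Rabs t <= delta ->
  Cmod (Cminus (chi p d D t) (RtoC (exp (- (v * t ^ 2 / 2))))) <= eps * t ^ 2 + rho.
Proof.
  intros He. pose proof INR_span_gt0 as Hd. pose proof scaled_variance_ge0 as Hv.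
  destruct (taylor_remainder_small (eps / 3)) as (del & K & Hdel & HT); [lra|].
  set (del3 := eps / 3 / (v ^ 2 + 1)).
  assert (Hdel3 : 0 < del3) by (unfold del3; apply Rdiv_lt_0_compat; [lra|]; simpl; nra).
  exists (Rmin (Rmin del del3) 1). split.
  { split; [repeat apply Rmin_glb_lt; lra|apply Rmin_r]. }
  intros rho Hrho.
  destruct (infinite_sum_tail _ _ (rho / 5) p_ge0 p_sum) as [N1 H1]; [lra|].
  destruct (infinite_sum_tail _ _ (rho / 5) (fun k => Rmult_le_pos _ _ (pos_INR k) (p_ge0 k)) p_mean) as [N2 H2]; [lra|].
  destruct (infinite_sum_tail _ _ (rho / 5) (fun k => Rmult_le_pos _ _ (pow2_ge_0 _) (p_ge0 k)) p_var) as [N3 H3]; [lra|].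
  exists (max K (max N1 (max N2 N3))). intros D t HD Ht.
  assert (Ht1 : Rabs t <= 1) by (eapply Rle_trans; [apply Ht|apply Rmin_r]).
  assert (Htd : Rabs t <= del).
  { eapply Rle_trans; [apply Ht|]. eapply Rle_trans; [apply Rmin_l|apply Rmin_l]. }
  assert (Htd3 : Rabs t <= del3).
  { eapply Rle_trans; [apply Ht|]. eapply Rle_trans; [apply Rmin_l|apply Rmin_r]. }
  clear Ht. specialize (H1 D ltac:(lia)). specialize (H2 D ltac:(lia)). specialize (H3 D ltac:(lia)).
  assert (Ht2 : 0 <= t ^ 2 <= 1).
  { split; [apply pow2_ge_0|]. rewrite <- pow2_abs. pose proof (Rabs_pos t). simpl; nra. }
  assert (Hd1 : / INR d <= 1).
  { rewrite <- Rinv_1. apply Rinv_le_contravar; [lra|]. apply (le_INR 1); auto. }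
  assert (Hd0 : 0 < / INR d) by (apply Rinv_0_lt_compat; auto).
  pose proof (HT (fun z => cos z - 1 + z ^ 2 / 2)
     ltac:(intros z; pose proof (cos_taylor_sq z); pose proof (pow2_ge_0 z); simpl in *; lra) cos_taylor_cube D t ltac:(lia) Htd) as HC.
  pose proof (HT (fun z => sin z - z) abs_sin_sub_id_sq
     ltac:(intros z; pose proof (abs_sin_sub_id z); pose proof (pow_le (Rabs z) 3 (Rabs_pos z)); lra) D t ltac:(lia) Htd) as HS.
  cbv beta in HC, HS.
  assert (HRe : Re (chi p d D t) - (1 - v * t ^ 2 / 2) =
    sum_f_R0 (fun k => p k * (cos (y k * t) - 1 + (y k * t) ^ 2 / 2)) D
    + (sum_f_R0 p D - 1) - t ^ 2 / 2 * (sum_f_R0 (fun k => p k * y k ^ 2) D - v)).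
  { unfold chi. rewrite Re_csum.
    rewrite (sum_eq (fun k => p k * (cos (y k * t) - 1 + (y k * t) ^ 2 / 2))
      (fun k => Re (Cmult (RtoC (p k)) (cis ((INR k - 1) / INR d * t))) - p k + t ^ 2 / 2 * (p k * y k ^ 2))).
    2:{ intros k _. rewrite Re_RtoC_mult. unfold y. simpl Re. field. lra. }
    rewrite plus_sum, minus_sum, sum_scal. field. }
  assert (HIm : Im (chi p d D t) =
    sum_f_R0 (fun k => p k * (sin (y k * t) - y k * t)) D
    + t * / INR d * (sum_f_R0 (fun k => INR k * p k) D - sum_f_R0 p D)).
  { unfold chi. rewrite Im_csum, <- minus_sum, <- sum_scal, <- plus_sum.
    apply sum_eq. intros k _. unfold y. simpl. field. lra. }
  assert (Hvar : Rabs (sum_f_R0 (fun k => p k * y k ^ 2) D - v) <= rho / 5).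
  { rewrite sum_scaled_square. unfold v.
    replace (/ INR d ^ 2 * sum_f_R0 (fun k => (INR k - 1) ^ 2 * p k) D - V / INR d ^ 2) with
      (/ INR d ^ 2 * (sum_f_R0 (fun k => (INR k - 1) ^ 2 * p k) D - V)) by (field; lra).
    rewrite Rabs_mult. rewrite <- pow_inv. rewrite Rabs_pos_eq by (apply pow2_ge_0).
    assert ((/ INR d) ^ 2 <= 1) by (simpl; nra).
    assert (Rabs (sum_f_R0 (fun k => (INR k - 1) ^ 2 * p k) D - V) <= rho / 5) by (apply Rabs_le; lra).
    pose proof (Rabs_pos (sum_f_R0 (fun k => (INR k - 1) ^ 2 * p k) D - V)). pose proof (pow2_ge_0 (/ INR d)). nra. }
  assert (HE : Rabs (1 - v * t ^ 2 / 2 - exp (- (v * t ^ 2 / 2))) <= eps / 3 * t ^ 2).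
  { rewrite Rabs_minus_sym. eapply Rle_trans; [apply exp_neg_taylor|].
    - assert (0 <= v * t ^ 2) by (apply Rmult_le_pos; lra). lra.
    - replace ((v * t ^ 2 / 2) ^ 2) with (v ^ 2 / 4 * t ^ 2 * t ^ 2) by field.
      apply Rmult_le_compat_r; [lra|].
      assert (t ^ 2 <= Rabs t) by (rewrite <- pow2_abs; pose proof (Rabs_pos t); simpl; nra).
      assert (0 <= v ^ 2) by apply pow2_ge_0.
      apply Rle_trans with ((v ^ 2 + 1) * del3).
      + pose proof (Rabs_pos t). nra.
      + unfold del3. right. field. lra. }
  eapply Rle_trans; [apply Cmod_le_abs|].
  replace (Re (Cminus _ _)) with ((Re (chi p d D t) - (1 - v * t ^ 2 / 2)) + (1 - v * t ^ 2 / 2 - exp (- (v * t ^ 2 / 2)))).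
  2:{ destruct (chi p d D t); simpl. ring. }
  replace (Im (Cminus _ _)) with (Im (chi p d D t)) by (destruct (chi p d D t); simpl; ring).
  rewrite HRe, HIm.
  assert (HA1 : Rabs (sum_f_R0 p D - 1) <= rho / 5) by (apply Rabs_le; lra).
  assert (HA2 : Rabs (t ^ 2 / 2 * (sum_f_R0 (fun k => p k * y k ^ 2) D - v)) <= rho / 5).
  { rewrite Rabs_mult, (Rabs_pos_eq (t ^ 2 / 2)) by lra.
    pose proof (Rabs_pos (sum_f_R0 (fun k => p k * y k ^ 2) D - v)). nra. }
  assert (HA3 : Rabs (t * / INR d * (sum_f_R0 (fun k => INR k * p k) D - sum_f_R0 p D)) <= rho / 5).
  { rewrite !Rabs_mult, (Rabs_pos_eq (/ INR d)) by lra.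
    assert (Hx : Rabs (sum_f_R0 (fun k => INR k * p k) D - sum_f_R0 p D) <= rho / 5) by (apply Rabs_le; lra).
    pose proof (Rabs_pos (sum_f_R0 (fun k => INR k * p k) D - sum_f_R0 p D)). pose proof (Rabs_pos t).
    assert (Rabs t * / INR d <= 1) by nra. nra. }
  match goal with |- Rabs (?a + ?b - ?c + ?e) + Rabs (?f + ?g) <= _ =>
    set (a' := a) in *; set (b' := b) in *; set (c' := c) in *; set (e' := e) in *;
    set (f' := f) in *; set (g' := g) in *;
    pose proof (Rabs_triang f' g'); pose proof (Rabs_triang (a' + b' - c') e');
    pose proof (Rabs_triang (a' + b') (- c')); pose proof (Rabs_triang a' b');
    pose proof (Rabs_Ropp c') end.
  unfold Rminus in *. lra.
Qed.

(* [gauss A] increases with [A] to the constant of the local limit theorem, which is never computed: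
   two positions of the walk are compared through the same [gauss A]. *)
Definition gauss (A : R) : R := / (2 * PI) * RInt (fun u => exp (- (v * u ^ 2 / 2))) (- A) A.

Lemma gauss_cont u : continuous (fun u => exp (- (v * u ^ 2 / 2))) u.
Proof. apply @ex_derive_continuous. auto_derive; auto. Qed.

Lemma gauss_mono A : 1 <= A -> gauss 1 <= gauss A.
Proof.
  intros HA. unfold gauss. apply Rmult_le_compat_l.
  { left. apply Rinv_0_lt_compat. pose proof PI_RGT_0. lra. }
  assert (Hex : forall a b, ex_RInt (fun u => exp (- (v * u ^ 2 / 2))) a b).
  { intros. apply @ex_RInt_continuous. intros; apply gauss_cont. }
  rewrite <- (RInt_Chasles _ (- A) (Ropp 1) A), <- (RInt_Chasles _ (Ropp 1) 1 A) by auto.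
  assert (H1 : 0 <= RInt (fun u => exp (- (v * u ^ 2 / 2))) (- A) (Ropp 1)).
  { apply RInt_ge_0; auto; [lra|]. intros; left; apply exp_pos. }
  assert (H2 : 0 <= RInt (fun u => exp (- (v * u ^ 2 / 2))) 1 A).
  { apply RInt_ge_0; auto. intros; left; apply exp_pos. }
  revert H1 H2. set (i1 := RInt _ (- A) (Ropp 1)). set (i2 := RInt _ 1 A). set (i0 := RInt _ (Ropp 1) 1).
  intros H1 H2. change (i0 <= i1 + (i0 + i2)). lra.
Qed.

Lemma gauss_pos : 0 < gauss 1.
Proof.
  unfold gauss. apply Rmult_lt_0_compat.
  { apply Rinv_0_lt_compat. pose proof PI_RGT_0. lra. }
  apply RInt_gt_0; [lra| |].
  - intros; apply exp_pos.
  - intros. apply gauss_cont.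
Qed.

(** The inversion integral is cut at [A / sqrt n]. Outside, the [1 / t ^ 2] bound contributes
    [O(1 / A)]; inside, [chi ^ n] is compared with the [n]-th power of a Gaussian factor through
    [|x ^ n - y ^ n| <= n |x - y|]. Since [C] depends neither on [A] nor on [j], the accuracy is set
    afterwards by the choice of [A]. *)
Lemma local_limit : exists C, 0 < C /\ forall A j, 1 <= A -> exists N, forall n, (N <= n)%nat ->
  Z.divide (Z.of_nat d) (Z.of_nat n + j) ->
  Rabs (sqrt (INR n) * cz p n (Z.of_nat n + j) - gauss A) <= C / A.
Proof.
  pose proof INR_span_gt0 as Hd. pose proof scaled_variance_ge0 as Hv. pose proof PI_RGT_0 as HPI.
  assert (p_sub : forall N, sum_f_R0 p N <= 1) by (intros; apply partial_le_infinite_sum; auto).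
  destruct (chi_decay p d p_ge0 d_pos bz bz_pos bz_sum p0_pos p_sub) as (c & D1 & Hc & Hdec).
  exists (1 + / c). split; [pose proof (Rinv_0_lt_compat c Hc); lra|].
  intros A j HA.
  assert (HA4 : 1 <= A ^ 4) by (apply pow_R1_Rle; auto).
  assert (HA2 : 1 <= A ^ 2) by (apply pow_R1_Rle; auto).
  assert (HA3 : 1 <= A ^ 3) by (apply pow_R1_Rle; auto).
  (* For [|t| <= A / sqrt n], [n] times the error [eps t ^ 2 + eps / n] is at most
     [eps A ^ 2 + eps <= 1 / (2 A ^ 2)]. *)
  set (eps := / (4 * A ^ 4)).
  assert (Heps : 0 < eps) by (apply Rinv_0_lt_compat; lra).
  destruct (chi_expand eps Heps) as (del & Hdel & Hexp).
  pose proof (Rabs_pos (IZR j)) as Hj.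
  (* The first summand puts [A / sqrt n] inside the range [del] of the expansion, the second makes
     the phase [j t / d] negligible there. *)
  set (S0 := A / del + 4 * Rabs (IZR j) * A ^ 3).
  destruct (INR_unbounded (S0 ^ 2 + 1)) as [N HN].
  exists N. intros n Hn Hdiv.
  set (s := sqrt (INR n)).
  assert (HnN : S0 ^ 2 + 1 < INR n) by (apply le_INR in Hn; lra).
  assert (HAd : 0 < A / del) by (apply Rdiv_lt_0_compat; lra).
  assert (HS0 : 0 <= S0) by (unfold S0; nra).
  assert (Hs2 : s * s = INR n) by (apply sqrt_sqrt; apply pos_INR).
  assert (Hs : S0 < s).
  { assert (0 <= s) by apply sqrt_pos. simpl in HnN. nra. }
  assert (Hs0 : 0 < s) by lra.
  assert (Hn0 : 0 < INR n) by (rewrite <- Hs2; nra).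
  assert (Hn1 : (1 <= n)%nat) by (apply INR_lt; simpl; lra).
  destruct (Hexp (eps / INR n)) as [D2 HD2]; [apply Rdiv_lt_0_compat; auto|].
  (* The truncation moves with [n]: beyond [n + j] it leaves the coefficient unchanged, and beyond
     [D2] its error in the expansion is at most [eps / n]. *)
  set (D := max (max D1 D2) (Z.to_nat (Z.of_nat n + j))).
  pose proof (fourier_inversion p d p_ge0 d_pos p_div D n j Hdiv) as HF.
  rewrite (cz_trunc p d) in HF by (unfold D; lia).
  set (f := fun t => Re (Cmult (Cpow (chi p d D t) n) (cis (- IZR j / INR d * t)))) in HF.
  set (W := cz p n (Z.of_nat n + j)) in *.
  set (a := A / s).
  assert (Ha0 : 0 < a) by (apply Rdiv_lt_0_compat; lra).
  assert (Hadel : a <= del).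
  { unfold a. apply Rmult_le_reg_r with s; auto. unfold Rdiv. rewrite Rmult_assoc, Rinv_l by lra.
    assert (A / del <= s) by (unfold S0 in Hs; nra).
    apply Rmult_le_compat_l with (r := del) in H; [|lra].
    replace (del * (A / del)) with A in H by (field; lra). lra. }
  assert (HaPI : a < PI) by (pose proof PI2_1; lra).
  assert (Hf1 : ex_RInt f (- PI) (- a)).
  { apply @ex_RInt_Chasles_1 with PI; [lra|]. eexists; apply HF. }
  assert (Hf23 : ex_RInt f (- a) PI).
  { apply @ex_RInt_Chasles_2 with (- PI); [lra|]. eexists; apply HF. }
  assert (Hf2 : ex_RInt f (- a) a) by (apply @ex_RInt_Chasles_1 with PI; [lra|auto]).
  assert (Hf3 : ex_RInt f a PI) by (apply @ex_RInt_Chasles_2 with (- a); [lra|auto]).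
  assert (Hsplit : 2 * PI * W = RInt f (- PI) (- a) + (RInt f (- a) a + RInt f a PI)).
  { rewrite <- (is_RInt_unique _ _ _ _ HF).
    rewrite <- (RInt_Chasles f (- PI) (- a) PI), <- (RInt_Chasles f (- a) a PI) by auto. reflexivity. }
  set (C0 := 2 / (c * INR n)).
  assert (HC0 : 0 < C0) by (apply Rdiv_lt_0_compat; [lra|apply Rmult_lt_0_compat; auto]).
  assert (Hfle : forall t, t <> 0 -> Rabs t <= PI -> Rabs (f t) <= C0 * / t ^ 2).
  { intros t Ht HtP. unfold f. eapply Rle_trans; [apply re_le_Cmod|].
    rewrite Cmod_mult, Cmod_cis, Rmult_1_r. apply chi_pow_le; auto. apply Hdec; auto. unfold D; lia. }
  assert (Hint : forall x z, x < z -> (0 < x \/ z < 0) ->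
     is_RInt (fun t => C0 * / t ^ 2) x z (C0 * (/ x - / z))).
  { intros x z Hxz Hside.
    replace (C0 * (/ x - / z)) with (minus (- C0 / z) (- C0 / x)).
    2:{ unfold minus, plus, opp; simpl. field. split; destruct Hside; lra. }
    apply (is_RInt_derive (fun t => - C0 / t)).
    - intros t Ht. rewrite Rmin_left, Rmax_right in Ht by lra.
      assert (t <> 0) by (destruct Hside; lra). auto_derive; auto. field. auto.
    - intros t Ht. rewrite Rmin_left, Rmax_right in Ht by lra.
      assert (t <> 0) by (destruct Hside; lra).
      apply @ex_derive_continuous. auto_derive. simpl. rewrite Rmult_1_r. apply Rmult_integral_contrapositive; auto. }
  assert (HI1 : Rabs (RInt f (- PI) (- a)) <= C0 / a).
  { apply Rle_trans with (C0 * (/ (- PI) - / (- a))).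
    - apply (norm_RInt_le f (fun t => C0 * / t ^ 2) (- PI) (- a)).
      + lra.
      + intros t Ht. apply Hfle; [lra|]. apply Rabs_le. lra.
      + apply (@RInt_correct R_CompleteNormedModule); auto.
      + apply Hint; lra.
    - assert (0 < / PI) by (apply Rinv_0_lt_compat; auto). rewrite !Rinv_opp. unfold Rdiv. nra. }
  assert (HI3 : Rabs (RInt f a PI) <= C0 / a).
  { apply Rle_trans with (C0 * (/ a - / PI)).
    - apply (norm_RInt_le f (fun t => C0 * / t ^ 2) a PI).
      + lra.
      + intros t Ht. apply Hfle; [lra|]. apply Rabs_le. lra.
      + apply (@RInt_correct R_CompleteNormedModule); auto.
      + apply Hint; lra.
    - assert (0 < / PI) by (apply Rinv_0_lt_compat; auto). unfold Rdiv. nra. }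
  set (g := fun t => exp (- (v * (s * t) ^ 2 / 2))).
  assert (Hg : is_RInt g (- a) a (/ s * RInt (fun u => exp (- (v * u ^ 2 / 2))) (- A) A)).
  { apply is_RInt_ext with (fun t => scal (/ s) (scal s (exp (- (v * (s * t + 0) ^ 2 / 2))))).
    - intros t _. unfold g. rewrite Rplus_0_r. unfold scal; simpl; unfold mult; simpl. field. lra.
    - apply @is_RInt_scal.
      apply (is_RInt_comp_lin (fun u => exp (- (v * u ^ 2 / 2)))).
      replace (s * - a + 0) with (- A) by (unfold a; field; lra).
      replace (s * a + 0) with A by (unfold a; field; lra).
      apply (@RInt_correct R_CompleteNormedModule), @ex_RInt_continuous. intros; apply gauss_cont. }
  (* A uniform error [1 / A ^ 2] on an interval of length [2 A / sqrt n] is again [O(1 / A)] after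
     multiplication by [sqrt n]. *)
  assert (Hfg : forall t, - a <= t <= a -> Rabs (f t - g t) <= / A ^ 2).
  { intros t Ht.
    assert (Hta : Rabs t <= a) by (apply Rabs_le; lra).
    assert (Hgt : RtoC (g t) = Cpow (RtoC (exp (- (v * t ^ 2 / 2)))) n).
    { rewrite <- RtoC_pow. f_equal. unfold g.
      replace (v * (s * t) ^ 2 / 2) with (INR n * (v * t ^ 2 / 2)) by (rewrite <- Hs2; field).
      generalize (v * t ^ 2 / 2). intros x. clear. induction n; [simpl; rewrite Rmult_0_l, Ropp_0, exp_0; auto|].
      rewrite S_INR, <- tech_pow_Rmult, <- IHn, <- exp_plus. f_equal. ring. }
    assert (Hg1 : Cmod (RtoC (exp (- (v * t ^ 2 / 2)))) <= 1).
    { rewrite Cmod_R, Rabs_pos_eq by (left; apply exp_pos). rewrite <- exp_0.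
      assert (0 <= v * t ^ 2) by (apply Rmult_le_pos; [auto|apply pow2_ge_0]).
      destruct (Req_dec (v * t ^ 2) 0) as [H0|H0]; [rewrite H0; right; f_equal; field|].
      left. apply exp_increasing. lra. }
    set (z := Cpow (chi p d D t) n). set (w := cis (- IZR j / INR d * t)).
    assert (Hz : Cmod z <= 1).
    { unfold z. rewrite Cmod_pow, <- (pow1 n). apply pow_incr. split; [apply Cmod_ge_0|].
      apply chi_le_1; auto. }
    replace (f t - g t) with (Re (Cplus (Cmult z (Cminus w 1)) (Cminus z (RtoC (g t))))).
    2:{ unfold f. fold z w. destruct z, w; simpl. ring. }
    eapply Rle_trans; [apply re_le_Cmod|]. eapply Rle_trans; [apply Cmod_triangle|].
    rewrite Cmod_mult.
    assert (B1 : Cmod (Cminus w 1) <= / (2 * A ^ 2)).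
    { eapply Rle_trans; [apply Cmod_cis_sub_1|].
      replace (- IZR j / INR d * t) with (- (IZR j * t * / INR d)) by (field; lra).
      rewrite Rabs_Ropp, !Rabs_mult.
      assert (Rabs (/ INR d) <= 1).
      { rewrite Rabs_pos_eq by (left; apply Rinv_0_lt_compat; auto).
        rewrite <- Rinv_1. apply Rinv_le_contravar; [lra|]. apply (le_INR 1); auto. }
      pose proof (Rabs_pos t). pose proof (Rabs_pos (/ INR d)).
      apply Rle_trans with (2 * (Rabs (IZR j) * a)).
      { apply Rmult_le_compat_l; [lra|]. rewrite <- (Rmult_1_r (Rabs (IZR j) * a)).
        apply Rmult_le_compat; auto; [apply Rmult_le_pos; auto|apply Rmult_le_compat_l; auto]. }
      unfold a. apply Rmult_le_reg_r with (2 * A ^ 2 * s); [apply Rmult_lt_0_compat; lra|].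
      replace (2 * (Rabs (IZR j) * (A / s)) * (2 * A ^ 2 * s)) with (4 * Rabs (IZR j) * A ^ 3) by (field; lra).
      replace (/ (2 * A ^ 2) * (2 * A ^ 2 * s)) with s by (field; lra).
      unfold S0 in Hs. lra. }
    assert (B2 : Cmod (Cminus z (RtoC (g t))) <= / (2 * A ^ 2)).
    { rewrite Hgt. eapply Rle_trans; [apply Cmod_pow_sub; [apply chi_le_1; auto|auto]|].
      apply Rle_trans with (INR n * (eps * a ^ 2 + eps / INR n)).
      - apply Rmult_le_compat_l; [lra|]. eapply Rle_trans; [apply HD2; [unfold D; lia|lra]|].
        apply Rplus_le_compat_r, Rmult_le_compat_l; [lra|]. rewrite <- (pow2_abs t).
        apply pow_incr. split; [apply Rabs_pos|auto].
      - unfold a. replace (INR n * (eps * (A / s) ^ 2 + eps / INR n)) with (eps * A ^ 2 + eps).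
        2:{ rewrite <- Hs2. field. lra. }
        apply Rle_trans with (2 * eps * A ^ 2); [nra|]. unfold eps. right. field. lra. }
    pose proof (Cmod_ge_0 (Cminus w 1)).
    apply Rle_trans with (/ (2 * A ^ 2) + / (2 * A ^ 2)).
    - apply Rplus_le_compat; auto. nra.
    - right. field. lra. }
  assert (HI2 : Rabs (RInt f (- a) a - / s * RInt (fun u => exp (- (v * u ^ 2 / 2))) (- A) A) <= 2 * a * / A ^ 2).
  { replace (2 * a * / A ^ 2) with ((a - - a) * / A ^ 2) by ring.
    apply (norm_RInt_le_const (fun t => minus (f t) (g t)) (- a) a).
    - lra.
    - intros t Ht. apply Hfg. lra.
    - apply @is_RInt_minus; auto. apply (@RInt_correct R_CompleteNormedModule); auto. }
  replace (s * W - gauss A) with (s / (2 * PI) * (2 * PI * W - / s * RInt (fun u => exp (- (v * u ^ 2 / 2))) (- A) A)).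
  2:{ unfold gauss. field. split; lra. }
  rewrite Rabs_mult, (Rabs_pos_eq (s / (2 * PI))).
  2:{ left. apply Rdiv_lt_0_compat; lra. }
  apply Rle_trans with (s / (2 * PI) * (C0 / a + 2 * a * / A ^ 2 + C0 / a)).
  - apply Rmult_le_compat_l; [left; apply Rdiv_lt_0_compat; lra|].
    rewrite Hsplit.
    set (i1 := RInt f (- PI) (- a)) in *. set (i2 := RInt f (- a) a) in *. set (i3 := RInt f a PI) in *.
    set (m := / s * RInt _ (- A) A) in *.
    replace (i1 + (i2 + i3) - m) with (i1 + (i2 - m) + i3) by ring.
    eapply Rle_trans; [apply Rabs_triang|]. pose proof (Rabs_triang i1 (i2 - m)). lra.
  - unfold C0, a.
    replace (s / (2 * PI) * (2 / (c * INR n) / (A / s) + 2 * (A / s) * / A ^ 2 + 2 / (c * INR n) / (A / s)))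
      with ((1 + 2 / c) / PI * / A).
    2:{ rewrite <- Hs2. field. repeat split; lra. }
    unfold Rdiv at 3. apply Rmult_le_compat_r; [left; apply Rinv_0_lt_compat; lra|].
    pose proof (Rinv_0_lt_compat c Hc). pose proof PI2_1.
    apply Rmult_le_reg_r with PI; auto. unfold Rdiv. rewrite Rmult_assoc, Rinv_l by lra. nra.
Qed.
End LLT.

(** * Ratio limit theorems *)

Lemma bezout_sum_scal c l : bezout_sum (map (fun q => (fst q, (c * snd q)%Z)) l) = (c * bezout_sum l)%Z.
Proof. induction l; simpl; lia. Qed.

Lemma nat_divide_Z a b : Nat.divide a b <-> Z.divide (Z.of_nat a) (Z.of_nat b).
Proof.
  split; intros [c Hc].
  - exists (Z.of_nat c). lia.
  - destruct (Nat.eq_dec a 0) as [->|Ha]; [exists 0%nat; lia|]. exists (Z.to_nat c). nia.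
Qed.

(** The least positive integer combination of support points divides each of them, since a nonzero
    remainder would be a smaller one. The certificate is kept explicit because its coefficients
    enter the decay constant of the characteristic function. *)
Lemma span_bezout (w : nat -> R) d : is_span w d -> (exists k, (1 <= k)%nat /\ 0 < w k) ->
  (1 <= d)%nat /\ exists bz, (forall q, In q bz -> 0 < w (fst q)) /\ bezout_sum bz = Z.of_nat d.
Proof.
  intros [Hdiv Hmax] [k0 [Hk0 Hw0]].
  set (P := fun g : nat => (1 <= g)%nat /\
     exists bz, (forall q, In q bz -> 0 < w (fst q)) /\ bezout_sum bz = Z.of_nat g).
  assert (HP : P k0).
  { split; auto. exists [(k0, 1%Z)]. split.
    - intros q [<-|[]]. auto.
    - cbn [bezout_sum fold_right fst snd]. lia. }
  assert (Hmin : exists g, P g /\ forall g', P g' -> (g <= g')%nat).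
  { destruct (dec_inh_nat_subset_has_unique_least_element P) as [g [Hg _]].
    - intros n. destruct (excluded_middle_informative (P n)); auto.
    - exists k0; auto.
    - exists g. exact Hg. }
  destruct Hmin as [g [[Hg1 [bz [Hbz Hs]]] Hleast]].
  assert (Hgd : forall k, 0 < w k -> Nat.divide g k).
  { intros k Hk. destruct (Nat.eq_dec (k mod g) 0) as [H0|H0].
    - apply Nat.Lcm0.mod_divide; auto.
    - exfalso. pose proof (Nat.mod_upper_bound k g ltac:(lia)).
      enough (g <= k mod g)%nat by lia. apply Hleast. split; [lia|].
      exists ((k, 1%Z) :: map (fun q => (fst q, (- Z.of_nat (k / g) * snd q)%Z)) bz). split.
      + intros q [<-|Hq]; auto. apply in_map_iff in Hq as [q' [<- Hq']]. simpl. auto.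
      + change (1 * Z.of_nat k + bezout_sum (map (fun q => (fst q, (- Z.of_nat (k / g) * snd q)%Z)) bz) = Z.of_nat (k mod g))%Z.
        rewrite bezout_sum_scal, Hs. pose proof (Nat.div_mod_eq k g). nia. }
  assert (Hd0 : d <> 0%nat).
  { intros ->. destruct (Hdiv k0 Hw0). lia. }
  assert (g = d).
  { apply Nat.divide_antisym; [apply Hmax; auto|].
    apply nat_divide_Z. rewrite <- Hs.
    clear - Hdiv Hbz. induction bz as [|q bz IH]; simpl; [apply Z.divide_0_r|].
    apply Z.divide_add_r.
    - apply Z.divide_mul_r. apply nat_divide_Z. apply Hdiv, Hbz. left; auto.
    - apply IH. intros; apply Hbz; right; auto. }
  subst g. split; [lia|]. exists bz; auto.
Qed.

Lemma infinite_sum_finite f D : (forall k, (D < k)%nat -> f k = 0) -> infinite_sum f (sum_f_R0 f D).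
Proof.
  intros H eps He. exists D. intros n Hn. rewrite (sum_extend f D n) by (auto; intros; apply H; lia).
  unfold Rdist. rewrite Rminus_diag, Rabs_R0. auto.
Qed.

Lemma continuity_sum (f : nat -> R -> R) n : (forall k, continuity (f k)) ->
  continuity (fun t => sum_f_R0 (fun k => f k t) n).
Proof.
  intros H. induction n; simpl; auto.
  apply (continuity_plus (fun t => sum_f_R0 (fun k => f k t) n)); auto.
Qed.

Section Ratio.
Variables (p : nat -> R) (d : nat) (bz : list (nat * Z)).
Hypothesis p_ge0 : forall k, 0 <= p k.
Hypothesis d_pos : (1 <= d)%nat.
Hypothesis p_div : forall k, 0 < p k -> Nat.divide d k.
Hypothesis bz_pos : forall q, In q bz -> 0 < p (fst q).
Hypothesis bz_sum : bezout_sum bz = Z.of_nat d.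
Hypothesis p0_pos : 0 < p 0%nat.
Hypothesis p_sum : infinite_sum p 1.
Hypothesis p_mean : infinite_sum (fun k => INR k * p k) 1.

Lemma partial_sum_le_1 N : sum_f_R0 p N <= 1.
Proof. apply partial_le_infinite_sum; auto. Qed.

(** Every step [k >= 1] adds [(k - 1) p k >= 0] to the drift, whose limit is 0, so the partial
    drifts approach 0 from below. *)
Lemma drift_partial_le_0 D : (1 <= D)%nat -> sum_f_R0 (fun k => INR k * p k) D <= sum_f_R0 p D.
Proof.
  intros HD. destruct (Rle_or_lt (sum_f_R0 (fun k => INR k * p k) D) (sum_f_R0 p D)) as [|Hlt]; auto.
  exfalso. set (e := sum_f_R0 (fun k => INR k * p k) D - sum_f_R0 p D) in *.
  destruct (infinite_sum_tail p 1 e p_ge0 p_sum) as [N HN]; [unfold e; lra|].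
  specialize (HN (max N D) ltac:(lia)).
  assert (Hm : forall M, (D <= M)%nat -> e <= sum_f_R0 (fun k => INR k * p k) M - sum_f_R0 p M).
  { induction 1; [unfold e; lra|]. rewrite !tech5. pose proof (p_ge0 (S m)).
    assert (1 <= INR (S m)) by (apply (le_INR 1); lia). nra. }
  specialize (Hm (max N D) ltac:(lia)).
  pose proof (partial_le_infinite_sum _ _ (max N D) (fun k => Rmult_le_pos _ _ (pos_INR k) (p_ge0 k)) p_mean).
  lra.
Qed.

(* The law truncated at [D] is subcritical; tilting it by some [t >= 1] makes it critical with
   finite variance, at an exponential cost that vanishes as [D] grows. *)
Lemma subexponential_lower_bound (k0 : nat) (Hk0 : (2 <= k0)%nat) (Hpk0 : 0 < p k0) eps : 0 < eps ->
  exists N, forall n, (N <= n)%nat -> Z.divide (Z.of_nat d) (Z.of_nat n - 1) ->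
    exp (- eps * INR n) <= cz p n (Z.of_nat n - 1).
Proof.
  (* [(1 - eta) ^ n = exp (- eps n / 2)]; the other half of the exponent is left for the factor
     [1 / sqrt n] of the local limit theorem. *)
  intros He. set (eta := 1 - exp (- (eps / 2))).
  assert (Heta : 0 < eta < 1).
  { unfold eta. pose proof (exp_pos (- (eps / 2))).
    assert (exp (- (eps / 2)) < exp 0) by (apply exp_increasing; lra). rewrite exp_0 in *. lra. }
  destruct (infinite_sum_tail p 1 eta p_ge0 p_sum) as [N1 H1]; [lra|].
  destruct (infinite_sum_tail _ 1 eta (fun k => Rmult_le_pos _ _ (pos_INR k) (p_ge0 k)) p_mean) as [N2 H2]; [lra|].
  set (D := max (max N1 N2) (max k0 (list_max (map fst bz)))).
  specialize (H1 D ltac:(lia)). specialize (H2 D ltac:(lia)).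
  set (f := fun t => sum_f_R0 (fun k => t ^ k * p k) D).
  set (h := fun t => sum_f_R0 (fun k => (INR k - 1) * (t ^ k * p k)) D).
  assert (Hhc : continuity h).
  { apply continuity_sum. intros k. apply derivable_continuous. intros t.
    apply ex_derive_Reals_0. auto_derive; auto. }
  assert (Hh1 : h 1 <= 0).
  { unfold h. rewrite (sum_eq _ (fun k => INR k * p k - p k)) by (intros; rewrite pow1; ring).
    rewrite minus_sum. pose proof (drift_partial_le_0 D ltac:(unfold D; lia)). lra. }
  assert (Hpk1 : p k0 <= 1) by (eapply Rle_trans; [apply (term_le_sum p k0 k0); auto|apply partial_sum_le_1]).
  assert (HT1 : 1 <= / p k0) by (rewrite <- Rinv_1; apply Rinv_le_contravar; lra).
  assert (HhT : 0 <= h (/ p k0)).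
  (* At [T = 1 / p k0] the term of [k0] is at least [T * p k0 = 1], which outweighs the only
     negative term [- p 0 >= -1]. The drift therefore vanishes at some [t] between 1 and [T]. *)
  { set (T := / p k0) in *. unfold h.
    apply Rle_trans with (sum_f_R0 (fun k => (if Nat.eq_dec k 0 then - 1 else 0) + (if Nat.eq_dec k k0 then 1 else 0)) D).
    - rewrite plus_sum, (sum_single _ D 0), (sum_single _ D k0).
      + destruct (Nat.eq_dec 0 0), (Nat.eq_dec k0 k0); try congruence; lra.
      + unfold D; lia.
      + intros k _ Hk. destruct Nat.eq_dec; congruence.
      + lia.
      + intros k _ Hk. destruct Nat.eq_dec; congruence.
    - apply sum_Rle. intros k _. assert (HTk : 0 <= T ^ k) by (apply pow_le; lra).
      pose proof (Rmult_le_pos _ _ HTk (p_ge0 k)).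
      destruct (Nat.eq_dec k 0) as [->|Hne].
      + destruct Nat.eq_dec; [lia|]. simpl. pose proof (partial_sum_le_1 0). simpl in *. lra.
      + assert (1 <= INR k) by (apply (le_INR 1); lia).
        destruct Nat.eq_dec as [->|]; [|nra].
        assert (2 <= INR k0) by (apply (le_INR 2); lia).
        assert (T * p k0 = 1) by (unfold T; field; lra).
        assert (T <= T ^ k0).
        { rewrite <- (pow_1 T) at 1. apply Rle_pow; [auto|lia]. }
        nra. }
  destruct (IVT_cor h 1 (/ p k0) Hhc HT1) as [t [Ht Hht]]; [nra|].
  (* Bernoulli's inequality [t ^ k >= 1 + k (t - 1)], with mass and mean both above [1 - eta],
     bounds the cost [t / f t] of the tilt by [1 / (1 - eta)] per step. *)
  assert (Hft : (1 - eta) * t <= f t).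
  { apply Rle_trans with (sum_f_R0 (fun k => p k + (t - 1) * (INR k * p k)) D).
    - rewrite plus_sum, sum_scal. nra.
    - apply sum_Rle. intros k _. assert (1 + INR k * (t - 1) <= t ^ k).
      { replace (t ^ k) with ((1 + (t - 1)) ^ k) by (f_equal; ring).
        assert (Hu : 0 <= t - 1) by lra. revert Hu. generalize (t - 1). intros u Hu. clear - Hu.
        induction k; [simpl; lra|]. rewrite S_INR, <- tech_pow_Rmult. pose proof (pos_INR k).
        assert (0 <= INR k * u * u) by (repeat apply Rmult_le_pos; auto). nra. }
      specialize (p_ge0 k). nra. }
  assert (Hf0 : 0 < f t) by nra.
  set (q := fun k => t ^ k * trunc p D k / f t).
  assert (Htr : forall k, (k <= D)%nat -> trunc p D k = p k) by (intros; unfold trunc; destruct le_dec; tauto).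
  assert (Htr0 : forall k, (D < k)%nat -> trunc p D k = 0) by (intros; unfold trunc; destruct le_dec; [lia|auto]).
  assert (Htrge : forall k, 0 <= trunc p D k) by (intros k; unfold trunc; destruct le_dec; auto; lra).
  assert (Hqge : forall k, 0 <= q k).
  { intros k. unfold q. apply Rmult_le_pos; [apply Rmult_le_pos; auto; apply pow_le; lra|].
    left; apply Rinv_0_lt_compat; auto. }
  assert (Hqpos : forall k, (k <= D)%nat -> 0 < p k -> 0 < q k).
  { intros k Hk Hp. unfold q. rewrite Htr by auto. apply Rdiv_lt_0_compat; auto.
    apply Rmult_lt_0_compat; auto. apply pow_lt; lra. }
  assert (Hq0 : forall k, (D < k)%nat -> q k = 0).
  { intros k Hk. unfold q. rewrite Htr0 by auto. unfold Rdiv. ring. }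
  assert (Hqdiv : forall k, 0 < q k -> Nat.divide d k).
  { intros k Hk. apply p_div. destruct (le_lt_dec k D) as [HkD|HkD]; [|rewrite Hq0 in Hk by auto; lra].
    destruct (Req_dec (p k) 0) as [H0|H0]; [|specialize (p_ge0 k); lra].
    unfold q in Hk. rewrite Htr, H0 in Hk by auto. unfold Rdiv in Hk. rewrite Rmult_0_r, Rmult_0_l in Hk. lra. }
  assert (Hqs : infinite_sum q 1).
  { replace 1 with (sum_f_R0 q D); [apply infinite_sum_finite; auto|].
    rewrite (sum_eq q (fun k => / f t * (t ^ k * p k))).
    - rewrite sum_scal. fold (f t). field. lra.
    - intros k Hk. unfold q. rewrite Htr by auto. field. lra. }
  assert (Hqm : infinite_sum (fun k => INR k * q k) 1).
  { replace 1 with (sum_f_R0 (fun k => INR k * q k) D);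
      [apply infinite_sum_finite; intros; rewrite Hq0 by auto; ring|].
    rewrite (sum_eq _ (fun k => / f t * ((INR k - 1) * (t ^ k * p k) + t ^ k * p k))).
    - rewrite sum_scal, plus_sum. fold (f t). fold (h t). rewrite Hht. field. lra.
    - intros k Hk. unfold q. rewrite Htr by auto. field. lra. }
  assert (Hqv : infinite_sum (fun k => (INR k - 1) ^ 2 * q k) (sum_f_R0 (fun k => (INR k - 1) ^ 2 * q k) D)).
  { apply infinite_sum_finite. intros k Hk. rewrite Hq0 by auto. ring. }
  set (V := sum_f_R0 (fun k => (INR k - 1) ^ 2 * q k) D) in *.
  assert (Hbz : forall r, In r bz -> 0 < q (fst r)).
  { intros r Hr. apply Hqpos; [|auto].
    pose proof (proj1 (list_max_le (map fst bz) _) (le_n _)) as HF.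
    rewrite Forall_forall in HF. specialize (HF (fst r) (in_map fst _ _ Hr)). unfold D; lia. }
  destruct (local_limit q d V Hqge d_pos Hqdiv bz Hbz bz_sum (Hqpos 0%nat ltac:(lia) p0_pos) Hqs Hqm Hqv)
    as (C & HC & Hlim).
  pose proof (gauss_pos d V) as Hg. set (kap := gauss d V 1 / 2).
  assert (Hkap : 0 < kap) by (unfold kap; lra).
  set (A := Rmax 1 (C / kap)).
  assert (HA : 1 <= A) by apply Rmax_l.
  destruct (Hlim A (-1)%Z HA) as [N HN].
  destruct (INR_unbounded ((2 / (kap * eps)) ^ 2)) as [N' HN'].
  exists (max 1 (max N N')). intros n Hn Hdiv.
  specialize (HN n ltac:(lia) Hdiv).
  assert (HCA : C / A <= kap).
  { apply Rmult_le_reg_r with A; [lra|]. unfold Rdiv. rewrite Rmult_assoc, Rinv_l by lra.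
    pose proof (Rmax_r 1 (C / kap)) as HH. fold A in HH.
    apply Rmult_le_compat_l with (r := kap) in HH; [|lra].
    replace (kap * (C / kap)) with C in HH by (field; lra). lra. }
  pose proof (gauss_mono d V A HA) as HgA.
  apply Rabs_le_between in HN.
  replace (Z.of_nat n + -1)%Z with (Z.of_nat n - 1)%Z in HN by lia.
  set (s := sqrt (INR n)) in *.
  assert (Hn0 : 0 < INR n) by (apply lt_0_INR; lia).
  assert (Hs0 : 0 < s) by (apply sqrt_lt_R0; auto).
  assert (Hs2 : s * s = INR n) by (apply sqrt_sqrt; lra).
  assert (Hlow : kap <= s * cz q n (Z.of_nat n - 1)) by (unfold kap in *; lra).
  assert (Hsbig : 2 / (kap * eps) <= s).
  { assert (0 < 2 / (kap * eps)) by (apply Rdiv_lt_0_compat; [lra|nra]).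
    assert (INR N' <= INR n) by (apply le_INR; lia). simpl in HN'. nra. }
  unfold q in Hlow. rewrite cz_tilt in Hlow by (lra || lia).
  assert (Hczt : cz (trunc p D) n (Z.of_nat n - 1) <= cz p n (Z.of_nat n - 1)).
  { apply cz_mono; auto. intros k. unfold trunc. specialize (p_ge0 k). destruct le_dec; lra. }
  set (W := cz p n (Z.of_nat n - 1)) in *. set (W' := cz (trunc p D) n (Z.of_nat n - 1)) in *.
  replace (Z.to_nat (Z.of_nat n - 1)) with (n - 1)%nat in Hlow by lia.
  assert (Hft0 : 0 < f t ^ n) by (apply pow_lt; auto).
  assert (Htn : 0 < t ^ (n - 1)) by (apply pow_lt; lra).
  assert (Htnf : (1 - eta) ^ n * t ^ (n - 1) <= f t ^ n).
  { apply Rle_trans with (((1 - eta) * t) ^ n); [|apply pow_incr; split; [nra|auto]].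
    rewrite Rpow_mult_distr. apply Rmult_le_compat_l; [apply pow_le; lra|]. apply Rle_pow; [lra|lia]. }
  assert (Hmain : kap * (1 - eta) ^ n <= s * W).
  { apply Rmult_le_reg_r with (t ^ (n - 1)); auto.
    apply Rle_trans with (kap * f t ^ n); [rewrite Rmult_assoc; apply Rmult_le_compat_l; lra|].
    apply Rmult_le_compat_r with (r := f t ^ n) in Hlow; [|lra].
    replace (s * (t ^ (n - 1) / f t ^ n * W') * f t ^ n) with (s * W' * t ^ (n - 1)) in Hlow by (field; lra).
    eapply Rle_trans; [apply Hlow|]. apply Rmult_le_compat_r; [lra|]. apply Rmult_le_compat_l; lra. }
  assert (Hexpn : (1 - eta) ^ n = exp (- (eps / 2) * INR n)).
  { unfold eta. replace (1 - (1 - exp (- (eps / 2)))) with (exp (- (eps / 2))) by ring.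
    generalize (- (eps / 2)). intros x. clear. induction n; [simpl; rewrite Rmult_0_r, exp_0; auto|].
    rewrite S_INR, <- tech_pow_Rmult, IHn, <- exp_plus. f_equal. ring. }
  rewrite Hexpn in Hmain.
  replace (- eps * INR n) with (- (eps / 2) * INR n + - (eps / 2 * INR n)) by field.
  rewrite exp_plus. set (E := exp (- (eps / 2) * INR n)) in *.
  assert (HE : 0 < E) by apply exp_pos.
  apply Rmult_le_reg_l with s; auto. eapply Rle_trans; [|apply Hmain].
  assert (H3 : exp (- (eps / 2 * INR n)) <= / (eps / 2 * INR n)) by (apply exp_le_inv; nra).
  assert (H4 : s * / (eps / 2 * INR n) <= kap).
  { rewrite <- Hs2. replace (s * / (eps / 2 * (s * s))) with (2 / eps / s) by (field; lra).
    apply Rmult_le_reg_r with (s / kap); [apply Rdiv_lt_0_compat; auto|].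
    replace (2 / eps / s * (s / kap)) with (2 / (kap * eps)) by (field; lra).
    replace (kap * (s / kap)) with s by (field; lra). auto. }
  apply Rle_trans with (E * (s * / (eps / 2 * INR n))); [|rewrite (Rmult_comm kap); apply Rmult_le_compat_l; lra].
  replace (s * (E * exp (- (eps / 2 * INR n)))) with (E * (s * exp (- (eps / 2 * INR n)))) by ring.
  apply Rmult_le_compat_l; [lra|]. apply Rmult_le_compat_l; lra.
Qed.

Definition nat_sum (xs : list nat) : nat := fold_right Nat.add 0%nat xs.

(** The steps of the pattern are removed one at a time, each at the price of a factor near 1.
    [cz_one_step_lower] asks for a subexponential lower bound on the walk already shortened; the
    induction hypothesis supplies it, bounding that coefficient below by half of the original
    one. *)
Lemma pattern_ratio (k0 : nat) (Hk0 : (2 <= k0)%nat) (Hpk0 : 0 < p k0) xs :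
  (forall x, In x xs -> 0 < p x) -> forall eta, 0 < eta <= 1 / 2 ->
  exists N, forall n, (N <= n)%nat -> Z.divide (Z.of_nat d) (Z.of_nat n - 1) ->
    (1 - eta) * cz p n (Z.of_nat n - 1) <=
      cz p (n - length xs) (Z.of_nat n - 1 - Z.of_nat (nat_sum xs)).
Proof.
  induction xs as [|x xs IH]; intros Hxs eta Heta.
  - exists 0%nat. intros n _ _. simpl. rewrite Nat.sub_0_r, Z.sub_0_r.
    pose proof (cz_ge0 p p_ge0 n (Z.of_nat n - 1)). nra.
  - pose proof (Hxs x (or_introl eq_refl)) as Hx.
    destruct (IH (fun y Hy => Hxs y (or_intror Hy)) (eta / 2)) as [N1 HN1]; [lra|].
    set (th := 1 - eta / 4).
    assert (Hth : 0 < th < 1) by (unfold th; lra).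
    set (eps := p x * (1 - th) * (eta / 4)).
    assert (Heps : 0 < eps) by (unfold eps; repeat apply Rmult_lt_0_compat; lra).
    destruct (subexponential_lower_bound k0 Hk0 Hpk0 (eps / 2)) as [N2 HN2]; [lra|].
    set (l := length xs) in *.
    destruct (INR_unbounded (2 * INR l + 2 / eps)) as [N3 HN3].
    exists (max (S l) (max N1 (max N2 N3))). intros n Hn Hdiv.
    specialize (HN1 n ltac:(lia) Hdiv). specialize (HN2 n ltac:(lia) Hdiv).
    set (W := cz p n (Z.of_nat n - 1)) in *.
    set (z := (Z.of_nat n - 1 - Z.of_nat (nat_sum xs))%Z) in *.
    assert (HW : 0 < W) by (eapply Rlt_le_trans; [apply exp_pos|apply HN2]).
    (* The bound was requested with [eps / 2]; the remaining [eps / 2 * n] covers the constant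
       [1 / 2] and the [l] removed steps once [n >= 2 l + 2 / eps]. *)
    assert (Hlow : exp (- eps * INR (n - l)) <= cz p (n - l) z).
    { apply Rle_trans with (/ 2 * W); [|nra].
      apply Rle_trans with (/ 2 * exp (- (eps / 2) * INR n)); [|lra].
      assert (Hn3 : INR N3 <= INR n) by (apply le_INR; lia).
      rewrite minus_INR by lia.
      assert (H2 : 2 <= exp 1) by (pose proof (exp_ineq1_le 1); lra).
      assert (Hinv : exp (Ropp 1) <= / 2).
      { rewrite exp_Ropp. apply Rinv_le_contravar; lra. }
      apply Rle_trans with (exp (Ropp 1) * exp (- (eps / 2) * INR n)).
      2:{ apply Rmult_le_compat_r; [left; apply exp_pos|auto]. }
      rewrite <- exp_plus.
      assert (Hle : - eps * (INR n - INR l) <= Ropp 1 + - (eps / 2) * INR n).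
      { assert (eps * (2 * INR l + 2 / eps) <= eps * INR n) by (apply Rmult_le_compat_l; lra).
        replace (eps * (2 * INR l + 2 / eps)) with (2 * eps * INR l + 2) in H by (field; lra). lra. }
      destruct Hle as [Hlt|Heq]; [left; apply exp_increasing; auto|right; f_equal; auto]. }
    pose proof (cz_one_step_lower p x th p_ge0 Hth (n - l) z eps partial_sum_le_1 Hx ltac:(lia) Hlow) as Hst.
    simpl length. simpl nat_sum. fold l.
    replace (n - S l)%nat with (n - l - 1)%nat by lia.
    replace (Z.of_nat n - 1 - Z.of_nat (x + nat_sum xs))%Z with (z - Z.of_nat x)%Z by (unfold z; lia).
    eapply Rle_trans; [|apply Hst].
    replace (eps / (p x * (1 - th))) with (eta / 4) by (unfold eps; field; lra).
    apply Rle_trans with (th * (1 - eta / 4) * ((1 - eta / 2) * W)).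
    + unfold th. assert (1 - eta <= (1 - eta / 4) * (1 - eta / 4) * (1 - eta / 2)) by nra. nra.
    + apply Rmult_le_compat_l; [unfold th; nra|auto].
Qed.

(** Both coefficients, which have end points [-1] and [0] for the centred walk, are compared with
    the same [gauss A]. The condition [2 m <= n] keeps [n - m] in the range of the local limit
    theorem, and replacing [sqrt (n - m)] by [sqrt n] only helps. *)
Lemma ratio_finite_variance V : infinite_sum (fun k => (INR k - 1) ^ 2 * p k) V ->
  forall eps, 0 < eps -> exists N, forall n, (N <= n)%nat -> Z.divide (Z.of_nat d) (Z.of_nat n - 1) ->
  forall m, (2 * m <= n)%nat -> Z.divide (Z.of_nat d) (Z.of_nat m - 1) ->
    (1 - eps) * cz p n (Z.of_nat n - 1) <= cz p (n - m) (Z.of_nat (n - m)).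
Proof.
  intros HV eps He.
  destruct (local_limit p d V p_ge0 d_pos p_div bz bz_pos bz_sum p0_pos p_sum p_mean HV) as (C & HC & Hlim).
  pose proof (gauss_pos d V) as Hg.
  set (e := Rmin 1 eps).
  assert (Hee : 0 < e <= 1) by (split; [apply Rmin_glb_lt; lra|apply Rmin_l]).
  assert (Hee' : e <= eps) by apply Rmin_r.
  set (kap := e * gauss d V 1 / 4).
  assert (Hkap : 0 < kap) by (unfold kap; nra).
  (* The error [C / A] becomes at most [kap], a small fraction of [gauss 1], which in turn bounds
     [gauss A] from below. *)
  set (A := Rmax 1 (C / kap)).
  assert (HA : 1 <= A) by apply Rmax_l.
  assert (HCA : C / A <= kap).
  { apply Rmult_le_reg_r with A; [lra|]. unfold Rdiv. rewrite Rmult_assoc, Rinv_l by lra.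
    pose proof (Rmax_r 1 (C / kap)) as HH. fold A in HH.
    apply Rmult_le_compat_l with (r := kap) in HH; [|lra].
    replace (kap * (C / kap)) with C in HH by (field; lra). lra. }
  pose proof (gauss_mono d V A HA) as HgA.
  destruct (Hlim A (-1)%Z HA) as [N1 HN1]. destruct (Hlim A 0%Z HA) as [N2 HN2].
  exists (max 1 (max N1 (2 * N2))). intros n Hn Hdn m Hm Hdm.
  specialize (HN1 n ltac:(lia) Hdn).
  assert (Hdnm : Z.divide (Z.of_nat d) (Z.of_nat (n - m) + 0)).
  { replace (Z.of_nat (n - m) + 0)%Z with ((Z.of_nat n - 1) - (Z.of_nat m - 1))%Z by lia.
    apply Z.divide_sub_r; auto. }
  specialize (HN2 (n - m)%nat ltac:(lia) Hdnm).
  apply Rabs_le_between in HN1. apply Rabs_le_between in HN2.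
  rewrite Z.add_0_r in HN2.
  replace (Z.of_nat n + -1)%Z with (Z.of_nat n - 1)%Z in HN1 by lia.
  set (a := cz p n _) in *. set (b := cz p (n - m) _) in *.
  assert (Hb : 0 <= b) by (apply cz_ge0; auto).
  assert (Hs : sqrt (INR (n - m)) <= sqrt (INR n)) by (apply sqrt_le_1_alt, le_INR; lia).
  assert (Hs0 : 0 < sqrt (INR n)) by (apply sqrt_lt_R0, lt_0_INR; lia).
  apply Rmult_le_reg_l with (sqrt (INR n)); auto.
  apply Rle_trans with (sqrt (INR (n - m)) * b); [|apply Rmult_le_compat_r; auto].
  assert (Ha : gauss d V 1 / 2 <= sqrt (INR n) * a) by (unfold kap in *; nra).
  replace (sqrt (INR n) * ((1 - eps) * a)) with ((1 - eps) * (sqrt (INR n) * a)) by ring.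
  unfold kap in *. set (u := sqrt (INR n) * a) in *. set (w := sqrt (INR (n - m)) * b) in *. nra.
Qed.
End Ratio.

(** * Enumeration of forests *)

Section TreeBasics.
Context {Sp : nat -> Type}.

Lemma etree_nested_ind (P : etree Sp -> Prop)
  (H : forall d s ch, Forall P ch -> P (ENode d s ch)) : forall t, P t.
Proof.
  fix IH 1. intros [d s ch]. apply H.
  induction ch as [|c ch IHch]; constructor; auto.
Qed.

Definition fsize (l : list (etree Sp)) : nat := fold_right (fun c a => (esize c + a)%nat) 0%nat l.
Definition fprod (g : forall d, Sp d -> R) (l : list (etree Sp)) : R :=
  fold_right (fun c a => ewprod g c * a) 1 l.

Lemma ewf_node d (s : Sp d) ch : ewf (ENode d s ch) <-> length ch = d /\ Forall ewf ch.
Proof.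
  simpl. apply and_iff_compat_l.
  induction ch as [|c ch IH]; [split; constructor|].
  rewrite IH. symmetry. apply Forall_cons_iff.
Qed.

Lemma esize_node d (s : Sp d) ch : esize (ENode d s ch) = S (fsize ch).
Proof. reflexivity. Qed.

Lemma ewprod_node g d (s : Sp d) ch : ewprod g (ENode d s ch) = g d s * fprod g ch.
Proof. reflexivity. Qed.

Lemma fsize_app l l' : fsize (l ++ l') = (fsize l + fsize l')%nat.
Proof. induction l; simpl; lia. Qed.

Lemma fprod_app g l l' : fprod g (l ++ l') = fprod g l * fprod g l'.
Proof. induction l; simpl; [ring|]. rewrite IHl. ring. Qed.

Lemma esize_pos (t : etree Sp) : (1 <= esize t)%nat.
Proof. destruct t. rewrite esize_node. lia. Qed.

Lemma length_le_fsize l : (length l <= fsize l)%nat.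
Proof. induction l as [|t l IH]; simpl; [lia|]. pose proof (esize_pos t). lia. Qed.

Lemma ewprod_ge0 (g : forall d, Sp d -> R) : (forall d s, 0 <= g d s) -> forall t, 0 <= ewprod g t.
Proof.
  intros Hg. apply etree_nested_ind. intros d s ch IH. rewrite ewprod_node.
  apply Rmult_le_pos; auto. induction IH; simpl; [lra|]. apply Rmult_le_pos; auto.
Qed.

Lemma fprod_ge0 (g : forall d, Sp d -> R) l : (forall d s, 0 <= g d s) -> 0 <= fprod g l.
Proof. intros Hg. induction l; simpl; [lra|]. apply Rmult_le_pos; auto using ewprod_ge0. Qed.

Fixpoint verts (t : etree Sp) : list (list nat) :=
  match t with
  | ENode _ _ ch => [] :: (fix go (l : list (etree Sp)) (i : nat) :=
      match l with nil => nil | c :: l' => map (cons i) (verts c) ++ go l' (S i) end) ch 0%nat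
  end.

Fixpoint fverts (l : list (etree Sp)) (i : nat) : list (list nat) :=
  match l with nil => nil | c :: l' => map (cons i) (verts c) ++ fverts l' (S i) end.

Lemma verts_node d (s : Sp d) ch : verts (ENode d s ch) = [] :: fverts ch 0.
Proof. reflexivity. Qed.

Lemma fverts_In l i a : In a (fverts l i) <->
  exists j c b, nth_error l j = Some c /\ a = (i + j)%nat :: b /\ In b (verts c).
Proof.
  revert i. induction l as [|c l IH]; intros i; simpl.
  - split; [tauto|]. intros (j & c & b & H & _). destruct j; discriminate.
  - rewrite in_app_iff, IH, in_map_iff. split.
    + intros [(b & <- & Hb)|(j & c' & b & H & -> & Hb)].
      * exists 0%nat, c, b. rewrite Nat.add_0_r. auto.
      * exists (S j), c', b. split; [auto|]. split; [f_equal; lia|auto].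
    + intros ([|j] & c' & b & H & -> & Hb).
      * left. simpl in H. injection H as <-. exists b. rewrite Nat.add_0_r. auto.
      * right. exists j, c', b. split; [auto|]. split; [f_equal; lia|auto].
Qed.

Lemma verts_In (t : etree Sp) : forall a, In a (verts t) <-> is_vertex t a.
Proof.
  revert t. apply (etree_nested_ind (fun t => forall a, In a (verts t) <-> is_vertex t a)).
  intros d s ch IH a. rewrite verts_node. unfold is_vertex.
  destruct a as [|i a]; [simpl; split; [discriminate|auto]|]. cbn [In subtree_at].
  rewrite fverts_In. destruct (nth_error ch i) as [c|] eqn:E.
  - rewrite Forall_forall in IH. specialize (IH c (nth_error_In _ _ E) a). split.
    + intros [H|(j & c' & b & Hj & He & Hb)]; [discriminate|].
      injection He as -> ->. simpl in E. rewrite E in Hj. injection Hj as ->. apply IH; auto.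
    + intros H. right. exists i, c, a. split; [auto|]. split; [auto|apply IH; auto].
  - split; [|tauto]. intros [H|(j & c' & b & Hj & He & Hb)]; [discriminate|].
    injection He as -> ->. simpl in E. congruence.
Qed.

Lemma verts_NoDup (t : etree Sp) : NoDup (verts t).
Proof.
  revert t. apply etree_nested_ind. intros d s ch IH. rewrite verts_node.
  constructor.
  - rewrite fverts_In. intros (j & c & b & _ & H & _). discriminate.
  - generalize 0%nat. induction IH as [|c ch Hc IH IHf]; intros i; simpl; [constructor|].
    apply NoDup_app; auto.
    + apply NoDup_map_inj; auto. intros; congruence.
    + intros a Ha Hb. apply in_map_iff in Ha as (b & <- & _).
      apply fverts_In in Hb as (j & c' & b' & _ & H & _). injection H. lia.
Qed.

Lemma verts_length (t : etree Sp) : length (verts t) = esize t.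
Proof.
  revert t. apply etree_nested_ind. intros d s ch IH. rewrite verts_node, esize_node.
  simpl. f_equal. generalize 0%nat. induction IH as [|c ch Hc IH IHf]; intros i; simpl; auto.
  rewrite length_app, length_map, IHf, Hc. reflexivity.
Qed.

Definition occ (B t : etree Sp) : R := sum_list (fun b => ind (subtree_at t b = Some B)) (verts t).

Lemma occ_node B d (s : Sp d) ch :
  occ B (ENode d s ch) = ind (ENode d s ch = B) + sum_list (occ B) ch.
Proof.
  unfold occ at 1. rewrite verts_node. simpl sum_list. f_equal.
  - unfold ind. repeat destruct excluded_middle_informative; auto; exfalso; congruence.
  - assert (forall pre l, ch = pre ++ l ->
      sum_list (fun b => ind (subtree_at (ENode d s ch) b = Some B)) (fverts l (length pre)) = sum_list (occ B) l).
    { intros pre l. revert pre. induction l as [|c l IH]; intros pre Hp; simpl; auto.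
      rewrite sum_list_app, sum_list_map. f_equal.
      - unfold occ. apply sum_list_ext. intros b _. simpl. subst ch.
        rewrite nth_error_app2, Nat.sub_diag by lia. reflexivity.
      - specialize (IH (pre ++ [c])). rewrite length_app in IH. simpl in IH.
        rewrite Nat.add_1_r in IH. apply IH. rewrite Hp, <- app_assoc. reflexivity. }
    apply (H []). reflexivity.
Qed.

Lemma occ_ge0 B t : 0 <= occ B t.
Proof. apply sum_list_ge0. intros. apply ind_range. Qed.

Variable enum : forall k, list (Sp k).
Hypothesis enum_nodup : forall k, NoDup (enum k).
Hypothesis enum_all : forall k s, In s (enum k).

(* The forests of [r] trees with [n] vertices in total: removing the root of the first tree leaves a
   forest of [k + r - 1] trees with [n - 1] vertices. *)
Fixpoint forests (n r : nat) {struct n} : list (list (etree Sp)) :=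
  match r, n with
  | O, O => [[]]
  | O, S _ => []
  | S _, O => []
  | S r', S n' =>
      flat_map (fun k => flat_map (fun s => map (fun fo => ENode k s (firstn k fo) :: skipn k fo)
        (forests n' (k + r'))) (enum k)) (seq 0 (S n'))
  end.

Lemma forests_In n : forall r fo,
  In fo (forests n r) <-> length fo = r /\ Forall ewf fo /\ fsize fo = n.
Proof.
  induction n as [|n IH]; intros r fo.
  - destruct r; simpl.
    + split; [intros [<-|[]]; simpl; auto|]. intros (H & _). left. destruct fo; [auto|discriminate].
    + split; [tauto|]. intros (H & _ & H'). pose proof (length_le_fsize fo). lia.
  - destruct r as [|r].
    + simpl. split; [tauto|]. intros (H & _ & H'). destruct fo; discriminate.
    + cbn [forests]. rewrite in_flat_map. split.
      * intros (k & Hk & H). apply in_flat_map in H as (s & Hs & H).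
        apply in_map_iff in H as (fo' & <- & H). apply IH in H as (Hl & Hw & Hz).
        assert (Hlk : length (firstn k fo') = k) by (rewrite length_firstn; lia).
        rewrite <- (firstn_skipn k fo'), Forall_app in Hw.
        rewrite <- (firstn_skipn k fo'), fsize_app in Hz.
        split; [simpl; rewrite length_skipn; lia|]. split.
        -- constructor; [|tauto]. apply ewf_node. tauto.
        -- cbn [fsize fold_right]. rewrite esize_node. unfold fsize in *. lia.
      * intros (Hl & Hw & Hz). destruct fo as [|[k s ch] rest]; [discriminate|].
        inversion Hw as [|? ? Hw1 Hw2]; subst. apply ewf_node in Hw1 as [Hlen Hw1].
        cbn [fsize fold_right] in Hz. rewrite esize_node in Hz.
        assert (Hz' : (fsize ch + fsize rest = n)%nat) by (unfold fsize in *; lia).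
        pose proof (length_le_fsize ch).
        exists k. split; [apply in_seq; lia|]. apply in_flat_map. exists s. split; auto.
        apply in_map_iff. exists (ch ++ rest). subst k. split.
        -- rewrite firstn_app, skipn_app, Nat.sub_diag, firstn_all, skipn_all. simpl. rewrite app_nil_r. auto.
        -- apply IH. rewrite length_app, fsize_app, Forall_app. simpl in Hl. split; [lia|auto].
Qed.

Lemma forests_NoDup n : forall r, NoDup (forests n r).
Proof.
  induction n as [|n IH]; intros r.
  - destruct r; simpl; repeat constructor; simpl; tauto.
  - destruct r as [|r]; [constructor|]. cbn [forests].
    apply NoDup_flat_map; [apply seq_NoDup| |].
    + intros k _. apply NoDup_flat_map; auto.
      * intros s _. apply NoDup_map_inj; auto. intros fo fo' _ _ He.
        injection He as He1 He2. rewrite <- (firstn_skipn k fo), <- (firstn_skipn k fo'). congruence.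
      * intros s s' y _ _ H H'. apply in_map_iff in H as (fo & <- & _). apply in_map_iff in H' as (fo' & H' & _).
        injection H' as H' _ _. apply inj_pair2_eq_dec in H'; auto. apply Nat.eq_dec.
    + intros k k' y _ _ H H'. apply in_flat_map in H as (s & _ & H). apply in_flat_map in H' as (s' & _ & H').
      apply in_map_iff in H as (fo & <- & _). apply in_map_iff in H' as (fo' & H' & _).
      injection H'. auto.
Qed.

Lemma sum_forests f n r : sum_list f (forests (S n) (S r)) =
  sum_f_R0 (fun k => sum_list (fun s => sum_list (fun fo => f (ENode k s (firstn k fo) :: skipn k fo))
     (forests n (k + r))) (enum k)) n.
Proof.
  cbn [forests]. rewrite sum_f_R0_list, sum_list_flat_map. apply sum_list_ext. intros k _.
  rewrite sum_list_flat_map. apply sum_list_ext. intros s _. apply sum_list_map.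
Qed.

Variable g : forall d, Sp d -> R.
Hypothesis g_ge0 : forall d s, 0 <= g d s.
Definition offspring (k : nat) : R := sum_list (g k) (enum k).

Definition Fsum (n r : nat) : R := sum_list (fprod g) (forests n r).
(** With the weights of the conditioned tree and [r = 1], this is [n Zn] times the probability that
    a uniform vertex is the root of a fringe subtree equal to [B]. *)
Definition Msum (B : etree Sp) (n r : nat) : R :=
  sum_list (fun fo => fprod g fo * sum_list (occ B) fo) (forests n r).

Lemma fprod_unroot k s fo :
  fprod g (ENode k s (firstn k fo) :: skipn k fo) = g k s * fprod g fo.
Proof.
  cbn [fprod fold_right]. rewrite ewprod_node, Rmult_assoc. f_equal.
  rewrite <- (firstn_skipn k fo) at 3. symmetry. apply fprod_app.
Qed.

Lemma Fsum_S n r : Fsum (S n) (S r) = sum_f_R0 (fun k => offspring k * Fsum n (k + r)) n.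
Proof.
  unfold Fsum at 1. rewrite sum_forests. apply sum_eq. intros k _.
  unfold offspring. rewrite <- sum_list_scal_r. apply sum_list_ext. intros s _.
  unfold Fsum. rewrite <- sum_list_scal. apply sum_list_ext. intros fo _. apply fprod_unroot.
Qed.

(** The cycle lemma, in the form of the Otter-Dwass formula. Deleting the first root is the first
    step of the depth-first walk, and [cz_exch] closes the resulting recursion in place of rotating
    sequences. *)
Lemma Fsum_cz n : forall r, INR n * Fsum n r = INR r * cz offspring n (Z.of_nat n - Z.of_nat r).
Proof.
  induction n as [|n IH]; intros r.
  - destruct r as [|r]; [simpl; ring|]. rewrite cz_neg by lia. simpl INR. ring.
  - destruct r as [|r]; [unfold Fsum; simpl; ring|].
    rewrite Fsum_S. replace (Z.of_nat (S n) - Z.of_nat (S r))%Z with (Z.of_nat n - Z.of_nat r)%Z by lia.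
    set (z := (Z.of_nat n - Z.of_nat r)%Z).
    assert (Hz : (z <= Z.of_nat n)%Z) by (unfold z; lia).
    (* The induction hypothesis carries no information about [Fsum 0], being multiplied by [INR 0];
       a single vertex is treated by hand. *)
    destruct n as [|n].
    + rewrite (cz_S _ 0) by lia. cbn [sum_f_R0 cz Nat.add]. unfold z.
      destruct r as [|r].
      * unfold Fsum; simpl. ring.
      * unfold Fsum. cbn [forests sum_list fold_right]. destruct Z.eq_dec; [lia|]. ring.
    + set (N := S n) in *.
      assert (HN : 0 < INR N) by (apply lt_0_INR; unfold N; lia).
      apply Rmult_eq_reg_l with (INR N); [|lra].
      assert (E : INR N * sum_f_R0 (fun k => offspring k * Fsum N (k + r)) N =
         INR r * cz offspring (S N) z + sum_f_R0 (fun k => INR k * offspring k * cz offspring N (z - Z.of_nat k)) N).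
      { rewrite (cz_S offspring N) by auto. rewrite <- !sum_scal, <- plus_sum. apply sum_eq. intros k _.
        replace (INR N * (offspring k * Fsum N (k + r))) with (offspring k * (INR N * Fsum N (k + r))) by ring.
        rewrite IH, plus_INR. replace (Z.of_nat N - Z.of_nat (k + r))%Z with (z - Z.of_nat k)%Z by (unfold z; lia). ring. }
      pose proof (cz_exch offspring N N z Hz) as Hx.
      replace (INR N * (INR (S N) * sum_f_R0 (fun k => offspring k * Fsum N (k + r)) N)) with
        (INR (S N) * (INR N * sum_f_R0 (fun k => offspring k * Fsum N (k + r)) N)) by ring.
      rewrite E, Rmult_plus_distr_l, <- Hx. unfold z. rewrite minus_IZR, <- !INR_IZR_INZ, !S_INR. ring.
Qed.

Lemma Msum_ge0 B n r : 0 <= Msum B n r.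
Proof.
  apply sum_list_ge0. intros fo _. apply Rmult_le_pos; [apply fprod_ge0; auto|].
  apply sum_list_ge0. intros; apply occ_ge0.
Qed.

(** Either the marked occurrence is the first tree itself, followed by any forest of [r] trees, or
    it survives the removal of the first root. *)
Lemma Msum_S B n r : ewf B -> (esize B <= S n)%nat ->
  ewprod g B * Fsum (S n - esize B) r + sum_f_R0 (fun k => offspring k * Msum B n (k + r)) n
  <= Msum B (S n) (S r).
Proof.
  intros HB Hle.
  set (first := sum_list (fun fo => fprod g fo * ind (hd_error fo = Some B)) (forests (S n) (S r))).
  assert (E : Msum B (S n) (S r) = first + sum_f_R0 (fun k => offspring k * Msum B n (k + r)) n).
  { unfold Msum at 1, first. rewrite !sum_forests, <- plus_sum. apply sum_eq. intros k _.
    unfold offspring. rewrite <- sum_list_scal_r, <- sum_list_plus. apply sum_list_ext. intros s _.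
    unfold Msum. rewrite <- sum_list_scal, <- sum_list_plus. apply sum_list_ext. intros fo _.
    rewrite fprod_unroot. simpl hd_error.
    change (sum_list (occ B) (ENode k s (firstn k fo) :: skipn k fo)) with
      (occ B (ENode k s (firstn k fo)) + sum_list (occ B) (skipn k fo)).
    rewrite occ_node.
    replace (ind (Some (ENode k s (firstn k fo)) = Some B)) with (ind (ENode k s (firstn k fo) = B)).
    2:{ unfold ind. repeat destruct excluded_middle_informative; auto; exfalso; congruence. }
    assert (Hfo : sum_list (occ B) fo = sum_list (occ B) (firstn k fo) + sum_list (occ B) (skipn k fo)).
    { rewrite <- sum_list_app, firstn_skipn. reflexivity. }
    rewrite Hfo. ring. }
  rewrite E. apply Rplus_le_compat_r. unfold first, Fsum. rewrite <- sum_list_scal.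
  apply Rle_trans with (sum_list (fun fo => fprod g fo * ind (hd_error fo = Some B))
     (map (cons B) (forests (S n - esize B) r))).
  - rewrite sum_list_map. apply sum_list_le. intros fo _. simpl hd_error. rewrite ind_true by auto.
    cbn [fprod fold_right]. unfold fprod. lra.
  - apply sum_list_incl.
    + apply NoDup_map_inj; [apply forests_NoDup|]. intros; congruence.
    + apply forests_NoDup.
    + intros fo Hfo. apply in_map_iff in Hfo as (fo' & <- & H). apply forests_In in H as (Hl & Hw & Hz).
      apply forests_In. split; [simpl; lia|]. split; [auto|]. cbn [fsize fold_right]. unfold fsize in Hz. lia.
    + intros fo _. apply Rmult_le_pos; [apply fprod_ge0; auto|apply ind_range].
Qed.

(** Contracting a marked copy of [B] to a leaf leaves a forest of [r] trees coded by [N] ordinary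
    steps and one marked step [-1]. The cycle lemma keeps the fraction [r / (N + 1)] of the
    sequences, and the marked step has [N + 1] possible places, so only the factor [r] remains. *)
Lemma Msum_lower B : ewf B -> forall N r,
  ewprod g B * (INR r * cz offspring N (Z.of_nat N + 1 - Z.of_nat r)) <= Msum B (esize B + N) r.
Proof.
  intros HB. pose proof (ewprod_ge0 g g_ge0 B) as Hw. pose proof (esize_pos B) as Hm.
  induction N as [|N IH]; intros r.
  - rewrite Nat.add_0_r. destruct r as [|r]; [simpl; rewrite Rmult_0_l, Rmult_0_r; apply Msum_ge0|].
    destruct (esize B) as [|m] eqn:Em; [lia|].
    pose proof (Msum_S B m r HB ltac:(lia)) as H. rewrite Em, Nat.sub_diag in H.
    eapply Rle_trans; [|apply H].
    assert (0 <= sum_f_R0 (fun k => offspring k * Msum B m (k + r)) m).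
    { apply sum_ge0. intros. apply Rmult_le_pos; [apply sum_list_ge0; auto|apply Msum_ge0]. }
    enough (INR (S r) * cz offspring 0 (Z.of_nat 0 + 1 - Z.of_nat (S r)) <= Fsum 0 r) by nra.
    destruct r as [|r].
    + unfold Fsum; simpl. lra.
    + rewrite cz_neg by lia. unfold Fsum; simpl. lra.
  - rewrite Nat.add_succ_r. destruct r as [|r]; [simpl; rewrite Rmult_0_l, Rmult_0_r; apply Msum_ge0|].
    pose proof (Msum_S B (esize B + N) r HB ltac:(lia)) as H.
    replace (S (esize B + N) - esize B)%nat with (S N) in H by lia.
    eapply Rle_trans; [|apply H]. clear H.
    set (D := (esize B + N)%nat) in *. set (z := (Z.of_nat N + 1 - Z.of_nat r)%Z).
    assert (Hz : (z <= Z.of_nat D)%Z) by (unfold z, D; lia).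
    replace (Z.of_nat (S N) + 1 - Z.of_nat (S r))%Z with z by (unfold z; lia).
    apply Rle_trans with (ewprod g B * Fsum (S N) r + ewprod g B *
       sum_f_R0 (fun k => offspring k * (INR (k + r) * cz offspring N (z - Z.of_nat k))) D).
    2:{ apply Rplus_le_compat_l. rewrite <- sum_scal. apply sum_Rle. intros k _.
        specialize (IH (k + r)%nat).
        replace (Z.of_nat N + 1 - Z.of_nat (k + r))%Z with (z - Z.of_nat k)%Z in IH by (unfold z; lia).
        assert (0 <= offspring k) by (apply sum_list_ge0; auto).
        eapply Rle_trans; [|apply Rmult_le_compat_l; [auto|apply IH]]. right; ring. }
    rewrite <- Rmult_plus_distr_l. apply Rmult_le_compat_l; auto. right.
    assert (HN : 0 < INR (S N)) by (apply lt_0_INR; lia).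
    apply Rmult_eq_reg_l with (INR (S N)); [|lra].
    rewrite Rmult_plus_distr_l, Fsum_cz.
    replace (Z.of_nat (S N) - Z.of_nat r)%Z with z by (unfold z; lia).
    rewrite (sum_eq _ (fun k => INR r * (offspring k * cz offspring N (z - Z.of_nat k)) +
        INR k * offspring k * cz offspring N (z - Z.of_nat k))) by (intros; rewrite plus_INR; ring).
    rewrite plus_sum, sum_scal, <- (cz_S offspring D N z) by auto.
    rewrite Rmult_plus_distr_l, <- (cz_exch offspring D N z) by auto.
    replace (IZR z) with (INR N + 1 - INR r) by (unfold z; rewrite minus_IZR, plus_IZR, <- !INR_IZR_INZ; ring).
    rewrite !S_INR. ring.
Qed.
End TreeBasics.

(** * The laws of the fringe subtrees *)

Section Trees1.
Context {Sp : nat -> Type}.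
Variable enum : forall k, list (Sp k).
Hypothesis enum_nodup : forall k, NoDup (enum k).
Hypothesis enum_all : forall k s, In s (enum k).

Definition trees (n : nat) : list (etree Sp) :=
  flat_map (fun fo => match fo with [t] => [t] | _ => [] end) (forests enum n 1).

Lemma forests_1 n fo : In fo (forests enum n 1) -> exists t, fo = [t].
Proof.
  intros H. apply forests_In in H as (Hl & _); auto. destruct fo as [|t [|]]; try discriminate. eauto.
Qed.

Lemma trees_In n t : In t (trees n) <-> ewf t /\ esize t = n.
Proof.
  unfold trees. rewrite in_flat_map. split.
  - intros (fo & Hfo & H). destruct (forests_1 n fo Hfo) as [t' ->]. destruct H as [->|[]].
    apply forests_In in Hfo as (_ & Hw & Hz); auto. inversion Hw. simpl in Hz. split; [auto|lia].
  - intros [Hw Hz]. exists [t]. split; [|left; auto].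
    apply forests_In; auto. split; [auto|]. split; [auto|]. simpl. lia.
Qed.

Lemma trees_NoDup n : NoDup (trees n).
Proof.
  apply NoDup_flat_map.
  - apply forests_NoDup; auto.
  - intros fo H. destruct (forests_1 n fo H) as [t ->]. repeat constructor; simpl; tauto.
  - intros fo fo' t H H' Ht Ht'. destruct (forests_1 n fo H) as [u ->]. destruct (forests_1 n fo' H') as [u' ->].
    destruct Ht as [->|[]], Ht' as [->|[]]. auto.
Qed.

Lemma sum_trees f n : sum_list f (forests enum n 1) = sum_list (fun t => f [t]) (trees n).
Proof.
  unfold trees. rewrite sum_list_flat_map. apply sum_list_ext. intros fo H.
  destruct (forests_1 n fo H) as [t ->]. simpl. ring.
Qed.

Lemma Fsum_trees g n : Fsum enum g n 1 = sum_list (ewprod g) (trees n).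
Proof.
  unfold Fsum. rewrite sum_trees. apply sum_list_ext. intros t _. simpl. ring.
Qed.

Lemma subtree_at_app (t : etree Sp) b a : subtree_at t (b ++ a) =
  match subtree_at t b with Some c => subtree_at c a | None => None end.
Proof.
  revert t. induction b as [|i b IH]; intros [d s ch]; simpl; auto.
  destruct (nth_error ch i); auto.
Qed.

Lemma sum_ind_filter {X} (P : X -> Prop) l :
  sum_list (fun x => ind (P x)) l =
  sum_list (fun _ => 1) (filter (fun x => if excluded_middle_informative (P x) then true else false) l).
Proof.
  induction l as [|x l IH]; simpl; auto. unfold ind at 1.
  destruct excluded_middle_informative; simpl; rewrite IH; ring.
Qed.

(** An occurrence of [B] at [b] yields the vertex [b ++ a], whose [k]-th ancestor is [b]; distinct
    occurrences yield distinct vertices. *)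
Lemma occ_le_fk (A B : etree Sp) a k : is_vertex B a -> length a = k ->
  occ B A <= sum_list (fun v => ind (fk k (A, v) = Some (B, a))) (verts A).
Proof.
  intros Ha Hk. unfold occ. rewrite sum_ind_filter.
  set (l := filter _ _).
  apply Rle_trans with (sum_list (fun v => ind (fk k (A, v) = Some (B, a))) (map (fun b => b ++ a) l)).
  - rewrite sum_list_map. right. apply sum_list_ext. intros b Hb.
    apply filter_In in Hb as [_ Hb]. destruct excluded_middle_informative as [Hs|]; [|discriminate].
    symmetry. apply ind_true. unfold fk. rewrite length_app, Hk.
    destruct (Nat.ltb_spec (length b + k) k); [lia|].
    replace (length b + k - k)%nat with (length b) by lia.
    rewrite firstn_app, skipn_app, Nat.sub_diag, firstn_all, skipn_all. simpl. rewrite app_nil_r, Hs. auto.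
  - apply sum_list_incl.
    + apply NoDup_map_inj; [apply NoDup_filter, verts_NoDup|]. intros b b' _ _. apply app_inv_tail.
    + apply verts_NoDup.
    + intros v Hv. apply in_map_iff in Hv as (b & <- & Hb). apply filter_In in Hb as [_ Hb].
      destruct excluded_middle_informative as [Hs|]; [|discriminate].
      apply verts_In. unfold is_vertex. rewrite subtree_at_app, Hs. apply Ha.
    + intros v _. apply ind_range.
Qed.

(** On the spine, size-biasing and the uniform choice of the distinguished child combine to
    [d pi_d / d = pi_d], so the pointed tree has the plain Galton-Watson weight. A spine vertex has
    a child, so agreement for [d >= 1] is enough. *)
Lemma qprod_valid (gw sp : forall d, Sp d -> R) : (forall d s, (1 <= d)%nat -> sp d s = gw d s) ->
  forall a t, ewf t -> is_vertex t a -> qprod gw sp t a = ewprod gw t.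
Proof.
  intros Hsp. induction a as [|i a IH]; intros [d s ch] Hw Hv; [reflexivity|].
  apply ewf_node in Hw as [Hl Hw]. unfold is_vertex in Hv. simpl in Hv.
  destruct (nth_error ch i) as [c|] eqn:E; [|tauto].
  assert (Hi : (i < length ch)%nat) by (apply nth_error_Some; congruence).
  rewrite ewprod_node. cbn [qprod]. rewrite Hsp by lia. f_equal.
  assert (Hgen : forall l j, Forall ewf l ->
     (forall j' c', nth_error l j' = Some c' -> (j + j')%nat = i -> is_vertex c' a) ->
     (fix go (l : list (etree Sp)) (j : nat) : R :=
             match l with
             | nil => 1
             | c :: l' => (if Nat.eqb j i then qprod gw sp c a else ewprod gw c) * go l' (S j)
             end) l j = fprod gw l).
  { induction l as [|c' l IHl]; intros j Hlw Hj; [reflexivity|].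
    inversion Hlw; subst. cbn [fprod fold_right]. f_equal.
    - destruct (Nat.eqb_spec j i); auto. apply IH; auto. apply (Hj 0%nat); [auto|lia].
    - apply IHl; auto. intros j' c'' Hn Hji. apply (Hj (S j')); [auto|lia]. }
  apply Hgen; auto. intros j' c' Hn Hji. simpl in Hji. subst j'.
  assert (c' = c) by congruence. subst c'. exact Hv.
Qed.

Fixpoint degs (t : etree Sp) : list nat :=
  match t with ENode d _ ch => d :: flat_map degs ch end.

Lemma degs_spec (t : etree Sp) : ewf t -> length (degs t) = esize t /\
  S (fold_right Nat.add 0%nat (degs t)) = esize t.
Proof.
  revert t. apply (etree_nested_ind (fun t => ewf t -> length (degs t) = esize t /\
    S (fold_right Nat.add 0%nat (degs t)) = esize t)).
  intros d s ch IH Hw. apply ewf_node in Hw as [Hl Hw]. rewrite esize_node. simpl.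
  assert (Happ : forall l l', fold_right Nat.add 0%nat (l ++ l') = (fold_right Nat.add 0%nat l + fold_right Nat.add 0%nat l')%nat).
  { induction l; simpl; intros; [auto|rewrite IHl; lia]. }
  assert (H : length (flat_map degs ch) = fsize ch /\
     (length ch + fold_right Nat.add 0%nat (flat_map degs ch))%nat = fsize ch).
  { clear Hl. induction ch as [|c ch IHch]; [auto|]. inversion IH; inversion Hw; subst.
    destruct (H1 H5), (IHch H2 H6). simpl. rewrite length_app, Happ. unfold fsize in *. split; lia. }
  lia.
Qed.

Lemma degs_pos (u : nat -> R) (g : forall d, Sp d -> R) : (forall d, 0 <= u d) ->
  (forall d s, g d s <> 0 -> 0 < u d) ->
  forall t, ewprod g t <> 0 -> forall x, In x (degs t) -> 0 < u x.
Proof.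
  intros Hu Hg. apply (etree_nested_ind (fun t => ewprod g t <> 0 -> forall x, In x (degs t) -> 0 < u x)).
  intros d s ch IH Hn x. rewrite ewprod_node in Hn. simpl.
  assert (Hs : g d s <> 0) by (intros E; rewrite E in Hn; lra).
  assert (Hf : fprod g ch <> 0) by (intros E; rewrite E in Hn; lra).
  intros [<-|Hx]; [apply (Hg _ s); auto|]. clear Hn.
  induction ch as [|c ch IHch]; [destruct Hx|]. simpl in Hf, Hx. inversion IH; subst.
  apply in_app_iff in Hx as [Hx|Hx].
  - apply H1; auto. intros E; rewrite E in Hf; lra.
  - apply IHch; auto. intros E; rewrite E in Hf; lra.
Qed.
End Trees1.

(** * Partition function of plane trees *)

Section Plane.
Variable w : nat -> R.

Lemma ptree_nested_ind (P : ptree -> Prop)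
  (H : forall ch, Forall P ch -> P (PNode ch)) : forall t, P t.
Proof.
  fix IH 1. intros [ch]. apply H. induction ch as [|c ch IHch]; constructor; auto.
Qed.

(** Plane trees are the enriched trees with a single structure per degree, so the enumeration of
    forests also evaluates [Zn]. *)
Fixpoint embed (t : ptree) : etree (fun _ => unit) :=
  match t with PNode ch => ENode (Sp := fun _ => unit) (length ch) tt (map embed ch) end.

Lemma eshape_embed t : eshape (embed t) = t.
Proof.
  revert t. apply ptree_nested_ind. intros ch IH. simpl. f_equal.
  induction IH; simpl; congruence.
Qed.

Lemma ewf_embed t : ewf (embed t).
Proof.
  revert t. apply ptree_nested_ind. intros ch IH. simpl embed. apply ewf_node.
  split; [apply length_map|]. induction IH; simpl; constructor; auto.
Qed.

Lemma embed_eshape (t : etree (fun _ => unit)) : ewf t -> embed (eshape t) = t.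
Proof.
  revert t. apply (etree_nested_ind (fun t => ewf t -> embed (eshape t) = t)).
  intros d [] ch IH Hw. apply ewf_node in Hw as [<- Hw]. simpl. rewrite length_map. f_equal.
  induction ch as [|c ch IHch]; auto. inversion IH; inversion Hw; subst. simpl. f_equal; auto.
Qed.

Lemma psize_eshape {Sp} (t : etree Sp) : psize (eshape t) = esize t.
Proof.
  revert t. apply etree_nested_ind. intros d s ch IH. simpl. f_equal.
  induction IH; simpl; congruence.
Qed.

Lemma pweight_eshape {Sp} (t : etree Sp) : ewf t -> pweight w (eshape t) = ewprod (fun d _ => w d) t.
Proof.
  revert t. apply (etree_nested_ind (fun t => ewf t -> pweight w (eshape t) = ewprod (fun d _ => w d) t)).
  intros d s ch IH Hw. apply ewf_node in Hw as [<- Hw]. simpl. rewrite length_map. f_equal. clear s.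
  induction ch as [|c ch IHch]; auto. inversion IH; inversion Hw; subst. simpl. f_equal; auto.
Qed.

Lemma plane_partition_function n :
  INR n * fsum (fun t => psize t = n) (pweight w) = cz w n (Z.of_nat n - 1).
Proof.
  set (en := fun _ : nat => [tt]).
  assert (Hn : forall k, NoDup (en k)) by (intros; repeat constructor; simpl; tauto).
  assert (Ha : forall k s, In s (en k)) by (intros k []; left; auto).
  rewrite (fsum_enum _ _ (map eshape (trees (Sp := fun _ => unit) en n))).
  - rewrite sum_list_map.
    rewrite (sum_list_ext _ (ewprod (fun d _ => w d))).
    2:{ intros t Ht. apply pweight_eshape. apply trees_In in Ht; [tauto|auto]. }
    rewrite <- Fsum_trees, Fsum_cz by auto. simpl INR. rewrite Rmult_1_l. simpl Z.of_nat.
    apply cz_ext. intros k _. unfold offspring. simpl. ring.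
  - split.
    + apply NoDup_map_inj; [apply trees_NoDup; auto|]. intros t t' Ht Ht' E.
      apply trees_In in Ht, Ht'; auto. rewrite <- (embed_eshape t), <- (embed_eshape t') by tauto. congruence.
    + intros t. rewrite in_map_iff. split.
      * intros (u & <- & Hu). apply trees_In in Hu; auto. rewrite psize_eshape. tauto.
      * intros E. exists (embed t). split; [apply eshape_embed|]. apply trees_In; auto.
        split; [apply ewf_embed|]. rewrite <- psize_eshape, eshape_embed. auto.
Qed.
End Plane.

(** * Explicit forms of the two laws and their comparison *)

Section Laws.
Context {Sp : nat -> Type}.
Variable enum : forall k, list (Sp k).
Variable kappa : forall k, Sp k -> R.
Hypothesis enum_nodup : forall k, NoDup (enum k).
Hypothesis enum_all : forall k s, In s (enum k).
Hypothesis kappa_ge0 : forall k s, 0 <= kappa k s.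

Notation om := (omega enum kappa).
Notation spr := (sprob enum kappa).

Definition gom (d : nat) (s : Sp d) : R := om d * spr d s.

Lemma Rk_ge0 d : 0 <= Rk enum kappa d.
Proof. apply sum_list_ge0; auto. Qed.

Lemma omega_ge0 d : 0 <= om d.
Proof.
  unfold omega. apply Rmult_le_pos; [apply Rk_ge0|]. left. apply Rinv_0_lt_compat, INR_fact_lt_0.
Qed.

Lemma sprob_ge0 d s : 0 <= spr d s.
Proof.
  unfold sprob. destruct (Rle_lt_or_eq _ _ (Rk_ge0 d)) as [H|H].
  - apply Rmult_le_pos; auto. left. apply Rinv_0_lt_compat; auto.
  - rewrite <- H. unfold Rdiv. rewrite Rinv_0. lra.
Qed.

Lemma gom_ge0 d s : 0 <= gom d s.
Proof. apply Rmult_le_pos; [apply omega_ge0|apply sprob_ge0]. Qed.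

(** If [Rk d = 0], the values of [sprob d] are 0 by the convention on division and do not sum to 1;
    [omega d] then vanishes too, so the product form holds for every [d]. *)
Lemma omega_sum_sprob d : om d * sum_list (spr d) (enum d) = om d.
Proof.
  destruct (Req_dec (Rk enum kappa d) 0) as [H|H].
  - unfold omega. rewrite H. unfold Rdiv. ring.
  - unfold sprob, Rdiv. rewrite sum_list_scal_r. fold (Rk enum kappa d). rewrite Rinv_r by auto. ring.
Qed.

Lemma offspring_gom k : offspring enum gom k = om k.
Proof. unfold offspring, gom. rewrite sum_list_scal. apply omega_sum_sprob. Qed.

Lemma cz_offspring n z : cz (offspring enum gom) n z = cz om n z.
Proof. apply cz_ext. intros; apply offspring_gom. Qed.

Lemma ewprod_mult (f h : forall d, Sp d -> R) t :
  ewprod (fun d s => f d s * h d s) t = ewprod f t * ewprod h t.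
Proof.
  revert t. apply etree_nested_ind. intros d s ch IH. rewrite !ewprod_node.
  assert (E : fprod (fun d s => f d s * h d s) ch = fprod f ch * fprod h ch).
  { induction IH; simpl; [ring|]. rewrite H. rewrite IHIH. ring. }
  rewrite E. ring.
Qed.

Lemma lawT_gom n A : ewf A -> lawT enum kappa n A = ewprod gom A / Zn enum kappa n.
Proof.
  intros Hw. unfold lawT, gom. rewrite (ewprod_mult (fun d _ => om d) spr), pweight_eshape by auto.
  unfold Rdiv. ring.
Qed.

Lemma Zn_cz n : INR n * Zn enum kappa n = cz om n (Z.of_nat n - 1).
Proof. apply plane_partition_function. Qed.

Lemma Zn_trees n : (1 <= n)%nat -> sum_list (ewprod gom) (trees enum n) = Zn enum kappa n.
Proof.
  intros Hn. apply Rmult_eq_reg_l with (INR n); [|apply not_0_INR; lia].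
  rewrite Zn_cz, <- Fsum_trees, Fsum_cz, cz_offspring by auto. simpl INR. simpl Z.of_nat. ring.
Qed.

Definition pointed_trees (n : nat) := flat_map (fun A => map (pair A) (verts A)) (trees enum n).

Lemma Pvalid_enum n : enumerates (Pvalid n) (pointed_trees n).
Proof.
  split.
  - apply NoDup_flat_map; [apply trees_NoDup; auto| |].
    + intros A _. apply NoDup_map_inj; [apply verts_NoDup|congruence].
    + intros A A' y _ _ H H'. apply in_map_iff in H as (v & <- & _). apply in_map_iff in H' as (v' & E & _). congruence.
  - intros [A v]. unfold pointed_trees, Pvalid. rewrite in_flat_map. simpl. split.
    + intros (A' & HA & H). apply in_map_iff in H as (v' & E & Hv). injection E as -> ->.
      apply trees_In in HA; auto. apply verts_In in Hv. tauto.
    + intros (Hw & Hz & Hv). exists A. split; [apply trees_In; auto|].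
      apply in_map. apply verts_In; auto.
Qed.

Lemma EH_sum n k h : EH enum kappa n k h =
  sum_list (fun p => lawT enum kappa n (fst p) * / INR n * h (fk k p)) (pointed_trees n).
Proof. apply fsum_enum, Pvalid_enum. Qed.

Lemma lawH_sum n k x : lawH enum kappa n k x =
  sum_list (fun p => lawT enum kappa n (fst p) * / INR n * ind (fk k p = x)) (pointed_trees n).
Proof. apply fsum_enum, Pvalid_enum. Qed.

Section Fixed_n.
Variable n : nat.
Hypothesis n_pos : (1 <= n)%nat.
Hypothesis cz_pos : 0 < cz om n (Z.of_nat n - 1).

Lemma Zn_pos : 0 < Zn enum kappa n.
Proof.
  rewrite <- Zn_cz in cz_pos. assert (0 < INR n) by (apply lt_0_INR; lia). nra.
Qed.

Lemma vertex_weight_ge0 p : In p (pointed_trees n) -> 0 <= lawT enum kappa n (fst p) * / INR n.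
Proof.
  intros H. apply (proj2 (Pvalid_enum n)) in H as (Hw & _). rewrite lawT_gom by auto.
  pose proof Zn_pos. assert (0 < INR n) by (apply lt_0_INR; lia).
  apply Rmult_le_pos; [|left; apply Rinv_0_lt_compat; auto].
  apply Rmult_le_pos; [|left; apply Rinv_0_lt_compat; auto].
  apply ewprod_ge0, gom_ge0.
Qed.

Lemma vertex_weight_total : sum_list (fun p => lawT enum kappa n (fst p) * / INR n) (pointed_trees n) = 1.
Proof.
  pose proof Zn_pos as HZ. assert (Hn : 0 < INR n) by (apply lt_0_INR; lia).
  unfold pointed_trees. rewrite sum_list_flat_map.
  rewrite (sum_list_ext _ (fun A => / Zn enum kappa n * ewprod gom A)).
  - rewrite sum_list_scal, Zn_trees by auto. field. lra.
  - intros A HA. apply trees_In in HA as [Hw Hz]; auto.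
    rewrite sum_list_map. simpl. rewrite sum_list_const, verts_length, Hz, lawT_gom by auto. field. lra.
Qed.

Lemma lawH_ge0 k x : 0 <= lawH enum kappa n k x.
Proof.
  rewrite lawH_sum. apply sum_list_ge0. intros p Hp.
  apply Rmult_le_pos; [apply vertex_weight_ge0; auto|apply ind_range].
Qed.

Lemma lawH_sum_le k l : NoDup l -> sum_list (lawH enum kappa n k) l <= 1.
Proof.
  intros Hl. rewrite (sum_list_ext _ _ l (fun x _ => lawH_sum n k x)).
  rewrite sum_list_swap. rewrite <- vertex_weight_total. apply sum_list_le. intros p Hp.
  rewrite sum_list_scal, sum_ind_eq by auto. pose proof (vertex_weight_ge0 p Hp).
  pose proof (ind_range (In (fk k p) l)). nra.
Qed.

Lemma EH_lawH k h L : NoDup L -> (forall p, In p (pointed_trees n) -> In (fk k p) L) ->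
  EH enum kappa n k h = sum_list (fun x => lawH enum kappa n k x * h x) L.
Proof.
  intros HL Hin. rewrite EH_sum.
  rewrite (sum_list_ext (fun x => lawH enum kappa n k x * h x)
     (fun x => sum_list (fun p => lawT enum kappa n (fst p) * / INR n * ind (fk k p = x) * h x) (pointed_trees n))).
  - rewrite sum_list_swap. apply sum_list_ext. intros p Hp.
    rewrite (sum_list_ext _ (fun x => lawT enum kappa n (fst p) * / INR n * h (fk k p) * ind (fk k p = x))).
    + rewrite sum_list_scal, sum_ind_eq, ind_true by auto. ring.
    + intros x _. unfold ind. destruct excluded_middle_informative as [<-|]; ring.
  - intros x _. rewrite lawH_sum, <- sum_list_scal_r. reflexivity.
Qed.

(** Occurrences of [B] in trees with [n] vertices are counted by [Msum] with [r = 1], and the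
    normalization [n Zn] is the coefficient in the denominator. *)
Lemma lawH_lower k B a : ewf B -> is_vertex B a -> length a = k -> (esize B <= n)%nat ->
  ewprod gom B * cz om (n - esize B) (Z.of_nat (n - esize B)) / cz om n (Z.of_nat n - 1)
  <= lawH enum kappa n k (Some (B, a)).
Proof.
  intros HB Ha Hk Hle. pose proof Zn_pos as HZ. assert (Hn : 0 < INR n) by (apply lt_0_INR; lia).
  rewrite lawH_sum. unfold pointed_trees. rewrite sum_list_flat_map.
  apply Rle_trans with (sum_list (fun A => / (INR n * Zn enum kappa n) * (ewprod gom A * occ B A)) (trees enum n)).
  - rewrite sum_list_scal. rewrite Zn_cz.
    pose proof (Msum_lower enum enum_nodup enum_all gom gom_ge0 B HB (n - esize B) 1) as HM.
    replace (esize B + (n - esize B))%nat with n in HM by lia.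
    unfold Msum in HM. rewrite sum_trees, cz_offspring in HM by auto.
    rewrite (sum_list_ext _ (fun A => ewprod gom A * occ B A)) in HM by (intros; simpl; ring).
    simpl INR in HM. simpl (Z.of_nat 1) in HM.
    replace (Z.of_nat (n - esize B) + 1 - 1)%Z with (Z.of_nat (n - esize B)) in HM by lia.
    rewrite Rmult_1_l in HM. unfold Rdiv. rewrite Rmult_comm.
    apply Rmult_le_compat_l; auto. left. apply Rinv_0_lt_compat; auto.
  - apply sum_list_le. intros A HA. apply trees_In in HA as [Hw Hz]; auto.
    rewrite sum_list_map. simpl fst. rewrite sum_list_scal, lawT_gom by auto.
    pose proof (occ_le_fk A B a k Ha Hk). pose proof (ewprod_ge0 gom gom_ge0 A) as HgA.
    replace (/ (INR n * Zn enum kappa n) * (ewprod gom A * occ B A)) with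
      (ewprod gom A / Zn enum kappa n * / INR n * occ B A) by (field; lra).
    apply Rmult_le_compat_l; auto.
    apply Rmult_le_pos; [|left; apply Rinv_0_lt_compat; auto].
    apply Rmult_le_pos; [auto|left; apply Rinv_0_lt_compat; auto].
Qed.
End Fixed_n.

Variables tau Phi : R.
Hypothesis tau_pos : 0 < tau.
Hypothesis Phi_pos : 0 < Phi.

Notation pr := (pi enum kappa tau Phi).
Definition gpi (d : nat) (s : Sp d) : R := pr d * spr d s.

Lemma pi_ge0 d : 0 <= pr d.
Proof.
  unfold pi. apply Rmult_le_pos; [apply Rmult_le_pos|].
  - apply pow_le; lra.
  - apply omega_ge0.
  - left. apply Rinv_0_lt_compat; auto.
Qed.

Lemma pi_pos d : 0 < om d -> 0 < pr d.
Proof.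
  intros H. unfold pi. apply Rdiv_lt_0_compat; auto. apply Rmult_lt_0_compat; auto. apply pow_lt; auto.
Qed.

Lemma omega_pos d : 0 < pr d -> 0 < om d.
Proof.
  intros H. destruct (Rle_lt_or_eq _ _ (omega_ge0 d)) as [|E]; auto.
  unfold pi, Rdiv in H. rewrite <- E, Rmult_0_r, Rmult_0_l in H. lra.
Qed.

Lemma gpi_ge0 d s : 0 <= gpi d s.
Proof. apply Rmult_le_pos; [apply pi_ge0|apply sprob_ge0]. Qed.

Lemma offspring_gpi k : offspring enum gpi k = pr k.
Proof.
  unfold offspring, gpi. rewrite sum_list_scal. unfold pi, Rdiv.
  replace (tau ^ k * om k * / Phi * sum_list (spr k) (enum k)) with
    (tau ^ k * / Phi * (om k * sum_list (spr k) (enum k))) by ring.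
  rewrite omega_sum_sprob. ring.
Qed.

(** A tree with [m] vertices has [m - 1] edges, so its weights under [pi] and [omega] differ by the
    factor [tau ^ (m - 1) / Phi ^ m]; the extra [tau] on the left avoids the subtraction. *)
Lemma ewprod_gpi t : ewf t -> tau * ewprod gpi t * Phi ^ esize t = tau ^ esize t * ewprod gom t.
Proof.
  revert t. apply (etree_nested_ind (fun t => ewf t -> tau * ewprod gpi t * Phi ^ esize t = tau ^ esize t * ewprod gom t)).
  intros d s ch IH Hw. apply ewf_node in Hw as [Hl Hw].
  assert (E : tau ^ length ch * fprod gpi ch * Phi ^ fsize ch = tau ^ fsize ch * fprod gom ch).
  { clear Hl. induction ch as [|c ch IHch]; [simpl; ring|]. inversion IH; inversion Hw; subst.
    specialize (H1 H5). specialize (IHch H2 H6). simpl. rewrite !pow_add.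
    unfold fsize, fprod in *.
    set (X := fold_right _ 1 ch) in *.
    match goal with |- tau * ?a * (?b * ?c) * (?d * ?e) = ?f * ?g * (?h * ?i) =>
      transitivity ((tau * b * d) * (a * c * e)); [ring|] end.
    rewrite H1, IHch. ring. }
  rewrite esize_node, !ewprod_node. unfold gpi at 1, gom at 1, pi. rewrite Hl in E.
  simpl pow.
  transitivity (tau * (om d * spr d s) * (tau ^ d * fprod gpi ch * Phi ^ fsize ch)); [field; lra|].
  rewrite E. ring.
Qed.

Lemma lawStar_valid k B a : ewf B -> is_vertex B a -> length a = k ->
  lawStar enum kappa tau Phi k (Some (B, a)) = ewprod gpi B.
Proof.
  intros HB Ha Hk. unfold lawStar. rewrite ind_true by auto. rewrite Rmult_1_l.
  apply qprod_valid; auto. intros d s Hd. field. apply not_0_INR. lia.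
Qed.

Lemma lawStar_invalid k B a : ~ (ewf B /\ is_vertex B a /\ length a = k) ->
  lawStar enum kappa tau Phi k (Some (B, a)) = 0.
Proof. intros H. unfold lawStar. rewrite ind_false by auto. ring. Qed.

Lemma lawStar_ge0 k x : 0 <= lawStar enum kappa tau Phi k x.
Proof.
  destruct x as [[B a]|]; [|simpl; lra].
  destruct (excluded_middle_informative (ewf B /\ is_vertex B a /\ length a = k)) as [(H1 & H2 & H3)|H].
  - rewrite lawStar_valid by auto. apply ewprod_ge0, gpi_ge0.
  - rewrite lawStar_invalid by auto. lra.
Qed.

Lemma cz_pi n z : (0 <= z)%Z -> cz pr n z = tau ^ Z.to_nat z / Phi ^ n * cz om n z.
Proof. intros Hz. apply cz_tilt; [lra|auto]. Qed.

(** All powers of [tau] and [Phi] cancel, which leaves a ratio of point probabilities for the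
    critical walk with step law [pi]. *)
Lemma lawH_lower_star n k B a : (1 <= n)%nat -> 0 < cz pr n (Z.of_nat n - 1) ->
  ewf B -> is_vertex B a -> length a = k -> (esize B <= n)%nat ->
  lawStar enum kappa tau Phi k (Some (B, a)) *
    (cz pr (n - esize B) (Z.of_nat (n - esize B)) / cz pr n (Z.of_nat n - 1))
  <= lawH enum kappa n k (Some (B, a)).
Proof.
  intros Hn Hc HB Ha Hk Hle. rewrite lawStar_valid by auto.
  pose proof (ewprod_gpi B HB) as E. rewrite !cz_pi in * by lia.
  replace (Z.to_nat (Z.of_nat n - 1)) with (n - 1)%nat in * by lia. rewrite Nat2Z.id.
  assert (Ht : forall m, 0 < tau ^ m) by (intros; apply pow_lt; auto).
  assert (HP : forall m, 0 < Phi ^ m) by (intros; apply pow_lt; auto).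
  assert (Hco : 0 < cz om n (Z.of_nat n - 1)).
  { apply Rmult_lt_reg_l with (tau ^ (n - 1) / Phi ^ n); [apply Rdiv_lt_0_compat; auto|]. lra. }
  eapply Rle_trans; [|apply lawH_lower; auto]. right.
  set (m := esize B) in *. pose proof (esize_pos B) as Hm. fold m in Hm.
  replace (Phi ^ n) with (Phi ^ m * Phi ^ (n - m)) by (rewrite <- pow_add; f_equal; lia).
  assert (E2 : tau ^ (n - 1) * tau = tau ^ m * tau ^ (n - m)).
  { rewrite <- pow_add, Rmult_comm, tech_pow_Rmult. f_equal. lia. }
  assert (E3 : ewprod gom B = tau * ewprod gpi B * Phi ^ m / tau ^ m).
  { rewrite E. field. specialize (Ht m). lra. }
  rewrite E3.
  assert (E4 : tau ^ (n - m) = tau ^ (n - 1) * tau / tau ^ m).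
  { rewrite E2. field. specialize (Ht m). lra. }
  rewrite E4. pose proof (Ht m). pose proof (Ht (n - 1)%nat). pose proof (HP m). pose proof (HP (n - m)%nat).
  field. repeat split; lra.
Qed.
End Laws.

(** * Mass of the limit law *)

Fixpoint tuples {X} (k : nat) (l : list X) : list (list X) :=
  match k with O => [[]] | S k' => flat_map (fun t => map (cons t) (tuples k' l)) l end.

Lemma tuples_In {X} k (l : list X) x : In x (tuples k l) -> length x = k /\ Forall (fun t => In t l) x.
Proof.
  revert x. induction k as [|k IH]; simpl; intros x H.
  - destruct H as [<-|[]]. auto.
  - apply in_flat_map in H as (t & Ht & H). apply in_map_iff in H as (y & <- & Hy).
    apply IH in Hy as [H1 H2]. simpl. auto.
Qed.

Lemma tuples_NoDup {X} k (l : list X) : NoDup l -> NoDup (tuples k l).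
Proof.
  intros Hl. induction k as [|k IH]; simpl; [repeat constructor; simpl; tauto|].
  apply NoDup_flat_map; auto.
  - intros t _. apply NoDup_map_inj; auto. congruence.
  - intros t t' y _ _ H H'. apply in_map_iff in H as (z & <- & _). apply in_map_iff in H' as (z' & E & _). congruence.
Qed.

Section Mass.
Context {Sp : nat -> Type}.
Variable enum : forall k, list (Sp k).
Hypothesis enum_nodup : forall k, NoDup (enum k).

Lemma sum_tuples_prod (g : forall d, Sp d -> R) k l :
  sum_list (fprod g) (tuples k l) = sum_list (ewprod g) l ^ k.
Proof.
  induction k as [|k IH]; simpl; [ring|].
  rewrite sum_list_flat_map, <- IH, <- sum_list_scal_r. apply sum_list_ext. intros t _.
  rewrite sum_list_map, <- sum_list_scal. reflexivity.
Qed.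

(** The product rule for a [k]-th power: one slot is marked by [phi], the other [k - 1]
    factorize. *)
Lemma sum_tuples_marked (g : forall d, Sp d -> R) (phi : etree Sp -> R) k l :
  sum_list (fun x => fprod g x * sum_list phi x) (tuples k l) =
  INR k * sum_list (ewprod g) l ^ (k - 1) * sum_list (fun t => ewprod g t * phi t) l.
Proof.
  induction k as [|k IH]; [simpl; ring|].
  cbn [tuples]. rewrite sum_list_flat_map.
  rewrite (sum_list_ext _ (fun t => ewprod g t * phi t * sum_list (fprod g) (tuples k l) +
     ewprod g t * sum_list (fun x => fprod g x * sum_list phi x) (tuples k l))).
  - rewrite sum_list_plus, !sum_list_scal_r, IH, sum_tuples_prod, S_INR.
    replace (S k - 1)%nat with k by lia.
    destruct k; [simpl; ring|]. replace (S k - 1)%nat with k by lia. simpl pow. ring.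
  - intros t _. rewrite sum_list_map, <- !sum_list_scal, <- sum_list_plus. apply sum_list_ext.
    intros x _. simpl. unfold fprod. ring.
Qed.

(** Trees with at most [h] generations and outdegrees at most [D]: a finite list on which the
    generating function identities become exact recursions in [h]. *)
Fixpoint bounded_trees (D h : nat) : list (etree Sp) :=
  match h with
  | O => []
  | S h' => flat_map (fun k => flat_map (fun s => map (ENode k s) (tuples k (bounded_trees D h'))) (enum k))
              (seq 0 (S D))
  end.

Lemma bounded_trees_ewf D h t : In t (bounded_trees D h) -> ewf t.
Proof.
  revert t. induction h as [|h IH]; cbn [bounded_trees]; intros t H; [destruct H|].
  apply in_flat_map in H as (k & _ & H). apply in_flat_map in H as (s & _ & H).
  apply in_map_iff in H as (ch & <- & H). apply tuples_In in H as [H1 H2].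
  apply ewf_node. split; auto. eapply Forall_impl; [|apply H2]. auto.
Qed.

Lemma bounded_trees_NoDup D h : NoDup (bounded_trees D h).
Proof.
  induction h as [|h IH]; cbn [bounded_trees]; [constructor|].
  apply NoDup_flat_map; [apply seq_NoDup| |].
  - intros k _. apply NoDup_flat_map; auto.
    + intros s _. apply NoDup_map_inj; [apply tuples_NoDup; auto|]. intros x x' _ _ E. injection E; auto.
    + intros s s' y _ _ H H'. apply in_map_iff in H as (fo & <- & _). apply in_map_iff in H' as (fo' & H' & _).
      injection H' as H' _. apply inj_pair2_eq_dec in H'; auto. apply Nat.eq_dec.
  - intros k k' y _ _ H H'. apply in_flat_map in H as (s & _ & H). apply in_flat_map in H' as (s' & _ & H').
    apply in_map_iff in H as (fo & <- & _). apply in_map_iff in H' as (fo' & H' & _).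
    injection H'. auto.
Qed.

Definition level (k : nat) (t : etree Sp) : list (list nat) :=
  filter (fun a => Nat.eqb (length a) k) (verts t).

Definition level_count (k : nat) (t : etree Sp) : R := sum_list (fun _ => 1) (level k t).

Lemma filter_map_cons k i (l : list (list nat)) :
  filter (fun a => Nat.eqb (length a) (S k)) (map (cons i) l) = map (cons i) (filter (fun a => Nat.eqb (length a) k) l).
Proof. induction l as [|a l IH]; simpl; auto. destruct Nat.eqb; simpl; congruence. Qed.

Lemma level_count_0 t : level_count 0 t = 1.
Proof.
  destruct t as [d s ch].
  assert (H : forall l i, filter (fun a => Nat.eqb (length a) 0) (fverts (Sp := Sp) l i) = []).
  { induction l as [|c l IH]; intros i; simpl; auto.
    rewrite filter_app, IH, app_nil_r. induction (verts c); simpl; auto. }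
  unfold level_count, level. rewrite verts_node.
  change (filter (fun a => length a =? 0) ([] :: fverts ch 0)) with
    ([] :: filter (fun a => Nat.eqb (length a) 0) (fverts ch 0)).
  rewrite H. simpl. ring.
Qed.

Lemma level_count_S k d (s : Sp d) ch : level_count (S k) (ENode d s ch) = sum_list (level_count k) ch.
Proof.
  unfold level_count at 1, level. rewrite verts_node. simpl filter.
  generalize 0%nat. induction ch as [|c ch IH]; intros i; simpl; auto.
  rewrite filter_app, sum_list_app, filter_map_cons, sum_list_map, IH. reflexivity.
Qed.

Section Weighted.
Variable g : forall d, Sp d -> R.
Hypothesis g_ge0 : forall d s, 0 <= g d s.
Variable D : nat.
Notation u := (offspring enum g).

Definition Gmass (h : nat) : R := sum_list (ewprod g) (bounded_trees D h).
Definition Ymass (k h : nat) : R := sum_list (fun t => ewprod g t * level_count k t) (bounded_trees D h).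
Definition fD (x : R) : R := sum_f_R0 (fun k => u k * x ^ k) D.
Definition fD' (x : R) : R := sum_f_R0 (fun k => INR k * u k * x ^ (k - 1)) D.

Lemma offspring_ge0 k : 0 <= u k.
Proof. apply sum_list_ge0; auto. Qed.

Lemma sum_bounded_trees phi h : sum_list phi (bounded_trees D (S h)) =
  sum_f_R0 (fun k => sum_list (fun s => sum_list (fun x => phi (ENode k s x)) (tuples k (bounded_trees D h))) (enum k)) D.
Proof.
  cbn [bounded_trees]. rewrite sum_f_R0_list, sum_list_flat_map. apply sum_list_ext. intros k _.
  rewrite sum_list_flat_map. apply sum_list_ext. intros s _. apply sum_list_map.
Qed.

Lemma Gmass_S h : Gmass (S h) = fD (Gmass h).
Proof.
  unfold Gmass at 1, fD. rewrite sum_bounded_trees. apply sum_eq. intros k _.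
  unfold offspring. rewrite <- sum_list_scal_r. apply sum_list_ext. intros s _.
  unfold Gmass. rewrite <- sum_tuples_prod, <- sum_list_scal. apply sum_list_ext. intros x _. apply ewprod_node.
Qed.

Lemma Ymass_0 h : Ymass 0 h = Gmass h.
Proof. apply sum_list_ext. intros t _. rewrite level_count_0. ring. Qed.

Lemma Ymass_S k h : Ymass (S k) (S h) = fD' (Gmass h) * Ymass k h.
Proof.
  unfold Ymass at 1, fD'. rewrite sum_bounded_trees, Rmult_comm, <- sum_scal. apply sum_eq. intros d _.
  unfold offspring.
  replace (Ymass k h * (INR d * sum_list (g d) (enum d) * Gmass h ^ (d - 1))) with
    (sum_list (g d) (enum d) * (INR d * Gmass h ^ (d - 1) * Ymass k h)) by ring.
  rewrite <- sum_list_scal_r. apply sum_list_ext. intros s _.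
  unfold Gmass, Ymass. rewrite <- sum_tuples_marked, <- sum_list_scal. apply sum_list_ext. intros x _.
  rewrite level_count_S, ewprod_node. ring.
Qed.

Lemma Gmass_ge0 h : 0 <= Gmass h.
Proof. apply sum_list_ge0. intros. apply ewprod_ge0; auto. Qed.

Lemma fD_mono x y : 0 <= x <= y -> fD x <= fD y.
Proof.
  intros H. apply sum_Rle. intros k _. apply Rmult_le_compat_l; [apply offspring_ge0|]. apply pow_incr; lra.
Qed.

Lemma fD'_mono x y : 0 <= x <= y -> fD' x <= fD' y.
Proof.
  intros H. apply sum_Rle. intros k _.
  apply Rmult_le_compat_l; [apply Rmult_le_pos; [apply pos_INR|apply offspring_ge0]|]. apply pow_incr; lra.
Qed.

Lemma fD'_ge0 x : 0 <= x -> 0 <= fD' x.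
Proof.
  intros H. apply sum_ge0. intros k _.
  apply Rmult_le_pos; [apply Rmult_le_pos; [apply pos_INR|apply offspring_ge0]|apply pow_le; auto].
Qed.

Lemma Gmass_mono h : Gmass h <= Gmass (S h).
Proof.
  induction h as [|h IH]; [unfold Gmass at 1; simpl; apply Gmass_ge0|].
  rewrite !Gmass_S. apply fD_mono. rewrite <- Gmass_S. split; [apply Gmass_ge0|auto].
Qed.

Lemma Gmass_mono_le h j : Gmass h <= Gmass (h + j).
Proof.
  induction j as [|j IH]; [rewrite Nat.add_0_r; lra|]. rewrite Nat.add_succ_r.
  pose proof (Gmass_mono (h + j)). lra.
Qed.

Lemma Ymass_lower k h : fD' (Gmass h) ^ k * Gmass h <= Ymass k (h + k).
Proof.
  induction k as [|k IH].
  - rewrite Nat.add_0_r, Ymass_0. simpl. lra.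
  - rewrite Nat.add_succ_r, Ymass_S. simpl pow. rewrite Rmult_assoc.
    pose proof (fD'_ge0 _ (Gmass_ge0 h)). pose proof (Gmass_ge0 h).
    apply Rmult_le_compat; auto.
    + apply Rmult_le_pos; [apply pow_le|]; auto.
    + apply fD'_mono. split; [auto|apply Gmass_mono_le].
Qed.

(** The masses are the iterates of [fD] started at 0, and each iteration gains at least [gam] as
    long as they stay below [1 - v]. *)
Lemma Gmass_reaches v gam : 0 < gam -> (forall x, 0 <= x <= 1 - v -> x + gam <= fD x) ->
  exists h, 1 - v <= Gmass h.
Proof.
  intros Hg Hx. destruct (excluded_middle_informative (exists h, 1 - v <= Gmass h)) as [|Hn]; auto.
  exfalso. assert (Hlt : forall h, Gmass h < 1 - v).
  { intros h. destruct (Rlt_or_le (Gmass h) (1 - v)); auto. exfalso; eauto. }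
  assert (Hgrow : forall h, INR h * gam <= Gmass h).
  { induction h as [|h IH]; [unfold Gmass; simpl; lra|].
    rewrite Gmass_S, S_INR. specialize (Hx (Gmass h)). pose proof (Gmass_ge0 h). specialize (Hlt h). lra. }
  destruct (INR_unbounded ((1 - v) / gam)) as [h Hh].
  specialize (Hgrow h). specialize (Hlt h).
  apply Rmult_gt_compat_r with (r := gam) in Hh; auto.
  unfold Rdiv in Hh. rewrite Rmult_assoc, Rinv_l in Hh by lra. lra.
Qed.

(** Each of the [k] spine vertices costs a factor [1 - b] and the tree below the pointed vertex a
    factor [1 - v]; Bernoulli's inequality makes the total loss linear in [k]. *)
Lemma Ymass_lower_bound k v b gam : 0 < v < 1 -> 0 <= b <= 1 -> 0 < gam -> fD 1 <= 1 ->
  (forall x, 0 <= x <= 1 - v -> x + gam <= fD x) -> 1 - b <= fD' (1 - v) ->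
  exists h, 1 - v - INR k * b <= Ymass k h.
Proof.
  intros Hv Hb Hg H1 Hx Hd. destruct (Gmass_reaches v gam Hg Hx) as [h Hh].
  exists (h + k)%nat. eapply Rle_trans; [|apply Ymass_lower].
  pose proof (fD'_mono (1 - v) (Gmass h) ltac:(lra)) as Hm.
  assert (Hp : 1 - INR k * b <= (1 - b) ^ k).
  { clear - Hb. induction k; [simpl; lra|]. rewrite S_INR, <- tech_pow_Rmult. pose proof (pos_INR k).
    assert (0 <= INR k * b * b) by (repeat apply Rmult_le_pos; lra). nra. }
  assert (Hp2 : (1 - b) ^ k <= fD' (Gmass h) ^ k) by (apply pow_incr; lra).
  assert (0 <= (1 - b) ^ k) by (apply pow_le; lra).
  assert (0 <= INR k * b) by (apply Rmult_le_pos; [apply pos_INR|lra]).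
  apply Rle_trans with ((1 - b) ^ k * (1 - v)); [|apply Rmult_le_compat; lra].
  nra.
Qed.

Lemma level_list k h : exists F : list (etree Sp * list nat), NoDup F /\
  (forall B a, In (B, a) F -> ewf B /\ is_vertex B a /\ length a = k) /\
  sum_list (fun q => ewprod g (fst q)) F = Ymass k h.
Proof.
  exists (flat_map (fun t => map (pair t) (level k t)) (bounded_trees D h)). split; [|split].
  - apply NoDup_flat_map; [apply bounded_trees_NoDup| |].
    + intros t _. apply NoDup_map_inj; [apply NoDup_filter, verts_NoDup|congruence].
    + intros t t' y _ _ H H'. apply in_map_iff in H as (a & <- & _). apply in_map_iff in H' as (a' & E & _). congruence.
  - intros B a H. apply in_flat_map in H as (t & Ht & H). apply in_map_iff in H as (a' & E & Ha). injection E as -> ->.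
    apply filter_In in Ha as [Ha Hl]. apply Nat.eqb_eq in Hl. apply verts_In in Ha.
    split; [eapply bounded_trees_ewf; eauto|auto].
  - rewrite sum_list_flat_map. apply sum_list_ext. intros t _. rewrite sum_list_map. simpl.
    unfold level_count. rewrite <- sum_list_scal. apply sum_list_ext. intros; ring.
Qed.
End Weighted.
End Mass.

(** * Critical generating functions near 1 *)

Lemma pow_one_sub_lower k w : 0 <= w <= 1 -> 1 - INR k * w <= (1 - w) ^ k.
Proof.
  intros Hw. induction k; [simpl; lra|]. rewrite S_INR, <- tech_pow_Rmult. pose proof (pos_INR k).
  assert (0 <= INR k * w * w) by (repeat apply Rmult_le_pos; lra). nra.
Qed.

(** The surplus [w ^ 2] expresses strict convexity; a single [k0 >= 2] in the support thereby lifts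
    the generating function above the diagonal to the left of 1. *)
Lemma pow_one_sub_lower_sq k w : (2 <= k)%nat -> 0 <= w <= 1 -> 1 - INR k * w + w ^ 2 <= (1 - w) ^ k.
Proof.
  intros Hk Hw. induction Hk as [|k Hk IH]; [simpl; nra|].
  rewrite S_INR, <- (tech_pow_Rmult (1 - w) k).
  assert (2 <= INR k) by (apply (le_INR 2); auto).
  apply Rle_trans with ((1 - w) * (1 - INR k * w + w ^ 2)); [|apply Rmult_le_compat_l; lra].
  assert (0 <= w ^ 2) by apply pow2_ge_0.
  assert (w * w ^ 2 <= w ^ 2) by nra. simpl in *. nra.
Qed.

Section Critical.
Variable p : nat -> R.
Hypothesis p_ge0 : forall k, 0 <= p k.
Hypothesis p_mean : infinite_sum (fun k => INR k * p k) 1.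

(** Without a second moment the derivative at [1 - v] is controlled only after a cut at [D0], where
    [(1 - v) ^ (k - 1) >= 1 - v D0]; [v] has to be chosen after [D0]. *)
Lemma truncated_deriv_lower_first D0 D v : (D0 <= D)%nat -> 0 <= v <= 1 ->
  sum_f_R0 (fun k => INR k * p k) D0 - v * INR D0 <= sum_f_R0 (fun k => INR k * p k * (1 - v) ^ (k - 1)) D.
Proof.
  intros HD Hv.
  apply Rle_trans with (sum_f_R0 (fun k => INR k * p k * (1 - v) ^ (k - 1)) D0).
  2:{ apply sum_le_upto; auto. intros k. apply Rmult_le_pos; [apply Rmult_le_pos; [apply pos_INR|auto]|apply pow_le; lra]. }
  apply Rle_trans with (sum_f_R0 (fun k => INR k * p k + (- (v * INR D0)) * (INR k * p k)) D0).
  - rewrite plus_sum, sum_scal.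
    pose proof (partial_le_infinite_sum _ _ D0 (fun k => Rmult_le_pos _ _ (pos_INR k) (p_ge0 k)) p_mean).
    pose proof (pos_INR D0). assert (0 <= v * INR D0) by (apply Rmult_le_pos; lra). nra.
  - apply sum_Rle. intros k Hk. pose proof (pow_one_sub_lower (k - 1) v Hv).
    assert (INR (k - 1) <= INR D0) by (apply le_INR; lia).
    assert (0 <= INR k * p k) by (apply Rmult_le_pos; [apply pos_INR|auto]).
    assert (INR (k - 1) * v <= INR D0 * v) by (apply Rmult_le_compat_r; lra).
    apply Rle_trans with (INR k * p k * (1 - v * INR D0)); [right; ring|].
    apply Rmult_le_compat_l; lra.
Qed.

(** By [k (k - 1) <= (k - 1)^2 + k] the loss is linear in [v], with the constant [V + 1] independent
    of [D]. *)
Lemma truncated_deriv_lower_second V D v : infinite_sum (fun k => (INR k - 1) ^ 2 * p k) V -> 0 <= v <= 1 ->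
  sum_f_R0 (fun k => INR k * p k) D - v * (V + 1) <= sum_f_R0 (fun k => INR k * p k * (1 - v) ^ (k - 1)) D.
Proof.
  intros HV Hv.
  apply Rle_trans with (sum_f_R0 (fun k => INR k * p k + (- v) * ((INR k - 1) ^ 2 * p k + INR k * p k)) D).
  - rewrite plus_sum, sum_scal, plus_sum.
    pose proof (partial_le_infinite_sum _ _ D (fun k => Rmult_le_pos _ _ (pos_INR k) (p_ge0 k)) p_mean).
    pose proof (partial_le_infinite_sum _ _ D (fun k => Rmult_le_pos _ _ (pow2_ge_0 _) (p_ge0 k)) HV).
    nra.
  - apply sum_Rle. intros k Hk. pose proof (p_ge0 k). destruct k as [|k].
    + simpl. nra.
    + pose proof (pow_one_sub_lower k v Hv). replace (S k - 1)%nat with k by lia. rewrite S_INR.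
      pose proof (pos_INR k).
      assert (0 <= (INR k + 1) * p (S k)) by nra.
      apply Rle_trans with ((INR k + 1) * p (S k) * (1 - INR k * v)); [|apply Rmult_le_compat_l; auto].
      assert (0 <= v * p (S k)) by nra. simpl. nra.
Qed.

(** By criticality the tangent at 1 is the diagonal, and [k0] adds [p k0 * v ^ 2]. For a positive
    gap this must beat the truncated mass [eta] and the discount [1 - s], which makes [v] of order
    [sqrt (1 - s)]. *)
Lemma truncated_pgf_lower k0 D eta s v : (2 <= k0)%nat -> (k0 <= D)%nat -> 1 - eta <= sum_f_R0 p D -> 0 < s <= 1 ->
  0 < v < 1 -> forall x, 0 <= x <= 1 - v ->
  x + (s * (p k0 * v ^ 2 - eta) - (1 - s)) <= s * sum_f_R0 (fun k => p k * x ^ k) D.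
Proof.
  intros k0_ge2; pose proof (p_ge0 k0) as pk0; intros HD He Hs Hv x Hx. set (w := 1 - x). assert (Hw : v <= w <= 1) by (unfold w; lra).
  assert (H : 1 - eta - w + p k0 * w ^ 2 <= sum_f_R0 (fun k => p k * x ^ k) D).
  { apply Rle_trans with (sum_f_R0 (fun k => (p k + (- w) * (INR k * p k)) + (if Nat.eq_dec k k0 then p k0 * w ^ 2 else 0)) D).
    - rewrite plus_sum, plus_sum, sum_scal, (sum_single (fun k => if Nat.eq_dec k k0 then p k0 * w ^ 2 else 0) D k0); auto.
      2:{ intros k _ Hk. cbv beta. destruct (Nat.eq_dec k k0); [congruence|reflexivity]. }
      destruct (Nat.eq_dec k0 k0); [|congruence].
      pose proof (partial_le_infinite_sum _ _ D (fun k => Rmult_le_pos _ _ (pos_INR k) (p_ge0 k)) p_mean). nra.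
    - apply sum_Rle. intros k _. replace x with (1 - w) by (unfold w; ring).
      specialize (p_ge0 k). destruct Nat.eq_dec as [->|].
      + pose proof (pow_one_sub_lower_sq k0 w k0_ge2 ltac:(lra)). nra.
      + pose proof (pow_one_sub_lower k w ltac:(lra)). nra. }
  assert (Hw2 : v ^ 2 <= w ^ 2) by (apply pow_incr; lra).
  assert (p k0 * v ^ 2 <= p k0 * w ^ 2) by (apply Rmult_le_compat_l; lra).
  apply Rmult_le_compat_l with (r := s) in H; [|lra].
  eapply Rle_trans; [|apply H]. unfold w in *. nra.
Qed.
End Critical.

(** * Convergence *)

Lemma sum_filter_split {X} (f : X -> R) (b : X -> bool) l :
  sum_list f l = sum_list f (filter b l) + sum_list f (filter (fun x => negb (b x)) l).
Proof. induction l as [|x l IH]; simpl; [ring|]. destruct (b x); simpl; lra. Qed.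

(* [|H - S| = H + S - 2 min(H, S)] and both total masses are at most 1. *)
Lemma total_variation_from_lower_bound {X} (H S : X -> R) eps F :
  (forall x, 0 <= H x) -> (forall x, 0 <= S x) ->
  (forall l, NoDup l -> sum_list H l <= 1) -> (forall l, NoDup l -> sum_list S l <= 1) ->
  0 <= eps <= 1 -> NoDup F -> 1 - eps <= sum_list S F ->
  (forall x, In x F -> (1 - eps) * S x <= H x) ->
  forall l, NoDup l -> sum_list (fun x => Rabs (H x - S x)) l <= 4 * eps.
Proof.
  intros H0 S0 H1 S1 He HF HSF HHF l Hl.
  set (L := F ++ dropl F l).
  assert (HL : NoDup L).
  { apply NoDup_app; auto using dropl_NoDup. intros x Hx Hy. apply dropl_In in Hy. tauto. }
  assert (Hin : incl l L).
  { intros x Hx. apply in_app_iff. destruct (in_dec eq_dec_cl x F); auto. right. apply dropl_In; auto. }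
  apply Rle_trans with (sum_list (fun x => Rabs (H x - S x)) L).
  { apply sum_list_incl; auto. intros; apply Rabs_pos. }
  rewrite (sum_list_ext _ (fun x => H x + S x + (- (2)) * Rmin (H x) (S x))).
  2:{ intros x _. unfold Rmin. destruct Rle_dec; [rewrite Rabs_left1 by lra|rewrite Rabs_pos_eq by lra]; ring. }
  rewrite !sum_list_plus, sum_list_scal.
  specialize (H1 L HL). specialize (S1 L HL).
  assert (Hmin : (1 - eps) * sum_list S F <= sum_list (fun x => Rmin (H x) (S x)) L).
  { apply Rle_trans with (sum_list (fun x => Rmin (H x) (S x)) F).
    - rewrite <- sum_list_scal. apply sum_list_le. intros x Hx. apply Rmin_glb; auto. specialize (S0 x). nra.
    - apply sum_list_incl; auto; [apply incl_appl, incl_refl|]. intros; apply Rmin_glb; auto. }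
  nra.
Qed.

(** The function [h + M] is nonnegative, so its weighted sums have a supremum [s']; as finite lists
    carry mass of [S] arbitrarily close to 1, removing the shift gives the value [s' - M]. *)
Lemma usum_bounded_function {X} (S h : X -> R) M :
  (forall x, 0 <= S x) -> (forall l, NoDup l -> sum_list S l <= 1) ->
  (forall eps, 0 < eps -> exists F, NoDup F /\ 1 - eps <= sum_list S F) ->
  (forall x, Rabs (h x) <= M) -> exists s, usum (fun x => S x * h x) s.
Proof.
  intros S0 S1 SF Hh.
  set (h' := fun x => S x * (h x + M)).
  assert (Hh' : forall x, 0 <= h' x).
  { intros x. specialize (Hh x). apply Rabs_le_between in Hh. apply Rmult_le_pos; auto. lra. }
  assert (HM : forall l, NoDup l -> sum_list h' l <= Rmax 0 (2 * M)).
  { intros l Hl. apply Rle_trans with (sum_list (fun x => S x * Rmax 0 (2 * M)) l).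
    - apply sum_list_le. intros x _. apply Rmult_le_compat_l; auto.
      specialize (Hh x). apply Rabs_le_between in Hh. pose proof (Rmax_r 0 (2 * M)). lra.
    - rewrite sum_list_scal_r. specialize (S1 l Hl). pose proof (Rmax_l 0 (2 * M)). nra. }
  destruct (completeness (fun r => exists l, NoDup l /\ r = sum_list h' l)) as [s' [Hub Hlub]].
  - exists (Rmax 0 (2 * M)). intros r (l & Hl & ->). auto.
  - exists 0, []. split; [constructor|reflexivity].
  - exists (s' - M). intros eps He.
    set (del := eps / (2 * (Rabs M + 1))).
    pose proof (Rabs_pos M) as HM0.
    assert (Hdel : 0 < del) by (apply Rdiv_lt_0_compat; lra).
    destruct (SF del Hdel) as (F & HF & HFm).
    assert (Hl1 : exists l1, NoDup l1 /\ s' - del < sum_list h' l1).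
    { destruct (excluded_middle_informative (exists l1, NoDup l1 /\ s' - del < sum_list h' l1)) as [|Hn]; auto.
      exfalso. assert (s' <= s' - del); [|lra]. apply Hlub. intros r (l & Hl & ->).
      destruct (Rle_or_lt (sum_list h' l) (s' - del)); auto. exfalso. eauto. }
    destruct Hl1 as (l1 & Hl1 & Hs1).
    exists (F ++ l1). intros l Hl Hi.
    assert (B1 : sum_list h' l1 <= sum_list h' l).
    { apply sum_list_incl; auto. intros x Hx. apply Hi, in_app_iff; auto. }
    assert (B2 : sum_list h' l <= s') by (apply Hub; eauto).
    assert (B3 : sum_list S F <= sum_list S l).
    { apply sum_list_incl; auto. intros x Hx. apply Hi, in_app_iff; auto. }
    specialize (S1 l Hl).
    rewrite (sum_list_ext _ (fun x => h' x - S x * M)) by (intros; unfold h'; ring).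
    rewrite sum_list_minus, sum_list_scal_r.
    set (a := sum_list h' l) in *. set (b := sum_list S l) in *.
    replace (a - b * M - (s' - M)) with ((a - s') + (1 - b) * M) by ring.
    eapply Rle_lt_trans; [apply Rabs_triang|]. rewrite Rabs_mult, (Rabs_left1 (a - s')), (Rabs_pos_eq (1 - b)) by lra.
    assert ((1 - b) * Rabs M <= del * Rabs M) by (apply Rmult_le_compat_r; lra).
    assert (del * (Rabs M + 1) = eps / 2) by (unfold del; field; lra). lra.
Qed.

(** * Mass of the limit law and the two convergence statements *)

Section Main.
Context {Sp : nat -> Type}.
Variable enum : forall k, list (Sp k).
Variable kappa : forall k, Sp k -> R.
Hypothesis enum_nodup : forall k, NoDup (enum k).
Hypothesis enum_all : forall k s, In s (enum k).
Hypothesis kappa_ge0 : forall k s, 0 <= kappa k s.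
Variables tau Phi : R.
Hypothesis tau_pos : 0 < tau.
Hypothesis Phi_pos : 0 < Phi.
Notation om := (omega enum kappa).
Notation p := (pi enum kappa tau Phi).
Notation gp := (gpi enum kappa tau Phi).
Notation star := (lawStar enum kappa tau Phi).
Notation lawn := (lawH enum kappa).
Hypothesis p_sum : infinite_sum p 1.
Hypothesis p_mean : infinite_sum (fun k => INR k * p k) 1.
Variables (k0 d : nat) (bz : list (nat * Z)).
Hypothesis k0_ge2 : (2 <= k0)%nat.
Hypothesis pk0 : 0 < p k0.
Hypothesis p0_pos : 0 < p 0%nat.
Hypothesis d_pos : (1 <= d)%nat.
Hypothesis p_div : forall k, 0 < p k -> Nat.divide d k.
Hypothesis bz_pos : forall q, In q bz -> 0 < p (fst q).
Hypothesis bz_sum : bezout_sum bz = Z.of_nat d.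

Lemma pi_law_ge0 k : 0 <= p k.
Proof. apply pi_ge0; auto. Qed.

Definition pointed_at_level (k : nat) (F : list (etree Sp * list nat)) : Prop :=
  NoDup F /\ forall B a, In (B, a) F -> ewf B /\ is_vertex B a /\ length a = k.

Lemma ewprod_scaled s t : ewprod (fun d x => s * gp d x) t = s ^ esize t * ewprod gp t.
Proof.
  rewrite (ewprod_mult (fun _ _ => s) gp). f_equal.
  revert t. apply etree_nested_ind. intros e x ch IH. rewrite ewprod_node, esize_node. simpl pow. f_equal.
  induction IH as [|c ch Hc IH IHf]; [reflexivity|]. cbn [fprod fsize fold_right].
  rewrite pow_add, Hc. unfold fprod, fsize in IHf. rewrite IHf. reflexivity.
Qed.

(** Multiplying every vertex weight by [s] produces the discount [s ^ esize]; the strict inequality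
    supplies the increment [gam] of the iteration. *)
Lemma mass_at_level k D s v b : (k0 <= D)%nat -> 0 < s <= 1 -> 0 < v < 1 -> 0 <= b <= 1 ->
  1 - s < s * (p k0 * v ^ 2 - (1 - sum_f_R0 p D)) ->
  1 - b <= s * sum_f_R0 (fun k => INR k * p k * (1 - v) ^ (k - 1)) D ->
  exists F, pointed_at_level k F /\
    1 - v - INR k * b <= sum_list (fun q => s ^ esize (fst q) * ewprod gp (fst q)) F.
Proof.
  intros HD Hs Hv Hb Hgap Hder.
  set (g := fun e (x : Sp e) => s * gp e x).
  assert (Hg0 : forall e x, 0 <= g e x).
  { intros e x. apply Rmult_le_pos; [lra|]. apply gpi_ge0; auto. }
  assert (Hoff : forall k, offspring enum g k = s * p k).
  { intros j. unfold offspring, g. rewrite sum_list_scal. f_equal. apply offspring_gpi; auto. }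
  assert (HfD : forall x, fD enum g D x = s * sum_f_R0 (fun k => p k * x ^ k) D).
  { intros x. unfold fD. rewrite <- sum_scal. apply sum_eq. intros; rewrite Hoff; ring. }
  assert (HfD' : forall x, fD' enum g D x = s * sum_f_R0 (fun k => INR k * p k * x ^ (k - 1)) D).
  { intros x. unfold fD'. rewrite <- sum_scal. apply sum_eq. intros; rewrite Hoff; ring. }
  pose proof (partial_le_infinite_sum _ _ D pi_law_ge0 p_sum) as Hpd.
  destruct (Ymass_lower_bound enum g Hg0 D k v b (s * (p k0 * v ^ 2 - (1 - sum_f_R0 p D)) - (1 - s)))
    as [h Hh]; auto; try lra.
  - rewrite HfD. rewrite (sum_eq _ p) by (intros; rewrite pow1; ring). nra.
  - intros x Hx. rewrite HfD. apply truncated_pgf_lower; auto using pi_law_ge0. lra.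
  - rewrite HfD'. lra.
  - destruct (level_list enum enum_nodup g D k h) as (F & HF1 & HF2 & HF3).
    exists F. split; [split; auto|]. rewrite <- HF3 in Hh.
    eapply Rle_trans; [apply Hh|]. right. apply sum_list_ext. intros q _. apply ewprod_scaled.
Qed.

(** At a fixed level [s = 1]. The constants are chosen in the order [b] (from [k]), [D0] (for the
    mean), [v] (small against [1 / D0]), [D] (so that the mass beyond it is below
    [p k0 * v ^ 2]). *)
Lemma mass_fixed_level k eps : 0 < eps -> exists F, pointed_at_level k F /\
  1 - eps <= sum_list (fun q => ewprod gp (fst q)) F.
Proof.
  intros He. set (b := Rmin (1 / 2) (eps / (INR k + 1))).
  pose proof (pos_INR k) as Hk.
  assert (Hb : 0 < b <= 1 / 2).
  { split; [apply Rmin_glb_lt; [lra|apply Rdiv_lt_0_compat; lra]|apply Rmin_l]. }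
  assert (Hbe : b * (INR k + 1) <= eps).
  { apply Rle_trans with (eps / (INR k + 1) * (INR k + 1)).
    - apply Rmult_le_compat_r; [lra|]. apply Rmin_r.
    - right. field. lra. }
  destruct (infinite_sum_tail _ 1 (b / 2) (fun k => Rmult_le_pos _ _ (pos_INR k) (pi_law_ge0 k)) p_mean) as [D0 HD0]; [lra|].
  specialize (HD0 D0 (le_n _)). pose proof (pos_INR D0) as HDp.
  set (v := b / (2 * (INR D0 + 1))).
  assert (Hv : 0 < v <= b).
  { unfold v. split; [apply Rdiv_lt_0_compat; lra|].
    apply Rmult_le_reg_r with (2 * (INR D0 + 1)); [lra|]. unfold Rdiv. rewrite Rmult_assoc, Rinv_l by lra. nra. }
  assert (HvD : v * INR D0 <= b / 2).
  { unfold v. apply Rmult_le_reg_r with (2 * (INR D0 + 1)); [lra|].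
    replace (b / (2 * (INR D0 + 1)) * INR D0 * (2 * (INR D0 + 1))) with (b * INR D0) by (field; lra). nra. }
  assert (Hc : 0 < p k0 * v ^ 2) by (apply Rmult_lt_0_compat; [auto|apply pow_lt; lra]).
  destruct (infinite_sum_tail p 1 (p k0 * v ^ 2) pi_law_ge0 p_sum) as [N HN]; [auto|].
  set (D := max D0 (max k0 N)). specialize (HN D ltac:(lia)).
  destruct (mass_at_level k D 1 v b) as (F & HF & HFm); try lra.
  - unfold D; lia.
  - pose proof (truncated_deriv_lower_first p pi_law_ge0 p_mean D0 D v ltac:(unfold D; lia) ltac:(lra)). lra.
  - exists F. split; auto.
    rewrite (sum_list_ext _ (fun q => ewprod gp (fst q))) in HFm by (intros; rewrite pow1; ring). nra.
Qed.

(** The loss per level collects the discount [1 - s], the curvature [v (V + 1)] and a truncation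
    error [e1 <= v]; the other bound on [e1] preserves the strict gap after truncation. *)
Lemma mass_level_finite_variance V : infinite_sum (fun k => (INR k - 1) ^ 2 * p k) V ->
  forall k s v, 0 < s <= 1 -> 0 < v < 1 -> 1 - s < s * (p k0 * v ^ 2) -> 1 - s + v * (V + 2) <= 1 ->
  exists F, pointed_at_level k F /\
    1 - v - INR k * (1 - s + v * (V + 2)) <= sum_list (fun q => s ^ esize (fst q) * ewprod gp (fst q)) F.
Proof.
  intros HV k s v Hs Hv Hgap Hb.
  assert (HV0 : 0 <= V).
  { pose proof (partial_le_infinite_sum _ _ 0 (fun k => Rmult_le_pos _ _ (pow2_ge_0 _) (pi_law_ge0 k)) HV) as H.
    simpl in H. nra. }
  set (e1 := Rmin v (p k0 * v ^ 2 - (1 - s) / s)).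
  assert (He1 : 0 < e1).
  { apply Rmin_glb_lt; [lra|]. apply Rmult_lt_reg_l with s; [lra|].
    rewrite Rmult_0_r, Rmult_minus_distr_l. unfold Rdiv. replace (s * ((1 - s) * / s)) with (1 - s) by (field; lra). lra. }
  destruct (infinite_sum_tail p 1 e1 pi_law_ge0 p_sum) as [N1 HN1]; [auto|].
  destruct (infinite_sum_tail _ 1 e1 (fun k => Rmult_le_pos _ _ (pos_INR k) (pi_law_ge0 k)) p_mean) as [N2 HN2]; [auto|].
  set (D := max k0 (max N1 N2)). specialize (HN1 D ltac:(lia)). specialize (HN2 D ltac:(lia)).
  pose proof (Rmin_l v (p k0 * v ^ 2 - (1 - s) / s)) as Hl. pose proof (Rmin_r v (p k0 * v ^ 2 - (1 - s) / s)) as Hr.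
  fold e1 in Hl, Hr.
  apply mass_at_level with (D := D); auto.
  - unfold D; lia.
  - split; [|auto]. nra.
  - apply Rle_lt_trans with (s * ((1 - s) / s)); [right; field; lra|].
    apply Rmult_lt_compat_l; lra.
  - pose proof (truncated_deriv_lower_second p pi_law_ge0 p_mean V D v HV ltac:(lra)) as H.
    apply Rmult_le_compat_l with (r := s) in H; [|lra]. eapply Rle_trans; [|apply H].
    assert (0 <= v * (V + 1)) by nra. nra.
Qed.

Lemma residue_divides n : (1 <= n)%nat -> (n mod d = 1 mod d)%nat -> Z.divide (Z.of_nat d) (Z.of_nat n - 1).
Proof.
  intros Hn H. exists (Z.of_nat (n / d) - Z.of_nat (1 / d))%Z.
  pose proof (Nat.div_mod_eq n d). pose proof (Nat.div_mod_eq 1 d). nia.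
Qed.

Definition eventually_admissible (P : nat -> Prop) : Prop :=
  exists N, forall n, (N <= n)%nat -> (n mod d = 1 mod d)%nat -> P n.

Lemma ev_and P Q : eventually_admissible P -> eventually_admissible Q -> eventually_admissible (fun n => P n /\ Q n).
Proof.
  intros [N HN] [N' HN']. exists (max N N'). intros n Hn Hr. split; [apply HN|apply HN']; auto; lia.
Qed.

Lemma ev_impl (P Q : nat -> Prop) : (forall n, P n -> Q n) -> eventually_admissible P -> eventually_admissible Q.
Proof. intros H [N HN]. exists N. auto. Qed.

Lemma ev_list {X} (P : X -> nat -> Prop) l : (forall x, In x l -> eventually_admissible (P x)) ->
  eventually_admissible (fun n => forall x, In x l -> P x n).
Proof.
  induction l as [|x l IH]; intros H; [exists 0%nat; simpl; tauto|].
  destruct (ev_and _ _ (H x (or_introl eq_refl)) (IH (fun y Hy => H y (or_intror Hy)))) as [N HN].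
  exists N. intros n Hn Hr. destruct (HN n Hn Hr). intros y [<-|Hy]; auto.
Qed.

Lemma ev_exists P : eventually_admissible P -> exists n, P n.
Proof.
  intros [N HN]. exists (1 + N * d)%nat. apply HN; [nia|]. apply Nat.Div0.mod_add.
Qed.

(** The subexponential bound, taken with [eps = 1], shows that the conditioned tree exists for all
    large admissible [n]. *)
Lemma ev_cz_pos : eventually_admissible (fun n => (1 <= n)%nat /\ 0 < cz p n (Z.of_nat n - 1)).
Proof.
  destruct (subexponential_lower_bound p d bz pi_law_ge0 d_pos p_div bz_pos bz_sum p0_pos p_sum p_mean k0 k0_ge2 pk0 1)
    as [N HN]; [lra|].
  exists (max 1 N). intros n Hn Hr. split; [lia|].
  eapply Rlt_le_trans; [|apply HN; [lia|apply residue_divides; [lia|auto]]]. apply exp_pos.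
Qed.

Lemma cz_omega_pos n : (1 <= n)%nat -> 0 < cz p n (Z.of_nat n - 1) -> 0 < cz om n (Z.of_nat n - 1).
Proof.
  intros Hn H. rewrite cz_pi in H by (auto; lia).
  apply Rmult_lt_reg_l with (tau ^ Z.to_nat (Z.of_nat n - 1) / Phi ^ n); [|lra].
  apply Rdiv_lt_0_compat; apply pow_lt; auto.
Qed.

Lemma degs_pi_pos B : ewprod gp B <> 0 -> forall x, In x (degs B) -> 0 < p x.
Proof.
  apply degs_pos; [apply pi_law_ge0|]. intros e s H.
  destruct (Rle_lt_or_eq _ _ (pi_law_ge0 e)) as [|E]; auto. exfalso. apply H. unfold gpi. rewrite <- E. ring.
Qed.

(** Where the limit weight vanishes only nonnegativity is at stake. Otherwise all outdegrees of [B]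
    lie in the support, and its degree sequence, with [m] entries of sum [m - 1], is the pattern to
    be removed. *)
Lemma ev_lower_bound k eta : 0 < eta <= 1 / 2 -> forall x,
  eventually_admissible (fun n => (1 - eta) * star k x <= lawn n k x).
Proof.
  intros He x.
  assert (Htriv : star k x = 0 -> eventually_admissible (fun n => (1 - eta) * star k x <= lawn n k x)).
  { intros E. eapply ev_impl; [|apply ev_cz_pos]. intros n [Hn Hc]. rewrite E, Rmult_0_r.
    apply lawH_ge0; auto. apply cz_omega_pos; auto. }
  destruct x as [[B a]|]; [|apply Htriv; reflexivity].
  destruct (excluded_middle_informative (ewf B /\ is_vertex B a /\ length a = k)) as [(HB & Ha & Hk)|Hn].
  2:{ apply Htriv, lawStar_invalid; auto. }
  destruct (Req_dec (ewprod gp B) 0) as [E|E].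
  { apply Htriv. rewrite lawStar_valid; auto. }
  destruct (pattern_ratio p d bz pi_law_ge0 d_pos p_div bz_pos bz_sum p0_pos p_sum p_mean k0 k0_ge2 pk0 (degs B)
    (degs_pi_pos B E) eta He) as [N HN].
  destruct (degs_spec B HB) as [Hd1 Hd2].
  apply (ev_impl (fun n => ((1 <= n)%nat /\ 0 < cz p n (Z.of_nat n - 1)) /\ ((max N (esize B) <= n)%nat /\ (n mod d = 1 mod d)%nat))).
  - intros n [[Hn Hc] [HnN Hr]].
    specialize (HN n ltac:(lia) (residue_divides n Hn Hr)). rewrite Hd1 in HN. unfold nat_sum in HN.
    replace (Z.of_nat n - 1 - Z.of_nat (fold_right Nat.add 0%nat (degs B)))%Z with (Z.of_nat (n - esize B)) in HN by lia.
    eapply Rle_trans; [|apply (lawH_lower_star enum kappa enum_nodup enum_all kappa_ge0 tau Phi tau_pos Phi_pos); auto; lia].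
    rewrite Rmult_comm. apply Rmult_le_compat_l; [apply lawStar_ge0; auto|].
    apply Rmult_le_reg_r with (cz p n (Z.of_nat n - 1)); auto. unfold Rdiv. rewrite Rmult_assoc, Rinv_l by lra. lra.
  - apply ev_and; [apply ev_cz_pos|]. exists (max N (esize B)). auto.
Qed.

(** On a finite list one large admissible [n] makes the law of the conditioned tree dominate
    [1 - eta] times the limit weight at every entry; the former sums to at most 1, and [eta] is
    arbitrary. *)
Lemma lawStar_sum_le k l : NoDup l -> sum_list (star k) l <= 1.
Proof.
  intros Hl.
  assert (H : forall eta, 0 < eta <= 1 / 2 -> (1 - eta) * sum_list (star k) l <= 1).
  { intros eta He.
    destruct (ev_exists _ (ev_and _ _ ev_cz_pos (ev_list _ l (fun x _ => ev_lower_bound k eta He x)))) as [n [[Hn Hc] Hx]].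
    rewrite <- sum_list_scal. eapply Rle_trans; [|apply (lawH_sum_le enum kappa enum_nodup enum_all kappa_ge0 n Hn (cz_omega_pos n Hn Hc) k l Hl)].
    apply sum_list_le; auto. }
  set (T := sum_list (star k) l) in *.
  destruct (Rle_or_lt T 1) as [|HT]; auto. exfalso.
  set (eta := Rmin (1 / 2) ((T - 1) / (2 * T))).
  assert (Heta : 0 < eta <= 1 / 2).
  { split; [apply Rmin_glb_lt; [lra|apply Rdiv_lt_0_compat; lra]|apply Rmin_l]. }
  specialize (H eta Heta).
  assert (eta * T <= (T - 1) / 2).
  { apply Rle_trans with ((T - 1) / (2 * T) * T); [apply Rmult_le_compat_r; [lra|apply Rmin_r]|right; field; lra]. }
  lra.
Qed.

Lemma pointed_list_star k F : pointed_at_level k F ->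
  NoDup (map Some F) /\ sum_list (star k) (map Some F) = sum_list (fun q => ewprod gp (fst q)) F.
Proof.
  intros [HF HV]. split; [apply NoDup_map_inj; auto; congruence|].
  rewrite sum_list_map. apply sum_list_ext. intros [B a] Hx. destruct (HV B a Hx) as (H1 & H2 & H3).
  apply lawStar_valid; auto.
Qed.

Lemma star_mass_fixed_level k eps : 0 < eps ->
  exists F, NoDup F /\ 1 - eps <= sum_list (star k) F.
Proof.
  intros He. destruct (mass_fixed_level k eps He) as (F & HF & Hm).
  destruct (pointed_list_star k F HF) as [H1 H2]. exists (map Some F). split; auto.
  rewrite H2. auto.
Qed.

Lemma total_variation_fixed_level k eps : 0 < eps ->
  eventually_admissible (fun n => forall l, NoDup l -> sum_list (fun x => Rabs (lawn n k x - star k x)) l <= eps).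
Proof.
  intros He. set (e := Rmin (1 / 2) (eps / 4)).
  assert (He' : 0 < e <= 1 / 2) by (split; [apply Rmin_glb_lt; lra|apply Rmin_l]).
  assert (He4 : 4 * e <= eps) by (pose proof (Rmin_r (1 / 2) (eps / 4)); unfold e; lra).
  destruct (star_mass_fixed_level k e ltac:(lra)) as (F & HF & Hm).
  eapply ev_impl; [|apply (ev_and _ _ ev_cz_pos (ev_list _ F (fun x _ => ev_lower_bound k e He' x)))].
  intros n [[Hn Hc] HFx] l Hl. pose proof (cz_omega_pos n Hn Hc).
  eapply Rle_trans; [|apply He4].
  apply (total_variation_from_lower_bound (lawn n k) (star k) e F); auto; try lra.
  - intros; apply lawH_ge0; auto.
  - intros; apply lawStar_ge0; auto.
  - intros; apply lawH_sum_le; auto.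
  - intros; apply lawStar_sum_le; auto.
Qed.

Lemma convergence_fixed_level k (h : @pointed Sp -> R) M : (forall x, Rabs (h x) <= M) ->
  exists s, usum (fun x => star k x * h x) s /\
    forall eps, 0 < eps -> eventually_admissible (fun n => Rabs (EH enum kappa n k h - s) < eps).
Proof.
  intros Hh.
  destruct (usum_bounded_function (star k) h M) as [s Hs]; auto.
  { intros; apply lawStar_ge0; auto. }
  { intros; apply lawStar_sum_le; auto. }
  { intros; apply star_mass_fixed_level; auto. }
  exists s. split; auto. intros eps He.
  assert (HM : 0 <= M) by (eapply Rle_trans; [apply Rabs_pos|apply (Hh None)]).
  set (del := eps / (2 * (M + 1))).
  assert (Hdel : 0 < del) by (apply Rdiv_lt_0_compat; lra).
  destruct (Hs (eps / 2)) as [l0 Hl0]; [lra|].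
  eapply ev_impl; [|apply (ev_and _ _ ev_cz_pos (total_variation_fixed_level k del Hdel))].
  intros n [[Hn Hc] Htv]. pose proof (cz_omega_pos n Hn Hc).
  (* [L] contains every value of the fringe subtree, so the expectation is a sum over [L]; it also
     contains [l0], so the limit sum over [L] is within [eps / 2] of [s]. *)
  set (L := nodup eq_dec_cl (map (fk k) (pointed_trees enum n) ++ l0)).
  assert (HL : NoDup L) by apply NoDup_nodup.
  rewrite (EH_lawH enum kappa enum_nodup enum_all n k h L HL).
  2:{ intros q Hq. apply nodup_In, in_app_iff. left. apply in_map; auto. }
  assert (Hi : incl l0 L) by (intros x Hx; apply nodup_In, in_app_iff; auto).
  specialize (Hl0 L HL Hi). specialize (Htv L HL).
  replace (sum_list (fun x => lawn n k x * h x) L - s) with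
    (sum_list (fun x => (lawn n k x - star k x) * h x) L + (sum_list (fun x => star k x * h x) L - s)).
  2:{ rewrite (sum_list_ext (fun x => (lawn n k x - star k x) * h x) (fun x => lawn n k x * h x - star k x * h x)) by (intros; ring).
      rewrite sum_list_minus. ring. }
  eapply Rle_lt_trans; [apply Rabs_triang|].
  assert (Rabs (sum_list (fun x => (lawn n k x - star k x) * h x) L) <= del * M).
  { eapply Rle_trans; [apply sum_list_abs|].
    apply Rle_trans with (sum_list (fun x => Rabs (lawn n k x - star k x) * M) L).
    - apply sum_list_le. intros x _. rewrite Rabs_mult. apply Rmult_le_compat_l; [apply Rabs_pos|auto].
    - rewrite sum_list_scal_r. apply Rmult_le_compat_r; auto. }
  assert (del * (M + 1) = eps / 2) by (unfold del; field; lra). lra.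
Qed.

Lemma esize_residue B : ewf B -> ewprod gp B <> 0 -> Z.divide (Z.of_nat d) (Z.of_nat (esize B) - 1).
Proof.
  intros HB HE. destruct (degs_spec B HB) as [_ <-]. rewrite Nat2Z.inj_succ.
  replace (Z.succ _ - 1)%Z with (Z.of_nat (fold_right Nat.add 0%nat (degs B))) by lia.
  apply nat_divide_Z. pose proof (degs_pi_pos B HE) as Hp.
  induction (degs B) as [|x l IH]; simpl; [exists 0%nat; auto|].
  apply Nat.divide_add_r; [apply p_div, Hp; left; auto|]. apply IH. intros; apply Hp; right; auto.
Qed.

(* The law of the size of the pointed tree at level [k = o(sqrt n)] is discounted by
   [(1 - K / n) ^ size], which bounds the mass of the trees with more than [n / 2] vertices. *)
Lemma star_mass_small_trees V (kn : nat -> nat) e :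
  infinite_sum (fun k => (INR k - 1) ^ 2 * p k) V -> o_sqrt kn -> 0 < e <= 1 ->
  exists N, forall n, (N <= n)%nat -> exists F, pointed_at_level (kn n) F /\
    (forall B a, In (B, a) F -> (2 * esize B <= n)%nat) /\
    1 - e <= sum_list (fun q => ewprod gp (fst q)) F.
Proof.
  intros HV Hkn He.
  assert (HV0 : 0 <= V).
  { pose proof (partial_le_infinite_sum _ _ 0 (fun k => Rmult_le_pos _ _ (pow2_ge_0 _) (pi_law_ge0 k)) HV) as H.
    simpl in H. nra. }
  (* The discount of a tree with more than [n / 2] vertices is at most
     [exp (- K / 2) <= 2 / K = e / 2]. *)
  set (K := 4 / e). assert (HK : 4 <= K).
  { unfold K. apply Rmult_le_reg_r with e; [lra|]. unfold Rdiv. rewrite Rmult_assoc, Rinv_l by lra. lra. }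
  (* For [v = C1 / sqrt n] this gives [p k0 * v ^ 2 = 4 K / n], while [1 - s = K / n] and
     [s >= 1 / 2], so the gap is positive. *)
  set (C1 := sqrt (4 * K / p k0)).
  assert (HC1 : 0 < C1) by (apply sqrt_lt_R0, Rdiv_lt_0_compat; lra).
  assert (HC1sq : C1 * C1 = 4 * K / p k0) by (apply sqrt_sqrt; left; apply Rdiv_lt_0_compat; lra).
  (* The loss per level is at most [Q / sqrt n]; for [k <= e sqrt n / (4 Q)] all levels together
     lose at most [e / 4]. *)
  set (Q := K + C1 * (V + 2) + 1).
  assert (HQ : 1 <= Q) by (unfold Q; assert (0 <= C1 * (V + 2)) by nra; lra).
  destruct (Hkn (e / (4 * Q))) as [N1 HN1]; [apply Rdiv_lt_0_compat; lra|].
  set (R0 := 4 * C1 / e + Q + 2 * K).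
  destruct (INR_unbounded (R0 ^ 2 + 1)) as [N2 HN2].
  exists (max N1 N2). intros n Hn.
  specialize (HN1 n ltac:(lia)). set (k := kn n) in *.
  assert (HnN : R0 ^ 2 + 1 < INR n) by (assert (INR N2 <= INR n) by (apply le_INR; lia); lra).
  set (r := sqrt (INR n)) in *.
  assert (Hn0 : 0 < INR n) by (pose proof (pow2_ge_0 R0); lra).
  assert (Hr2 : r * r = INR n) by (apply sqrt_sqrt; lra).
  assert (Hr0 : 0 < r) by (apply sqrt_lt_R0; auto).
  assert (HR0 : 0 < 4 * C1 / e) by (apply Rdiv_lt_0_compat; lra).
  assert (Hr : R0 < r) by (simpl in HnN; unfold R0 in *; nra).
  assert (Hr1 : 1 <= r) by (unfold R0 in Hr; lra).
  set (s := 1 - K / INR n). set (v := C1 / r).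
  assert (HKn : 0 < K / INR n <= 1 / 2).
  { split; [apply Rdiv_lt_0_compat; lra|]. apply Rmult_le_reg_r with (INR n); auto.
    unfold Rdiv. rewrite Rmult_assoc, Rinv_l by lra. unfold R0 in Hr. nra. }
  assert (Hv0 : 0 < v) by (apply Rdiv_lt_0_compat; lra).
  assert (Hve : v <= e / 4).
  { unfold v. apply Rmult_le_reg_r with (4 / e * r); [apply Rmult_lt_0_compat; [apply Rdiv_lt_0_compat; lra|auto]|].
    replace (C1 / r * (4 / e * r)) with (4 * C1 / e) by (field; lra).
    replace (e / 4 * (4 / e * r)) with r by (field; lra). unfold R0 in Hr. lra. }
  assert (HKr : K / INR n <= K / r).
  { rewrite <- Hr2. apply Rmult_le_compat_l; [lra|]. apply Rinv_le_contravar; nra. }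
  assert (Hb : 1 - s + v * (V + 2) <= Q / r).
  { unfold s, v. replace (1 - (1 - K / INR n)) with (K / INR n) by ring.
    apply Rle_trans with (K / r + C1 * (V + 2) / r).
    - apply Rplus_le_compat; auto. right. field. lra.
    - unfold Q, Rdiv. assert (0 < / r) by (apply Rinv_0_lt_compat; auto). nra. }
  assert (HQr : Q / r <= 1).
  { apply Rmult_le_reg_r with r; auto. unfold Rdiv. rewrite Rmult_assoc, Rinv_l by lra. unfold R0 in Hr. lra. }
  assert (Hkb : INR k * (1 - s + v * (V + 2)) <= e / 4).
  { apply Rle_trans with (e / (4 * Q) * r * (Q / r)); [|right; field; lra].
    apply Rmult_le_compat; auto; [apply pos_INR|]. unfold s.
    assert (0 <= v * (V + 2)) by nra. lra. }
  assert (Hs : / 2 <= s < 1) by (unfold s; lra).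
  destruct (mass_level_finite_variance V HV k s v) as (F & HF & HFm); try lra.
  { assert (E : p k0 * v ^ 2 = 4 * (K / INR n)).
    { unfold v. replace (p k0 * (C1 / r) ^ 2) with (p k0 * (C1 * C1) / (r * r)) by (field; lra).
      rewrite HC1sq, Hr2. field. lra. }
    rewrite E. unfold s at 1. nra. }
  set (small := fun q : etree Sp * list nat => Nat.leb (2 * esize (fst q)) n).
  assert (Hsub : forall f, pointed_at_level k (filter f F)).
  { intros f. destruct HF as [HF1 HF2]. split; [apply NoDup_filter; auto|].
    intros B a H. apply filter_In in H as [H _]. auto. }
  exists (filter small F). split; [apply Hsub|]. split.
  { intros B a H. apply filter_In in H as [_ H]. apply Nat.leb_le in H. exact H. }
  rewrite (sum_filter_split _ small) in HFm.
  assert (Hw : forall t, 0 <= ewprod gp t) by (intros; apply ewprod_ge0; intros; apply gpi_ge0; auto).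
  assert (A1 : sum_list (fun q => s ^ esize (fst q) * ewprod gp (fst q)) (filter small F)
      <= sum_list (fun q => ewprod gp (fst q)) (filter small F)).
  { apply sum_list_le. intros q _. specialize (Hw (fst q)).
    assert (s ^ esize (fst q) <= 1) by (rewrite <- (pow1 (esize (fst q))); apply pow_incr; lra). nra. }
  set (rest := filter (fun x => negb (small x)) F) in *.
  assert (A2 : sum_list (fun q => s ^ esize (fst q) * ewprod gp (fst q)) rest
      <= e / 2 * sum_list (fun q => ewprod gp (fst q)) rest).
  { rewrite <- sum_list_scal. apply sum_list_le. intros q Hq. apply filter_In in Hq as [_ Hq].
    unfold small in Hq. apply Bool.negb_true_iff, Nat.leb_gt in Hq.
    apply Rmult_le_compat_r; auto. set (m := esize (fst q)) in *.
    assert (Hm : INR n <= 2 * INR m) by (apply lt_INR in Hq; rewrite mult_INR in Hq; simpl in Hq; lra).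
    set (x := K / INR n) in *.
    assert (Hx : K / 2 <= INR m * x).
    { unfold x. apply Rmult_le_reg_r with (INR n); auto.
      replace (INR m * (K / INR n) * INR n) with (INR m * K) by (field; lra). nra. }
    apply Rle_trans with (exp (- (INR m * x))).
    - assert (He1 : s <= exp (- x)) by (pose proof (exp_ineq1_le (- x)); unfold s; lra).
      apply Rle_trans with (exp (- x) ^ m); [apply pow_incr; lra|].
      right. clear. induction m; [simpl; rewrite Rmult_0_l, Ropp_0, exp_0; auto|].
      rewrite S_INR, <- tech_pow_Rmult, IHm, <- exp_plus. f_equal. ring.
    - eapply Rle_trans; [apply exp_le_inv; lra|].
      replace (e / 2) with (/ (K / 2)) by (unfold K; field; lra).
      apply Rinv_le_contravar; lra. }
  assert (A3 : sum_list (fun q => ewprod gp (fst q)) rest <= 1).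
  { destruct (pointed_list_star k rest (Hsub _)) as [H1 H2]. rewrite <- H2.
    apply lawStar_sum_le; auto. }
  (* The losses are [v <= e / 4], [e / 4] from the levels, and [e / 2] from the discounted large
     trees, whose mass is at most 1. *)
  nra.
Qed.

Lemma total_variation_growing_level V (kn : nat -> nat) :
  infinite_sum (fun k => (INR k - 1) ^ 2 * p k) V -> o_sqrt kn -> forall eps, 0 < eps ->
  eventually_admissible (fun n => tv_le (lawn n (kn n)) (star (kn n)) eps).
Proof.
  intros HV Hkn eps He. set (e := Rmin (1 / 2) (eps / 2)).
  assert (He' : 0 < e <= 1 / 2) by (split; [apply Rmin_glb_lt; lra|apply Rmin_l]).
  assert (He2 : 2 * e <= eps) by (pose proof (Rmin_r (1 / 2) (eps / 2)); unfold e; lra).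
  destruct (star_mass_small_trees V kn e HV Hkn) as [N1 HN1]; [lra|].
  destruct (ratio_finite_variance p d bz pi_law_ge0 d_pos p_div bz_pos bz_sum p0_pos p_sum p_mean V HV e) as [N2 HN2]; [lra|].
  destruct ev_cz_pos as [N3 HN3].
  exists (max N1 (max N2 N3)). intros n Hn Hr.
  destruct (HN3 n ltac:(lia) Hr) as [Hn1 Hc]. pose proof (cz_omega_pos n Hn1 Hc).
  destruct (HN1 n ltac:(lia)) as (F & HF & Hsm & Hm).
  specialize (HN2 n ltac:(lia) (residue_divides n Hn1 Hr)).
  set (k := kn n) in *.
  destruct (pointed_list_star k F HF) as [HF1 HF2].
  intros l Hl. apply Rmult_le_reg_l with 2; [lra|]. rewrite <- Rmult_assoc, Rinv_r, Rmult_1_l by lra.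
  apply Rle_trans with (4 * e); [|lra].
  apply (total_variation_from_lower_bound (lawn n k) (star k) e (map Some F)); auto; try lra.
  - intros; apply lawH_ge0; auto.
  - intros; apply lawStar_ge0; auto.
  - intros; apply lawH_sum_le; auto.
  - intros; apply lawStar_sum_le; auto.
  - intros x Hx. apply in_map_iff in Hx as ([B a] & <- & Hx).
    destruct (proj2 HF B a Hx) as (HB & Ha & Hk). specialize (Hsm B a Hx).
    destruct (Req_dec (ewprod gp B) 0) as [E|E].
    + rewrite lawStar_valid, E, Rmult_0_r by auto. apply lawH_ge0; auto.
    + specialize (HN2 (esize B) Hsm (esize_residue B HB E)).
      eapply Rle_trans; [|apply (lawH_lower_star enum kappa enum_nodup enum_all kappa_ge0 tau Phi tau_pos Phi_pos); auto; lia].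
      rewrite Rmult_comm. apply Rmult_le_compat_l; [apply lawStar_ge0; auto|].
      apply Rmult_le_reg_r with (cz p n (Z.of_nat n - 1)); auto. unfold Rdiv. rewrite Rmult_assoc, Rinv_l by lra. lra.
Qed.
End Main.

Theorem mainTheorem5
  (Sp : nat -> Type) (enum : forall k, list (Sp k)) (kappa : forall k, Sp k -> R)
  (Henum_nodup : forall k, NoDup (enum k))
  (Henum_all : forall k (s : Sp k), In s (enum k))
  (Hkappa : forall k s, 0 <= kappa k s)
  (Hw0 : 0 < omega enum kappa 0)
  (Hw2 : exists k, (2 <= k)%nat /\ 0 < omega enum kappa k)
  (span : nat) (Hspan : is_span (omega enum kappa) span)
  (HI : typeI (omega enum kappa))
  (tau Phi Phi' : R) (Htau : 0 < tau)
  (HPhi : infinite_sum (fun k => omega enum kappa k * tau ^ k) Phi)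
  (HPhi' : infinite_sum (fun k => INR k * omega enum kappa k * tau ^ (k - 1)) Phi')
  (Hpsi : tau * Phi' / Phi = 1) :
  (* (1) convergence in distribution (discrete topology) for fixed k >= 1 *)
  (forall k : nat, (1 <= k)%nat ->
     forall g : @pointed Sp -> R, (exists M, forall x, Rabs (g x) <= M) ->
     exists s, usum (fun x => lawStar enum kappa tau Phi k x * g x) s /\
       forall eps, 0 < eps -> exists N, forall n, (N <= n)%nat ->
         n mod span = 1 mod span ->
         Rabs (EH enum kappa n k g - s) < eps)
  /\
  (* (2) type I alpha: sigma^2 < infinity *)
  ((exists v, infinite_sum (fun k => (INR k - 1) ^ 2 * pi enum kappa tau Phi k) v) ->
     forall kn : nat -> nat, o_sqrt kn ->
     forall eps, 0 < eps -> exists N, forall n, (N <= n)%nat ->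
       n mod span = 1 mod span ->
       tv_le (lawH enum kappa n (kn n)) (lawStar enum kappa tau Phi (kn n)) eps).
Proof.
  pose proof (omega_ge0 enum kappa Hkappa) as Hom.
  assert (HPhi0 : 0 < Phi).
  { eapply Rlt_le_trans; [|apply (partial_le_infinite_sum _ _ 0 (fun k => Rmult_le_pos _ _ (Hom k) (pow_le tau k (Rlt_le _ _ Htau))) HPhi)].
    simpl. lra. }
  assert (Hsum : infinite_sum (pi enum kappa tau Phi) 1).
  { replace 1 with (/ Phi * Phi) by (field; lra).
    eapply infinite_sum_ext; [|apply (infinite_sum_scal (/ Phi) _ _ HPhi)].
    intros k. unfold pi. simpl. field. lra. }
  (* Criticality enters here: the mean of [pi] is [tau * Phi' / Phi]. At [k = 0] the exponent
     [k - 1] is cut off at 0, but the factor [INR 0] removes the term. *)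
  assert (Hmean : infinite_sum (fun k => INR k * pi enum kappa tau Phi k) 1).
  { rewrite <- Hpsi. replace (tau * Phi' / Phi) with (tau / Phi * Phi') by (field; lra).
    eapply infinite_sum_ext; [|apply (infinite_sum_scal (tau / Phi) _ _ HPhi')].
    intros [|k]; unfold pi; [simpl; field; lra|].
    replace (S k - 1)%nat with k by lia. simpl pow. field. lra. }
  destruct Hw2 as (k0 & Hk0 & Hwk0).
  destruct (span_bezout _ _ Hspan) as (Hd & bz & Hbz & Hbs); [exists k0; split; [lia|auto]|].
  assert (Hdiv : forall k, 0 < pi enum kappa tau Phi k -> Nat.divide span k).
  { intros k Hk. apply Hspan. revert Hk. apply omega_pos; auto. }
  pose proof (pi_pos enum kappa tau Phi Htau HPhi0) as Hpos.
  split.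
  - intros k _ g [M HM].
    apply (convergence_fixed_level enum kappa Henum_nodup Henum_all Hkappa tau Phi Htau HPhi0 Hsum Hmean
      k0 span bz Hk0 (Hpos _ Hwk0) (Hpos _ Hw0) Hd Hdiv (fun q Hq => Hpos _ (Hbz q Hq)) Hbs k g M HM).
  - intros [v Hv] kn Hkn.
    apply (total_variation_growing_level enum kappa Henum_nodup Henum_all Hkappa tau Phi Htau HPhi0 Hsum Hmean
      k0 span bz Hk0 (Hpos _ Hwk0) (Hpos _ Hw0) Hd Hdiv (fun q Hq => Hpos _ (Hbz q Hq)) Hbs v kn Hv Hkn).
Qed.
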